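(* Let $0<s<1<p$, $sp<3$, $p<q<p^*_s$, where $p^*_s=\frac{3p}{3-sp}$. Let $A:\mathbb{R}^3\to\mathbb{R}^3$ be a continuous vector field with locally bounded gradient. Let $H,K$ be nontrivial (not a.e. zero) real functions on $\mathbb{R}^3$ with $0\le H\in L^{r}(\mathbb{R}^3,\mathbb{R})$, $r=\frac{p^*_s}{p^*_s-q}$, and $0\le K\in L^\infty(\mathbb{R}^3,\mathbb{R})\cap C(\mathbb{R}^3,\mathbb{R})$. Assume moreover that there exists $\Omega_H\subset\mathbb{R}^3$ with $|\Omega_H|>0$ and $H>0$ in $\Omega_H$. Then there exists $\lambda^*>0$ such that for every $\lambda>\lambda^*$ the equation $$(-\Delta)^s_{p,A}u=\lambda H(x)|u|^{q-2}u+K(x)|u|^{p^*_s-2}u\quad\text{in }\mathbb{R}^3$$ admits at least one nontrivial weak solution $u\in D^{s,p}_A(\mathbb{R}^3,\mathbb{C})$ with positive energy, i.e. $\mathcal{E}(u)>0$.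
   Context: For measurable $u:\mathbb{R}^3\to\mathbb{C}$ set $$[u]_{A,s,p}=\Big(\int_{\mathbb{R}^3\times\mathbb{R}^3}\frac{|e^{-i(x-y)\cdot A(\frac{x+y}{2})}u(x)-u(y)|^p}{|x-y|^{3+sp}}\,dx\,dy\Big)^{1/p}.$$ $D^{s,p}_A(\mathbb{R}^3,\mathbb{C})=\{u\in L^{p^*_s}(\mathbb{R}^3,\mathbb{C}):[u]_{A,s,p}<\infty\}$, a real Banach space with norm $[\cdot]_{A,s,p}$. The fractional magnetic $p$-Laplacian (constant normalized to $1$) is formally $$(-\Delta)^s_{p,A}u(x)=\lim_{\varepsilon\searrow0}\int_{\{|y-x|\ge\varepsilon\}}\frac{|u(x)-e^{i(x-y)\cdot A(\frac{x+y}{2})}u(y)|^{p-2}\big(u(x)-e^{i(x-y)\cdot A(\frac{x+y}{2})}u(y)\big)}{|x-y|^{3+sp}}\,dy.$$ The energy functional $\mathcal{E}:D^{s,p}_A(\mathbb{R}^3,\mathbb{C})\to\mathbb{R}$ is $$\mathcal{E}(u)=\frac1p[u]^p_{A,s,p}-\frac{\lambda}{q}\int_{\mathbb{R}^3}H|u|^q\,dx-\frac1{p^*_s}\int_{\mathbb{R}^3}K|u|^{p^*_s}\,dx .$$ Weak solutions are the critical points of $\mathcal{E}$: $u\in D^{s,p}_A(\mathbb{R}^3,\mathbb{C})$ is a weak solution if for all $v\in D^{s,p}_A(\mathbb{R}^3,\mathbb{C})$ $$\Re\int_{\mathbb{R}^3\times\mathbb{R}^3}\frac{|U|^{p-2}U\,\overline{V}}{|x-y|^{3+sp}}\,dx\,dy=\Re\Big(\lambda\int_{\mathbb{R}^3}H|u|^{q-2}u\,\overline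 v\,dx+\int_{\mathbb{R}^3}K|u|^{p^*_s-2}u\,\overline v\,dx\Big),$$ where $U=e^{-i(x-y)\cdot A(\frac{x+y}{2})}u(x)-u(y)$ and $V=e^{-i(x-y)\cdot A(\frac{x+y}{2})}v(x)-v(y)$. *)

(* Defs.v *)
From HB Require Import structures.
From mathcomp Require Import all_boot all_order all_algebra.
From mathcomp Require Import complex.
From mathcomp Require Import all_classical all_reals all_analysis.

Set Implicit Arguments.
Unset Strict Implicit.
Unset Printing Implicit Defensive.

Import Order.TTheory GRing.Theory Num.Theory.
Import numFieldNormedType.Exports.

Local Open Scope classical_set_scope.
Local Open Scope ring_scope.
Local Open Scope complex_scope.

(* The library's own sigma-finite instance on [\x] is shadowed by the one for
   subprobabilities, so it is proved again and attached to named measures. *)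
Lemma sigma_finite_product d1 d2 (T1 : measurableType d1)
    (T2 : measurableType d2) (R : realType)
    (m1 : {sigma_finite_measure set T1 -> \bar R})
    (m2 : {sigma_finite_measure set T2 -> \bar R}) :
  sigma_finite setT (m1 \x m2)%E.
Proof.
have /sigma_finiteP[F [TF ndF Foo]] := sigma_finiteT m1.
have /sigma_finiteP[G [TG ndG Goo]] := sigma_finiteT m2.
exists (fun n => F n `*` G n).
  rewrite -setXTT TF TG predeqE => -[x y]; split.
    move=> [/= [n _ Fnx] [k _ Gky]]; exists (maxn n k) => //; split.
    - by move: x Fnx; exact/subsetPset/ndF/leq_maxl.
    - by move: y Gky; exact/subsetPset/ndG/leq_maxr.
  by move=> [n _ []/= ? ?]; split; exists n.
move=> k; have [? ?] := Foo k; have [? ?] := Goo k.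
split; first exact: measurableX.
by rewrite product_measure1E// lte_mul_pinfty// ge0_fin_numE.
Qed.

Definition lebesgue2 (R : realType) :
    set (measurableTypeR R * measurableTypeR R)%type -> \bar R :=
  (lebesgue_measure \x lebesgue_measure)%E.
HB.instance Definition _ (R : realType) := Measure.on (@lebesgue2 R).
HB.instance Definition _ (R : realType) :=
  Measure_isSigmaFinite.Build _ _ _ (@lebesgue2 R)
    (sigma_finite_product lebesgue_measure lebesgue_measure).

(* Binary products carry both a measurable structure (here the Borel
   sigma-algebra) and a normed-module structure, which ['rV[R]_3] does not. The
   library norm on this type is the sup norm; the Euclidean one is [enorm]. *)
Definition R3 (R : realType) :=
  (measurableTypeR R * measurableTypeR R * measurableTypeR R)%type.

Definition lebesgue3 (R : realType) : set (R3 R) -> \bar R :=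
  (@lebesgue2 R \x lebesgue_measure)%E.
HB.instance Definition _ (R : realType) := Measure.on (@lebesgue3 R).
HB.instance Definition _ (R : realType) :=
  Measure_isSigmaFinite.Build _ _ _ (@lebesgue3 R)
    (sigma_finite_product (@lebesgue2 R) lebesgue_measure).

Section Definitions.
Variable R : realType.
Local Notation C := R[i].
Local Notation mu3 := (@lebesgue3 R).
Local Notation mu6 := (@lebesgue3 R \x @lebesgue3 R)%E.
Local Notation normc := (@ComplexField.Normc.normc R).

Definition dot3 (x y : R3 R) : R :=
  x.1.1 * y.1.1 + x.1.2 * y.1.2 + x.2 * y.2.

Definition enorm (x : R3 R) : R := Num.sqrt (dot3 x x).

Definition expi (t : R) : C := cos t +i* sin t.

Definition std_basis : set (R3 R) :=
  [set e | e = (1, 0, 0) \/ e = (0, 1, 0) \/ e = (0, 0, 1)].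

(* The gradient is the matrix of classical partial derivatives. *)
Definition locally_bounded_gradient (A : R3 R -> R3 R) : Prop :=
  forall e, std_basis e ->
    (forall x : R3 R, derivable A x e) /\
    (forall x : R3 R, bounded_near ('D_e A) (nbhs x)).

(* Componentwise; each component integral is the library's [Rintegral]. *)
Definition Cintegral d (T : measurableType d)
    (mu : {measure set T -> \bar R}) (f : T -> C) : C :=
  (\int[mu]_t complex.Re (f t)) +i* (\int[mu]_t complex.Im (f t)).

Definition Cmeasurable (u : R3 R -> C) : Prop :=
  measurable_fun setT (fun x => complex.Re (u x)) /\
  measurable_fun setT (fun x => complex.Im (u x)).

Definition CLfun (p : R) : set (R3 R -> C) :=
  [set u | Cmeasurable u /\ (fun x => normc (u x)) \in Lfun mu3 p%:E].

Definition magnetic_diff (A : R3 R -> R3 R) (u : R3 R -> C) (z : R3 R * R3 R) : C :=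
  expi (- dot3 (z.1 - z.2) (A (2^-1 *: (z.1 + z.2)))) * u z.1 - u z.2.

(* On the diagonal the denominators below vanish and the quotients are [0] by
   convention; the diagonal is a null set. *)
Definition gagliardo_denom (s p : R) (z : R3 R * R3 R) : R :=
  enorm (z.1 - z.2) `^ (3 + s * p).

Definition magnetic_seminorm (A : R3 R -> R3 R) (s p : R) (u : R3 R -> C) : \bar R :=
  ((\int[mu6]_z (normc (magnetic_diff A u z) `^ p / gagliardo_denom s p z)%:E) `^ p^-1)%E.

Definition pstar (s p : R) : R := 3 * p / (3 - s * p).

(* Elements are functions, not classes modulo a.e. equality. *)
Definition Dspace (A : R3 R -> R3 R) (s p : R) : set (R3 R -> C) :=
  [set u | CLfun (pstar s p) u /\ (magnetic_seminorm A s p u < +oo)%E].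

Definition energy (A : R3 R -> R3 R) (s p q lambda : R) (H K : R3 R -> R)
    (u : R3 R -> C) : R :=
  p^-1 * fine (magnetic_seminorm A s p u) `^ p
  - lambda / q * (\int[mu3]_x (H x * normc (u x) `^ q))
  - (pstar s p)^-1 * (\int[mu3]_x (K x * normc (u x) `^ pstar s p)).

(* [|z|^(p-2) z]. For [p < 2] this is [0] at [z = 0], as it should be, since
   [0 `^ a = 0] for [a != 0]. *)
Definition Cpow_duality (p : R) (z : C) : C := (normc z `^ (p - 2))%:C * z.

Definition weak_solution (A : R3 R -> R3 R) (s p q lambda : R) (H K : R3 R -> R)
    (u : R3 R -> C) : Prop :=
  Dspace A s p u /\
  forall v, Dspace A s p v ->
    complex.Re (Cintegral mu6 (fun z =>
      Cpow_duality p (magnetic_diff A u z) * conjc (magnetic_diff A v z)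
      / (gagliardo_denom s p z)%:C))
    = complex.Re
        (lambda%:C * Cintegral mu3 (fun x =>
           (H x)%:C * Cpow_duality q (u x) * conjc (v x))
         + Cintegral mu3 (fun x =>
           (K x)%:C * Cpow_duality (pstar s p) (u x) * conjc (v x))).

End Definitions.

(* Main.v *)
(* The term K|u|^Q (Q = p*_s) is first replaced by K W^(Q-e) |u|^e with e < Q and
   W^Q an integrable Gaussian. The perturbed problem is subcritical, and its
   solutions are minimizers of (1/p-1/q) B1 + (1/p-1/e) B2 under the constraint
   0 < N <= B1 + B2, where N is the p-th power of the seminorm and B1, B2 are the
   two right-hand terms. For large lambda the minimum is small, so N is small,
   and the K-term, which grows faster than N, absorbs at most half of N; the H-term
   is then bounded below independently of e. As e tends to Q, a subsequence
   converges a.e. to some u; the H-term is continuous along it, so u is nonzero,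
   and the weak equations pass to the limit. No compactness at the critical
   exponent is needed. Testing with u
   itself shows that the energy of u is (1/p-1/q) B1 + (1/p-1/Q) B2 > 0.

   The Sobolev inequality follows by comparing |u(x)| with its averages over cubes
   of optimal size around x, the phase being harmless because
   |u(x)| <= |u(y)| + |U(x,y)|. Almost everywhere convergent subsequences come
   from averages over fine grids, where the phase is small because A is locally
   bounded. *)

(* Both right-hand terms get one shape, the integral of [k h^(Q-e) |u|^e] with [h^Q] integrable: the
   weight [H] is [h^(Q-q)] because [r = Q/(Q-q)], and [K W^(Q-e)] has this form by construction. For
   [e < Q] the integrand is at most [eps |u|^Q] plus a multiple of [h^Q], so bounded sequences that
   converge a.e. lose nothing in the limit and the direct method applies. At [e = Q] this fails, but
   the derivative in a fixed direction [v] is still dominated by [eps (h + |u|)^Q] plus a multiple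
   of [|v|^Q]. Hence the equations survive the limit although the K-term and the seminorm may lose
   mass; this is why nontriviality must rest on the H-term alone, and why the energy is read off the
   equation of the limit and not passed to the limit. Every constant has to be free of [e], which
   explains the crude bounds and the added 1's.

   The variational part knows only a linear map [L], a weight, a Sobolev inequality and local
   compactness; the magnetic difference enters afterwards. *)
Require Import Defs.
From mathcomp Require Import all_boot all_order all_algebra.
From mathcomp Require Import complex.
From mathcomp Require Import all_classical all_reals all_analysis.
From mathcomp Require Import measurable_realfun ring lra zify.

Import Order.TTheory GRing.Theory Num.Theory.
Import numFieldNormedType.Exports.

Local Open Scope classical_set_scope.
Local Open Scope ring_scope.

(** * Powers, moduli and limits of integrals *)

Section powR_inequalities.
Context {R : realType}.

Lemma eq_ler (x y : R) : x = y -> x <= y. Proof. by move->. Qed.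

(** Young's inequality without sharp constants, by comparing [b] with [d * a], where [d^be = e]:
    below the threshold [b^be] is at most [e * a^be], above it [a^al] is at most [(b / d)^al]. The
    small coefficient on one side is the source of all equi-integrability below. *)
Lemma powR_mixed_small (a b e al be : R) : 0 < al -> 0 < be -> 0 < e ->
  0 <= a -> 0 <= b ->
  a `^ al * b `^ be <=
  e * a `^ (al + be) + (e `^ be^-1) `^ (- al) * b `^ (al + be).
Proof.
move=> al0 be0 e0 a0 b0.
set d := e `^ be^-1.
have d0 : 0 < d by exact: powR_gt0.
have s0 : 0 < al + be by exact: addr_gt0.
have powD (c : R) : 0 <= c -> c `^ (al + be) = c `^ al * c `^ be.
  by move=> c0; rewrite powRD// (gt_eqF s0).
have [bda|dab] := leP b (d * a).
  apply: (@le_trans _ _ (e * a `^ (al + be))).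
    rewrite powD// mulrCA ler_wpM2l ?powR_ge0//.
    have -> : e * a `^ be = (d * a) `^ be.
      by rewrite powRM ?(ltW d0)// /d -powRrM mulVf ?powRr1 ?(ltW e0)// gt_eqF.
    by rewrite ge0_ler_powR ?(ltW be0)// nnegrE ?mulr_ge0// ltW.
  by rewrite lerDl mulr_ge0// powR_ge0.
apply: (@le_trans _ _ (d `^ (- al) * b `^ (al + be))); last first.
  by rewrite lerDr mulr_ge0// ?powR_ge0// ltW.
rewrite powD// mulrA ler_wpM2r ?powR_ge0//.
have -> : d `^ (- al) * b `^ al = (b / d) `^ al.
  rewrite powRM ?invr_ge0 ?(ltW d0)// mulrC; congr (_ * _).
  by rewrite -(powR_inv1 (ltW d0)) -powRrM mulN1r.
by rewrite ge0_ler_powR ?(ltW al0)// ?nnegrE ?divr_ge0 ?(ltW d0)// ler_pdivlMr// mulrC ltW.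
Qed.

Lemma powR_addl_le (a b p : R) : 0 < p -> 0 <= a -> 0 <= b ->
  (a + b) `^ p <= 2 `^ p * (a `^ p + b `^ p).
Proof.
move=> p0 a0 b0.
have h (x y : R) : 0 <= x -> 0 <= y -> x <= y ->
    (x + y) `^ p <= 2 `^ p * (x `^ p + y `^ p).
  move=> x0 y0 xy; apply: (@le_trans _ _ ((2 * y) `^ p)).
    rewrite ge0_ler_powR ?(ltW p0)// ?nnegrE; lra.
  by rewrite powRM// ler_wpM2l ?powR_ge0// lerDr powR_ge0.
have [ab|/ltW ba] := leP a b; first exact: h.
by rewrite addrC [X in 2 `^ p * X]addrC; exact: h.
Qed.

(** Both bases are at most [h + a]. The exponent [e] disappears on the right, so one majorant serves
    a whole sequence of exponents. *)
Lemma powR_interp_le (h a e Q : R) : 0 <= h -> 0 <= a -> 1 < e -> e <= Q ->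
  h `^ (Q - e) * a `^ (e - 1) <= (h + a) `^ (Q - 1).
Proof.
move=> h0 a0 e1 eQ.
apply: (@le_trans _ _ ((h + a) `^ (Q - e) * (h + a) `^ (e - 1))).
  have ha0 : 0 <= h + a by exact: addr_ge0.
  apply: ler_pM; rewrite ?powR_ge0//.
    by rewrite ge0_ler_powR ?subr_ge0 ?nnegrE// lerDl.
  by rewrite ge0_ler_powR ?subr_ge0 ?(ltW e1) ?nnegrE// lerDr.
have E : Q - e + (e - 1) = Q - 1 by lra.
by rewrite -powRD E// gt_eqF// subr_gt0 (lt_le_trans e1).
Qed.

(** Convexity in tangent form: for [b <= a], Young's inequality for [b] and [a^(p-1)] rearranges to
    [a^p - b^p <= p (a - b) a^(p-1)]. *)
Lemma powR_diff_le (x y p : R) : 1 < p -> 0 <= x -> 0 <= y ->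
  `|x `^ p - y `^ p| <= p * `|x - y| * (Num.max x y) `^ (p - 1).
Proof.
move=> p1.
have h (a b : R) : 0 <= a -> 0 <= b -> b <= a -> a `^ p - b `^ p <= p * (a - b) * a `^ (p - 1).
  move=> a0 b0 ba.
  have p0 : 0 < p by exact: lt_trans p1.
  have pB0 : 0 < p - 1 by rewrite subr_gt0.
  have := @conjugate_powR _ b (a `^ (p - 1)) p (p / (p - 1)) b0 (powR_ge0 _ _) p0
    (divr_gt0 p0 pB0).
  rewrite invf_div mulrBl mul1r divff ?gt_eqF// addrC subrK => /(_ erefl).
  rewrite -powRrM mulrCA divff ?gt_eqF// mulr1.
  have ap : a `^ p = a * a `^ (p - 1) by rewrite mulr_powRB1.
  rewrite ap => H.
  have E : p * (b `^ p / p + a * a `^ (p - 1) * (1 - p^-1)) =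
     b `^ p + (p - 1) * (a * a `^ (p - 1)).
    by field; rewrite gt_eqF.
  have : p * (b * a `^ (p - 1)) <= b `^ p + (p - 1) * (a * a `^ (p - 1)).
    by rewrite -E ler_pM2l.
  lra.
move=> x0 y0; have [xy|/ltW yx] := leP x y.
  rewrite distrC (distrC x) !ger0_norm ?subr_ge0//; first exact: h.
  by rewrite ge0_ler_powR// (ltW (lt_trans _ p1)).
rewrite !ger0_norm ?subr_ge0//; first exact: h.
by rewrite ge0_ler_powR// (ltW (lt_trans _ p1)).
Qed.

(** Above the level [al] the factor [(a / al)^(p-1)] is at least 1. Splitting at a free level
    replaces Hölder's inequality where a first power is averaged and only p-th powers are
    controlled. *)
Lemma le_truncated (a al p : R) : 1 < p -> 0 < al -> 0 <= a ->
  a <= al + al `^ (1 - p) * a `^ p.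
Proof.
move=> p1 al0 a0; have [aal|ala] := leP a al.
  by rewrite (le_trans aal)// lerDl mulr_ge0// powR_ge0.
apply: (@le_trans _ _ (al `^ (1 - p) * a `^ p)); last by rewrite lerDr ltW.
rewrite -(mulr_powRB1 a0 (lt_trans ltr01 p1)) mulrCA ler_peMr//.
rewrite -opprB powRN mulrC ler_pdivlMr ?powR_gt0// mul1r.
by rewrite ge0_ler_powR ?nnegrE ?subr_ge0 ?(ltW p1) ?(ltW al0) ?(ltW ala).
Qed.

(** The power is discontinuous where base and exponent both vanish, since [0^0 = 1]; the lower bound
    [eb] on the exponents keeps away from that point. *)
Lemma cvg_powR (x e : nat -> R) (x0 e0 eb : R) :
  0 < eb -> (forall n, eb <= e n) -> (forall n, 0 <= x n) ->
  x @ \oo --> x0 -> e @ \oo --> e0 ->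
  (fun n => x n `^ e n) @ \oo --> x0 `^ e0.
Proof.
move=> eb0 ebe x_ge0 xx0 ee0.
have x00 : 0 <= x0.
  by rewrite -(cvg_lim _ xx0)//; apply: limr_ge; [exact: cvgP xx0|exact: nearW].
have [x0E|x0_neq0] := eqVneq x0 0.
  have e00 : 0 < e0.
    rewrite (lt_le_trans eb0)// -(cvg_lim _ ee0)//.
    by apply: limr_ge; [exact: cvgP ee0|exact: nearW].
  rewrite x0E powR0 ?gt_eqF//.
  apply/cvgrPdist_le => eps eps0.
  (* The bound 1 gives [x^e <= x^eb], the other bound gives [x^eb <= eps]. *)
  have d0 : 0 < Num.min 1 (eps `^ eb^-1) by rewrite lt_min ltr01 powR_gt0.
  have /cvgrPdist_le/(_ _ d0) := xx0; apply: filterS => n.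
  rewrite x0E !sub0r !normrN (ger0_norm (x_ge0 n)) (ger0_norm (powR_ge0 _ _)).
  rewrite le_min => /andP[x1 xe].
  have [->|xn0] := eqVneq (x n) 0.
    by rewrite powR0 ?(ltW eps0)// gt_eqF// (lt_le_trans eb0).
  apply: (@le_trans _ _ (x n `^ eb)).
    by apply: ger_powR => //; rewrite x1 andbT lt_neqAle eq_sym xn0 x_ge0.
  have -> : eps = (eps `^ eb^-1) `^ eb.
    by rewrite -powRrM mulVf ?powRr1 ?(ltW eps0)// gt_eqF.
  by rewrite ge0_ler_powR ?(ltW eb0) ?nnegrE ?powR_ge0.
have x0gt : 0 < x0 by rewrite lt_neqAle eq_sym x0_neq0.
have H : (fun n => expR (e n * ln (x n))) @ \oo --> expR (e0 * ln x0).
  apply: continuous_cvg; first exact: continuous_expR.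
  apply: cvgM => //; apply: continuous_cvg => //; exact: continuous_ln.
rewrite /powR (negbTE x0_neq0); apply: cvg_trans H; apply: near_eq_cvg.
have /cvgrPdist_lt/(_ _ x0gt) := xx0; apply: filterS => n.
by case: eqP => // ->; rewrite subr0 gtr0_norm// ltxx.
Qed.

End powR_inequalities.

(** * Complex moduli and the duality pairing *)

Section complex_modulus.
Context {R : realType}.
Local Notation C := R[i].
Local Notation Re := (@complex.Re R).
Local Notation Im := (@complex.Im R).
Local Notation nc := (@ComplexField.Normc.normc R).
Implicit Types z v w : C.

Definition cdot z v : R := Re z * Re v + Im z * Im v.

(** This is the real part of [|z|^(e-2) z conj(v)], that is, [1/e] times the derivative of the e-th
    power of the modulus at [z] in the direction [v]. *)
Definition cdual (e : R) z v : R := nc z `^ (e - 2) * cdot z v.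

Lemma normcE_sqrt z : nc z = Num.sqrt (Re z ^+ 2 + Im z ^+ 2).
Proof. by case: z. Qed.

Lemma complexReD z w : Re (z + w) = Re z + Re w. Proof. by case: z; case: w. Qed.
Lemma complexImD z w : Im (z + w) = Im z + Im w. Proof. by case: z; case: w. Qed.
Lemma complexReB z w : Re (z - w) = Re z - Re w. Proof. by case: z; case: w. Qed.
Lemma complexImB z w : Im (z - w) = Im z - Im w. Proof. by case: z; case: w. Qed.
Lemma complexReZ (t : R) z : Re (t%:C%C * z) = t * Re z.
Proof. by case: z => a b /=; rewrite mul0r subr0. Qed.
Lemma complexImZ (t : R) z : Im (t%:C%C * z) = t * Im z.
Proof. by case: z => a b /=; rewrite mul0r addr0. Qed.

Lemma normc_ge0 z : 0 <= nc z.
Proof. by rewrite normcE_sqrt sqrtr_ge0. Qed.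

Lemma normc_sqr z : nc z ^+ 2 = Re z ^+ 2 + Im z ^+ 2.
Proof. by rewrite normcE_sqrt sqr_sqrtr// addr_ge0// sqr_ge0. Qed.

Lemma ler_normcD z w : nc (z + w) <= nc z + nc w.
Proof. exact: le_normcD. Qed.

Lemma normcZ (t : R) z : nc (t%:C%C * z) = `|t| * nc z.
Proof. by rewrite ComplexField.Normc.normcM /= expr0n/= addr0 sqrtr_sqr. Qed.

Lemma normcB z w : nc (z - w) = nc (w - z).
Proof. by rewrite -[LHS]normcN opprB. Qed.

Lemma ler_normc_sub z w : `|nc z - nc w| <= nc (z - w).
Proof.
rewrite ler_norml lerBlDr lerNl opprB lerBlDr normcB.
apply/andP; split.
  by have := ler_normcD (w - z) z; rewrite subrK.
by have := ler_normcD (z - w) w; rewrite subrK normcB.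
Qed.

Lemma norm_Re_le z : `|Re z| <= nc z.
Proof.
rewrite -[leLHS]sqrtr_sqr normcE_sqrt ler_wsqrtr// lerDl sqr_ge0//.
Qed.

Lemma norm_Im_le z : `|Im z| <= nc z.
Proof.
rewrite -[leLHS]sqrtr_sqr normcE_sqrt ler_wsqrtr// lerDr sqr_ge0//.
Qed.

Lemma normc_le_ReIm z : nc z <= `|Re z| + `|Im z|.
Proof.
rewrite -(@ler_pXn2r _ 2) ?nnegrE ?normc_ge0 ?addr_ge0// normc_sqr sqrrD.
rewrite !real_normK ?num_real//.
have : 0 <= `|Re z| * `|Im z| by rewrite mulr_ge0.
lra.
Qed.

Lemma norm_cdot_le z v : `|cdot z v| <= nc z * nc v.
Proof.
rewrite -(@ler_pXn2r _ 2) ?nnegrE ?mulr_ge0 ?normc_ge0// exprMn !normc_sqr.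
rewrite real_normK ?num_real// /cdot -subr_ge0.
rewrite [X in 0 <= X](_ : _ = (Re z * Im v - Im z * Re v) ^+ 2) ?sqr_ge0//.
ring.
Qed.

Lemma cdotzz z : cdot z z = nc z ^+ 2.
Proof. by rewrite normc_sqr /cdot -!expr2. Qed.

Lemma Re_mul_conjc z v : Re (z * conjc v) = cdot z v.
Proof. by case: z => a b; case: v => c d; rewrite /cdot /= mulrN opprK. Qed.

Lemma norm_cdual_le (e : R) z v : 1 < e -> `|cdual e z v| <= nc z `^ (e - 1) * nc v.
Proof.
move=> e1; rewrite /cdual normrM (ger0_norm (powR_ge0 _ _)).
have [z0|z_neq0] := eqVneq (nc z) 0.
  apply: (@le_trans _ _ 0); last by rewrite mulr_ge0 ?powR_ge0 ?normc_ge0.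
  rewrite (_ : `|cdot z v| = 0) ?mulr0//; apply/eqP; rewrite eq_le normr_ge0 andbT.
  by rewrite (le_trans (norm_cdot_le _ _))// z0 mul0r.
apply: (@le_trans _ _ (nc z `^ (e - 2) * (nc z * nc v))).
  by rewrite ler_wpM2l ?powR_ge0// norm_cdot_le.
rewrite mulrA ler_wpM2r ?normc_ge0// mulrC.
have -> : e - 2 = (e - 1) - 1 by lra.
by rewrite mulr_powRB1 ?normc_ge0// subr_gt0.
Qed.

Lemma cdualzz (e : R) z : 1 < e -> cdual e z z = nc z `^ e.
Proof.
move=> e1; rewrite /cdual cdotzz.
have [->|z0] := eqVneq (nc z) 0.
  by rewrite expr0n/= mulr0 powR0// gt_eqF// (lt_trans _ e1).
by rewrite -powR_mulrn ?normc_ge0// -powRD ?subrK// z0 implybT.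
Qed.

Lemma Re_Cpow_duality (e : R) z v : Re (Cpow_duality e z * conjc v) = cdual e z v.
Proof.
rewrite Re_mul_conjc /Cpow_duality /cdual /cdot.
by case: z => a b /=; rewrite !mul0r subr0 addr0 mulrDr !mulrA.
Qed.

Definition ccvg (z_ : nat -> C) z :=
  (Re \o z_) @ \oo --> Re z /\ (Im \o z_) @ \oo --> Im z.

Lemma ccvg_normcB (z_ : nat -> C) z : ccvg z_ z <-> (fun n => nc (z_ n - z)) @ \oo --> (0 : R).
Proof.
split=> [[zR zI]|z0].
  apply: (@squeeze_cvgr _ _ _ _ (cst 0) (fun n => `|Re (z_ n - z)| + `|Im (z_ n - z)|)).
  - by apply: nearW => n; rewrite normc_ge0 normc_le_ReIm.
  - exact: cvg_cst.
  - have h (f : nat -> R) (l : R) : f @ \oo --> l -> (fun n => `|f n - l|) @ \oo --> (0 : R).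
      by move=> fl; rewrite -[X in _ --> X](normr0 R) -(subrr l); apply: cvg_norm; apply: cvgB => //; exact: cvg_cst.
    rewrite -[X in _ --> X](addr0 0); apply: cvgD; [move: zR => /h|move: zI => /h].
      by apply: cvg_trans; apply: near_eq_cvg; apply: nearW => n /=; rewrite complexReB.
    by apply: cvg_trans; apply: near_eq_cvg; apply: nearW => n /=; rewrite complexImB.
have h (f : nat -> R) (l : R) : (forall n, `|f n - l| <= nc (z_ n - z)) -> f @ \oo --> l.
  move=> fl; apply/cvgrPdist_le => eps eps0.
  have /cvgrPdist_le/(_ _ eps0) := z0; apply: filterS => n.
  rewrite sub0r normrN ger0_norm ?normc_ge0// distrC; exact: le_trans.
split; apply: h => n /=; rewrite -?complexReB -?complexImB; [exact: norm_Re_le|exact: norm_Im_le].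
Qed.

Lemma ccvg_normc (z_ : nat -> C) z : ccvg z_ z -> (nc \o z_) @ \oo --> nc z.
Proof.
move=> /ccvg_normcB z0; apply/cvgrPdist_le => eps eps0.
have /cvgrPdist_le/(_ _ eps0) := z0; apply: filterS => n.
rewrite sub0r normrN ger0_norm ?normc_ge0// distrC; apply: le_trans.
exact: ler_normc_sub.
Qed.

(** For [e < 2] the factor [|z|^(e-2)] blows up at 0. Where the limit vanishes, convergence comes
    instead from the bound [|z|^(e-1) |v|], whose exponents stay at least [eb - 1 > 0]. *)
Lemma ccvg_cdual (z_ : nat -> C) z v (e_ : nat -> R) (e eb : R) : 1 < eb ->
  (forall n, eb <= e_ n) -> e_ @ \oo --> e -> ccvg z_ z ->
  (fun n => cdual (e_ n) (z_ n) v) @ \oo --> cdual e z v.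
Proof.
move=> eb1 ebe ee zz; have e1 n : 1 < e_ n by exact: lt_le_trans (ebe n).
have ebl : eb <= e by rewrite -(cvg_lim _ ee)//; apply: limr_ge; [exact: cvgP ee|exact: nearW].
have ncz := ccvg_normc _ _ zz.
have [z0|z_neq0] := eqVneq (nc z) 0.
  have -> : cdual e z v = 0.
    apply/eqP; rewrite -normr_le0.
    rewrite (le_trans (norm_cdual_le _ _ _ _)) ?(lt_le_trans eb1)// z0 powR0 ?mul0r//.
    by rewrite subr_eq0 gt_eqF// (lt_le_trans eb1).
  have H : (fun n => nc (z_ n) `^ (e_ n - 1) * nc v) @ \oo --> (0 : R).
    rewrite -(mul0r (nc v)); apply: cvgM; last exact: cvg_cst.
    have -> : (0 : R) = nc z `^ (e - 1).
      by rewrite z0 powR0// subr_eq0 gt_eqF// (lt_le_trans eb1).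
    apply: (@cvg_powR _ _ _ _ _ (eb - 1)) => //.
    - by rewrite subr_gt0.
    - by move=> n; rewrite lerD2r.
    - by move=> n; rewrite normc_ge0.
    - by apply: cvgB => //; exact: cvg_cst.
  apply/cvgrPdist_le => eps eps0.
  have /cvgrPdist_le/(_ _ eps0) := H; apply: filterS => n.
  rewrite !sub0r !normrN; apply: le_trans; rewrite (le_trans (norm_cdual_le _ _ _ (e1 n)))//.
  exact: ler_norm.
have z_gt0 : 0 < nc z by rewrite lt_neqAle eq_sym z_neq0 normc_ge0.
apply: cvgM; last first.
  by apply: cvgD; (apply: cvgM; [|exact: cvg_cst]); [exact: zz.1|exact: zz.2].
have H : (fun n => expR ((e_ n - 2) * ln (nc (z_ n)))) @ \oo --> expR ((e - 2) * ln (nc z)).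
  apply: continuous_cvg; first exact: continuous_expR.
  apply: cvgM; first by apply: cvgB => //; exact: cvg_cst.
  by apply: continuous_cvg => //; exact: continuous_ln.
rewrite /powR (negbTE z_neq0); apply: cvg_trans H; apply: near_eq_cvg.
have /cvgrPdist_lt/(_ _ z_gt0) := ncz; apply: filterS => n /=.
by case: eqP => // ->; rewrite subr0 gtr0_norm// ltxx.
Qed.

End complex_modulus.

(** * Limit theorems of Fatou and Vitali type *)

Section integral_limits.
Context {d} {T : measurableType d} {R : realType}.
Variable mu : {measure set T -> \bar R}.

Definition rintegrable (f : T -> R) := mu.-integrable setT (EFin \o f).

Lemma ge0_rintegrable (f : T -> R) : measurable_fun setT f ->
  (forall x, 0 <= f x) -> (\int[mu]_x (f x)%:E < +oo)%E -> rintegrable f.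
Proof.
move=> mf f0 foo; apply/integrableP; split; first exact/measurable_EFinP.
by under eq_integral do rewrite /= ger0_norm//.
Qed.

Lemma rintegrable_measurable (f : T -> R) : rintegrable f -> measurable_fun setT f.
Proof. by move=> /measurable_int/measurable_EFinP. Qed.

Lemma rintegrable_lty (f : T -> R) : rintegrable f -> (forall x, 0 <= f x) ->
  (\int[mu]_x (f x)%:E < +oo)%E.
Proof.
move=> /integrableP[_ H] f0.
by move: H; under eq_integral do rewrite /= ger0_norm//.
Qed.

Lemma rintegrableE (f : T -> R) : rintegrable f ->
  (\int[mu]_x (f x)%:E)%E = (\int[mu]_x f x)%:E.
Proof. by move=> fi; rewrite /Rintegral fineK//; exact: integrable_fin_num. Qed.

Lemma le_rintegrable (f g : T -> R) : measurable_fun setT f ->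
  (forall x, `|f x| <= g x) -> rintegrable g -> rintegrable f.
Proof.
move=> mf fg; apply: le_integrable => //; first exact/measurable_EFinP.
by move=> x _ /=; rewrite lee_fin (le_trans (fg x))// ler_norm.
Qed.

Lemma rintegrableD (f g : T -> R) : rintegrable f -> rintegrable g ->
  rintegrable (fun x => f x + g x).
Proof. by move=> fi gi; have := integrableD measurableT fi gi. Qed.

Lemma rintegrableB (f g : T -> R) : rintegrable f -> rintegrable g ->
  rintegrable (fun x => f x - g x).
Proof. by move=> fi gi; have := integrableB measurableT fi gi. Qed.

Lemma rintegrableZ (k : R) (f : T -> R) : rintegrable f ->
  rintegrable (fun x => k * f x).
Proof. by move=> fi; have := integrableZl measurableT k fi. Qed.

Lemma rintegrable_norm (f : T -> R) : rintegrable f -> rintegrable (fun x => `|f x|).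
Proof. by move=> /integrable_norm. Qed.

Lemma rintegralD (f g : T -> R) : rintegrable f -> rintegrable g ->
  \int[mu]_x (f x + g x) = \int[mu]_x f x + \int[mu]_x g x.
Proof. exact: RintegralD. Qed.

Lemma rintegralB (f g : T -> R) : rintegrable f -> rintegrable g ->
  \int[mu]_x (f x - g x) = \int[mu]_x f x - \int[mu]_x g x.
Proof. exact: RintegralB. Qed.

Lemma rintegralZ (k : R) (f : T -> R) : rintegrable f ->
  \int[mu]_x (k * f x) = k * \int[mu]_x f x.
Proof. exact: RintegralZl. Qed.

Lemma le_rintegral (f g : T -> R) : rintegrable f -> rintegrable g ->
  (forall x, f x <= g x) -> \int[mu]_x f x <= \int[mu]_x g x.
Proof. by move=> fi gi fg; apply: le_Rintegral. Qed.

Lemma rintegral_ge0 (f : T -> R) : (forall x, 0 <= f x) -> 0 <= \int[mu]_x f x.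
Proof. by move=> f0; apply: Rintegral_ge0. Qed.

Lemma rintegrable_indic (X : set T) : measurable X -> (mu X < +oo)%E ->
  rintegrable (\1_X : T -> R).
Proof.
move=> mX Xoo; apply: ge0_rintegrable.
- by have /measurable_indicP := mX.
- by move=> x; rewrite indicE.
- by rewrite integral_indic// setIT.
Qed.

Lemma rintegral_indic (X : set T) : measurable X ->
  \int[mu]_x (\1_X x : R) = fine (mu X).
Proof. by move=> mX; rewrite /Rintegral integral_indic// setIT. Qed.

Lemma fatou_bound (g_ : nat -> T -> R) (g : T -> R) (M : \bar R) :
  (forall n, measurable_fun setT (g_ n)) -> measurable_fun setT g ->
  (forall n x, 0 <= g_ n x) -> (forall x, 0 <= g x) ->
  {ae mu, forall x, g_ ^~ x @ \oo --> g x} ->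
  (forall n, \int[mu]_x (g_ n x)%:E <= M)%E ->
  (\int[mu]_x (g x)%:E <= M)%E.
Proof.
move=> mg_ mg g_0 g0 g_g leM.
have mE n : measurable_fun setT (EFin \o g_ n) by exact/measurable_EFinP.
have := @fatou _ _ _ mu _ measurableT (fun n => EFin \o g_ n) mE
  (fun n x _ => g_0 n x : (0 <= (g_ n x)%:E)%E).
set L := (X in (_ <= X)%E) => fat.
have LM : (L <= M)%E.
  rewrite /L limn_einf_lim; apply: lime_le; first exact: is_cvg_einfs.
  apply: nearW => n; apply: le_trans (leM n).
  by apply: ereal_inf_lbound; exists n => //=.
apply: le_trans LM; apply: le_trans fat.
apply: ae_ge0_le_integral => //.
- by move=> x _; rewrite lee_fin.
- exact/measurable_EFinP.
- move=> x _; rewrite limn_einf_lim; apply: lime_ge; first exact: is_cvg_einfs.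
  by apply: nearW => n; apply: le_ereal_inf_tmp => _ [m _ <-] /=; rewrite lee_fin.
- have -> : (fun x => limn_einf ((fun n => EFin \o g_ n) ^~ x)) =
     (fun x => - limn_esup (fun n => - (g_ n x)%:E))%E by [].
  apply: measurableT_comp => //; apply: measurable_fun_limn_esup => n.
  by apply: measurableT_comp => //; exact: mE.
- apply: filterS g_g => x gx _.
  have H : (fun n => (EFin \o g_ n) x) @ \oo --> (g x)%:E by apply: cvg_EFin => //; exact: nearW.
  by have [-> _] := cvg_limn_einf_sup H.
Qed.

Lemma fatou_cvg (g_ : nat -> T -> R) (g : T -> R) (c_ : nat -> R) (c : R) :
  (forall n, measurable_fun setT (g_ n)) -> measurable_fun setT g ->
  (forall n x, 0 <= g_ n x) -> (forall x, 0 <= g x) ->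
  {ae mu, forall x, g_ ^~ x @ \oo --> g x} ->
  (forall n, \int[mu]_x (g_ n x)%:E <= (c_ n)%:E)%E -> c_ @ \oo --> c ->
  (\int[mu]_x (g x)%:E <= c%:E)%E.
Proof.
move=> mg_ mg g_0 g0 g_g lec cc; apply/lee_addgt0Pr => e e0.
have /cvgrPdist_le/(_ _ e0)[N _ HN] := cc.
apply: (@fatou_bound (fun n => g_ (n + N)%N)) => //.
  by apply: filterS g_g => x; rewrite -(cvg_shiftn N).
move=> n; apply: (le_trans (lec _)); rewrite -EFinD lee_fin.
have := HN (n + N)%N (leq_addl _ _); rewrite /= ler_norml; lra.
Qed.

(* The truncation [h n] below converges to 0 and is dominated by [|g| + Y],
   while [|g_ n - g| <= h n + e * P n]. *)
Lemma cvg_Rintegral_equi (g_ P : nat -> T -> R) (g : T -> R) (M : R) :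
  (forall n, measurable_fun setT (g_ n)) -> measurable_fun setT g ->
  {ae mu, forall x, g_ ^~ x @ \oo --> g x} ->
  (forall n, measurable_fun setT (P n)) -> (forall n x, 0 <= P n x) ->
  (forall n, \int[mu]_x (P n x)%:E <= M%:E)%E ->
  (forall e : R, 0 < e -> exists2 Y, rintegrable Y &
     forall n x, `|g_ n x| <= e * P n x + Y x) ->
  [/\ rintegrable g, forall n, rintegrable (g_ n) &
    (fun n => \int[mu]_x g_ n x) @ \oo --> \int[mu]_x g x].
Proof.
move=> mg_ mg g_g mP P0 PM dom.
have Pi n : rintegrable (P n).
  by apply: ge0_rintegrable => //; apply: le_lt_trans (PM n) _; rewrite ltry.
have g_i n : rintegrable (g_ n).
  have [Y Yi HY] := dom _ ltr01; apply: (le_rintegrable _ _ _ (HY n)) => //.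
  by apply: rintegrableD => //; exact: rintegrableZ.
have M0 : 0 <= M.
  by rewrite -lee_fin; apply: le_trans (PM 0%N); apply: integral_ge0 => x _; rewrite lee_fin.
have gi : rintegrable g.
  have [Y Yi HY] := dom _ ltr01.
  suff : rintegrable (fun x => `|g x|).
    by apply: le_rintegrable => // x.
  have Yn := rintegrable_norm _ Yi.
  apply: ge0_rintegrable => //; first exact: measurableT_comp.
  apply: (@le_lt_trans _ _ (M%:E + \int[mu]_x (`|Y x|)%:E)%E); last first.
    by rewrite lte_add_pinfty ?ltry//; apply: rintegrable_lty.
  apply: (@fatou_bound (fun n x => `|g_ n x|)) => //.
  - by move=> n; exact: measurableT_comp.
  - exact: measurableT_comp.
  - by apply: filterS g_g => x; exact: cvg_norm.
  - move=> n; apply: (@le_trans _ _ (\int[mu]_x (P n x + `|Y x|)%:E)%E).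
      apply: ge0_le_integral => //.
      + by apply/measurable_EFinP; exact: measurableT_comp.
      + apply/measurable_EFinP; apply: measurable_funD => //.
        by apply: rintegrable_measurable.
      + move=> x _; rewrite lee_fin (le_trans (HY n x))// mul1r lerD2l.
        exact: ler_norm.
    under eq_integral do rewrite EFinD.
    rewrite ge0_integralD//; first by rewrite leeD2r.
    + by move=> x _; rewrite lee_fin.
    + exact/measurable_EFinP.
    by apply/measurable_EFinP; apply: rintegrable_measurable.
split=> //.
apply/cvgrPdist_le => e e0.
(* Half of [e] pays for the integral of the truncation [h], the other half for [e' * M]; the added 1
   covers [M = 0]. *)
pose e' := e / (2 * (M + 1)).
have M1 : 0 < M + 1 by rewrite ltr_wpDl.
have e'0 : 0 < e' by rewrite divr_gt0// mulr_gt0.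
have [Y Yi HY] := dom _ e'0.
pose h n x := Num.max (`|g_ n x - g x| - e' * P n x) 0.
have mh n : measurable_fun setT (h n).
  apply: measurable_maxr => //; apply: measurable_funB => //.
    by apply: measurableT_comp => //; exact: measurable_funB.
  exact: measurable_funM.
have h0 n x : 0 <= h n x by rewrite le_max lexx orbT.
have hcv : (fun n => \int[mu]_x (h n x)%:E)%E @ \oo --> (0%E : \bar R).
  have h1 : {ae mu, forall x, setT x -> (fun n => (EFin \o h n) x) @ \oo --> (0%E : \bar R)}.
    apply: filterS g_g => x gx _; apply: cvg_EFin; first exact: nearW.
    apply: (@squeeze_cvgr _ _ _ _ (cst 0) (fun n => `|g_ n x - g x|)).
    - apply: nearW => n; rewrite /= h0 ge_max normr_ge0 andbT.
      by rewrite gerBl mulr_ge0// ltW.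
    - exact: cvg_cst.
    - rewrite -[X in _ --> X](normr0 R) -(subrr (g x)); apply: cvg_norm.
      by apply: cvgB => //; exact: cvg_cst.
  have h2 : {ae mu, forall x n, setT x -> (`|(EFin \o h n) x| <= (`|g x| + `|Y x|)%:E)%E}.
    apply: aeW => x n _ /=; rewrite lee_fin ger0_norm// ge_max.
    rewrite [X in _ && X]addr_ge0// andbT lerBlDr.
    rewrite (le_trans (ler_normB _ _))// addrC -addrA lerD2l addrC.
    by rewrite (le_trans (HY n x))// lerD2l ler_norm.
  have h3 : mu.-integrable setT (fun x => (`|g x| + `|Y x|)%:E).
    exact: rintegrableD (rintegrable_norm _ gi) (rintegrable_norm _ Yi).
  have h4 n : measurable_fun setT (EFin \o h n) by exact/measurable_EFinP.
  have [_ _] := dominated_convergence measurableT h4 (measurable_cst _) h1 h3 h2.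
  by rewrite integral0.
have hcv' : (fun n => \int[mu]_x h n x) @ \oo --> (0 : R) by exact: fine_cvg hcv.
have hi n : rintegrable (h n).
  apply: (@le_rintegrable _ (fun x => `|g_ n x - g x|)) => //; last first.
    by apply: rintegrable_norm; exact: rintegrableB.
  move=> x; rewrite ger0_norm// ge_max normr_ge0 andbT.
  by rewrite gerBl mulr_ge0// ltW.
have /cvgrPdist_le/(_ _ (divr_gt0 e0 (ltr0n R 2))) := hcv'.
apply: filterS => n; rewrite sub0r normrN => hn.
rewrite distrC -rintegralB//.
apply: le_trans.
  by apply: le_normr_Rintegral => //; exact: rintegrableB.
apply: (@le_trans _ _ (\int[mu]_x (h n x + e' * P n x))).
  apply: le_rintegral => //.
  - by apply: rintegrable_norm; exact: rintegrableB.
  - by apply: rintegrableD => //; exact: rintegrableZ.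
  - by move=> x; rewrite -lerBlDr le_max lexx.
rewrite rintegralD//; last exact: rintegrableZ.
rewrite rintegralZ//.
have PM' : \int[mu]_x P n x <= M by rewrite -lee_fin -rintegrableE.
apply: (@le_trans _ _ (e / 2 + e' * M)).
  apply: lerD; last by rewrite ler_wpM2l// ltW.
  exact: le_trans (ler_norm _) hn.
have : e' * (M + 1) = e / 2 by rewrite /e'; field; rewrite gt_eqF.
rewrite mulrDr mulr1; lra.
Qed.

End integral_limits.

(** * Weighted powers and their derivatives *)

Section weighted_powers.
Context {d} {T : measurableType d} {R : realType}.
Variable mu : {measure set T -> \bar R}.
Local Notation C := R[i].
Local Notation Re := (@complex.Re R).
Local Notation Im := (@complex.Im R).
Local Notation nc := (@ComplexField.Normc.normc R).

Definition cmeasurable (f : T -> C) :=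
  measurable_fun setT (Re \o f) /\ measurable_fun setT (Im \o f).

Lemma cmeasurable_normc (f : T -> C) : cmeasurable f -> measurable_fun setT (nc \o f).
Proof.
move=> [fR fI].
rewrite (_ : nc \o f = (fun x => Num.sqrt ((Re \o f) x ^+ 2 + (Im \o f) x ^+ 2))); last first.
  by apply/funext => x /=; rewrite normcE_sqrt.
rewrite (_ : (fun x => _) = (@powR R ^~ 2^-1) \o
    (fun x => (Re \o f) x ^+ 2 + (Im \o f) x ^+ 2)); last first.
  by apply/funext => x /=; rewrite powR12_sqrt// addr_ge0// sqr_ge0.
apply: measurableT_comp; first exact: measurable_powR.
by apply: measurable_funD; apply: measurable_funX.
Qed.

Lemma cmeasurable_normc_powR (f : T -> C) (e : R) : cmeasurable f ->
  measurable_fun setT (fun x => nc (f x) `^ e).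
Proof.
move=> mf; apply: (measurableT_comp (measurable_powR e)).
exact: cmeasurable_normc.
Qed.

Lemma cmeasurable_cdual (f g : T -> C) (e : R) : cmeasurable f -> cmeasurable g ->
  measurable_fun setT (fun x => cdual e (f x) (g x)).
Proof.
move=> mf mg; apply: measurable_funM; first exact: cmeasurable_normc_powR.
by apply: measurable_funD; apply: measurable_funM;
  [exact: mf.1|exact: mg.1|exact: mf.2|exact: mg.2].
Qed.

Lemma cmeasurable_comb (f g : T -> C) (a b : R) : cmeasurable f -> cmeasurable g ->
  cmeasurable (fun x => a%:C%C * f x + b%:C%C * g x).
Proof.
move=> [fR fI] [gR gI]; split.
  rewrite (_ : _ \o _ = (fun x => a * (Re \o f) x + b * (Re \o g) x)); last first.
    by apply/funext => x /=; rewrite complexReD !complexReZ.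
  by apply: measurable_funD; apply: measurable_funM.
rewrite (_ : _ \o _ = (fun x => a * (Im \o f) x + b * (Im \o g) x)); last first.
  by apply/funext => x /=; rewrite complexImD !complexImZ.
by apply: measurable_funD; apply: measurable_funM.
Qed.

Lemma normc_comb_powR_le (a b : R) (z v : C) (e : R) : 0 < e ->
  nc (a%:C%C * z + b%:C%C * v) `^ e <=
  2 `^ e * (`|a| `^ e * nc z `^ e + `|b| `^ e * nc v `^ e).
Proof.
move=> e0; rewrite -!powRM ?normc_ge0// -!normcZ.
apply: (le_trans _ (powR_addl_le _ _ _ e0 (normc_ge0 _) (normc_ge0 _))).
by rewrite ge0_ler_powR ?(ltW e0) ?nnegrE ?addr_ge0 ?normc_ge0// ler_normcD.
Qed.

Variable w : T -> R.
Hypotheses (mw : measurable_fun setT w) (w0 : forall x, 0 <= w x).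

Lemma rintegrable_comb (f g : T -> C) (a b e : R) : 0 < e ->
  cmeasurable f -> cmeasurable g ->
  rintegrable mu (fun x => w x * nc (f x) `^ e) ->
  rintegrable mu (fun x => w x * nc (g x) `^ e) ->
  rintegrable mu (fun x => w x * nc (a%:C%C * f x + b%:C%C * g x) `^ e).
Proof.
move=> e0 mf mg fi gi.
apply: (@le_rintegrable _ _ _ _ _ (fun x => (2 `^ e * `|a| `^ e) * (w x * nc (f x) `^ e)
  + (2 `^ e * `|b| `^ e) * (w x * nc (g x) `^ e))).
- apply: measurable_funM => //; apply: cmeasurable_normc_powR.
  exact: cmeasurable_comb.
- move=> x; rewrite ger0_norm ?mulr_ge0 ?powR_ge0//.
  apply: (le_trans (ler_wpM2l (w0 x) (normc_comb_powR_le a b (f x) (g x) _ e0))).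
  by apply: eq_ler; ring.
- by apply: rintegrableD; apply: rintegrableZ.
Qed.

Lemma rintegrable_cdual (f g : T -> C) (e : R) : 1 < e ->
  cmeasurable f -> cmeasurable g ->
  rintegrable mu (fun x => w x * nc (f x) `^ e) ->
  rintegrable mu (fun x => w x * nc (g x) `^ e) ->
  rintegrable mu (fun x => w x * cdual e (f x) (g x)).
Proof.
move=> e1 mf mg fi gi; have eB : 0 < e - 1 by rewrite subr_gt0.
apply: (@le_rintegrable _ _ _ _ _ (fun x => w x * nc (f x) `^ e
  + (1 `^ 1^-1) `^ (- (e - 1)) * (w x * nc (g x) `^ e))).
- by apply: measurable_funM => //; apply: cmeasurable_cdual.
- move=> x; rewrite normrM (ger0_norm (w0 x)).
  apply: (@le_trans _ _ (w x * (1 * nc (f x) `^ (e - 1 + 1) +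
    (1 `^ 1^-1) `^ (- (e - 1)) * nc (g x) `^ (e - 1 + 1)))).
    rewrite ler_wpM2l// (le_trans (norm_cdual_le _ _ _ e1))//.
    rewrite -[X in _ * X](powRr1 (normc_ge0 (g x))).
    by apply: powR_mixed_small; rewrite ?normc_ge0.
  by rewrite subrK; apply: eq_ler; ring.
- by apply: rintegrableD => //; exact: rintegrableZ.
Qed.

End weighted_powers.

Section derivative_of_powers.
Context {R : realType}.
Local Notation C := R[i].
Local Notation nc := (@ComplexField.Normc.normc R).

(** The majorant is free of [t], as dominated convergence of the difference quotients requires;
    [t <= 1] bounds [|z + t v|] by [|z| + |v|]. *)
Lemma normc_powR_quotient_le (z v : C) (t e : R) : 1 < e -> 0 < t -> t <= 1 ->
  `|t^-1 * (nc (z + t%:C%C * v) `^ e - nc z `^ e)| <=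
  e * 2 `^ e * (nc z `^ e + nc v `^ e).
Proof.
move=> e1 t0 t1; have e0 : 0 < e by exact: lt_trans e1.
rewrite normrM gtr0_norm ?invr_gt0// ler_pdivrMl//.
apply: (le_trans (powR_diff_le _ _ _ e1 (normc_ge0 _) (normc_ge0 _))).
have zv : nc (z + t%:C%C * v) <= nc z + nc v.
  rewrite (le_trans (ler_normcD _ _))// lerD2l normcZ gtr0_norm//.
  by rewrite ler_piMl ?normc_ge0.
have zv0 : 0 <= nc z + nc v by rewrite addr_ge0 ?normc_ge0.
apply: (@le_trans _ _ (e * (t * (nc z + nc v)) * (nc z + nc v) `^ (e - 1))).
  apply: ler_pM; rewrite ?powR_ge0 ?mulr_ge0 ?(ltW e0)//.
    rewrite ler_wpM2l ?(ltW e0)// (le_trans (ler_normc_sub _ _))//.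
    rewrite addrAC subrr add0r normcZ gtr0_norm// ler_wpM2l ?(ltW t0)//.
    by rewrite lerDr normc_ge0.
  apply: ge0_ler_powR; rewrite ?nnegrE ?subr_ge0 ?(ltW e1) ?le_max ?normc_ge0//.
  by rewrite ge_max zv lerDl normc_ge0.
rewrite -!mulrA mulr_powRB1// mulrCA ler_wpM2l ?(ltW t0)// ler_wpM2l ?(ltW e0)//.
by apply: powR_addl_le; rewrite ?normc_ge0.
Qed.

(** At [z = 0] the quotient is [t^(e-1) |v|^e], which tends to 0 because [e > 1]. Elsewhere
    [|z + t v|^2] is a quadratic polynomial in [t], positive at 0, and the chain rule applies to its
    power [e / 2]. *)
Lemma cvg_normc_powR_quotient (z v : C) (t_ : nat -> R) (e : R) : 1 < e ->
  (forall n, 0 < t_ n) -> t_ @ \oo --> (0 : R) ->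
  (fun n => (t_ n)^-1 * (nc (z + (t_ n)%:C%C * v) `^ e - nc z `^ e)) @ \oo -->
  e * cdual e z v.
Proof.
move=> e1 t0 t_0; have e0 : 0 < e by exact: lt_trans e1.
have eB : 0 < e - 1 by rewrite subr_gt0.
have [z0|z_neq0] := eqVneq (nc z) 0.
  have zE : z = 0 by exact: ComplexField.Normc.eq0_normc.
  have -> : e * cdual e z v = 0.
    by rewrite /cdual zE /cdot/= !mul0r addr0 !mulr0.
  rewrite (_ : (fun n => _) = (fun n => (t_ n) `^ (e - 1) * nc v `^ e)); last first.
    apply/funext => n; rewrite z0 powR0 ?gt_eqF// subr0 zE add0r normcZ gtr0_norm//.
    rewrite powRM ?(ltW (t0 n)) ?normc_ge0// mulrA; congr (_ * _).
    by rewrite -(mulr_powRB1 (ltW (t0 n)) e0) mulrA mulVf ?mul1r// gt_eqF.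
  rewrite -(mul0r (nc v `^ e)); apply: cvgM; last exact: cvg_cst.
  rewrite -(@powR0 _ (e - 1)) ?gt_eqF//.
  apply: (@cvg_powR _ _ _ _ _ (e - 1)) => //; last exact: cvg_cst.
  by move=> n; rewrite ltW.
pose s (t : R) := nc z ^+ 2 + t * (2 * cdot z v) + t ^+ 2 * nc v ^+ 2.
have sE t : nc (z + t%:C%C * v) `^ e = s t `^ (e / 2).
  have -> : s t = nc (z + t%:C%C * v) ^+ 2.
    by rewrite /s !normc_sqr complexReD complexImD complexReZ complexImZ /cdot; ring.
  by rewrite -powR_mulrn ?normc_ge0// -powRrM mulrCA divff ?mulr1.
have s0 : 0 < s 0 by rewrite /s mul0r expr0n/= mul0r !addr0 exprn_even_gt0.
have ds : is_derive (0 : R) (1 : R) s (2 * cdot z v).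
  apply: is_derive_eq; rewrite /GRing.scale/=; ring.
have dp := is_derive1_comp (is_derive1_powR (e / 2) s0) ds.
have tt : t_ @ \oo --> (0 : R)^'.
  move=> P HP.
  have HP' : nbhs (0 : R) (fun y => y != 0 -> P y) := HP.
  have H : \forall n \near \oo, t_ n != 0 -> P (t_ n) := t_0 _ HP'.
  suff : \forall n \near \oo, P (t_ n) by [].
  by apply: filterS H => n; apply; rewrite gt_eqF.
have [dpx dpv] := dp.
have H := cvg_comp _ _ tt dpx.
have dE : 'D_1 ((powR (R:=R))^~ (e / 2) \o s) 0 = e * cdual e z v.
  rewrite dpv /cdual /s mul0r expr0n/= mul0r !addr0 -powR_mulrn ?normc_ge0//.
  rewrite -powRrM (_ : 2%:R * (e / 2 - 1) = e - 2); last lra.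
  by field.
rewrite -dE; apply: cvg_trans H; apply: near_eq_cvg; apply: nearW => n /=.
rewrite /shift/= addr0 -[t_ n *: 1]/(t_ n * 1) mulr1 -sE; congr (_ * (_ - _)).
by rewrite -sE rmorph0 mul0r addr0.
Qed.

End derivative_of_powers.

Section gateaux.
Context {d} {T : measurableType d} {R : realType}.
Variable mu : {measure set T -> \bar R}.
Local Notation C := R[i].
Local Notation nc := (@ComplexField.Normc.normc R).
Variable w : T -> R.
Hypotheses (mw : measurable_fun setT w) (w0 : forall x, 0 <= w x).

Lemma cvg_wpower_quotient (f g : T -> C) (t_ : nat -> R) (e : R) : 1 < e ->
  (forall n, 0 < t_ n) -> (forall n, t_ n <= 1) -> t_ @ \oo --> (0 : R) ->
  cmeasurable f -> cmeasurable g ->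
  rintegrable mu (fun x => w x * nc (f x) `^ e) ->
  rintegrable mu (fun x => w x * nc (g x) `^ e) ->
  (fun n => (t_ n)^-1 * ((\int[mu]_x (w x * nc (f x + (t_ n)%:C%C * g x) `^ e)) -
     \int[mu]_x (w x * nc (f x) `^ e))) @ \oo -->
  e * \int[mu]_x (w x * cdual e (f x) (g x)).
Proof.
move=> e1 t0 t1 tcv mf mg fi gi; have e0 : 0 < e by exact: lt_trans e1.
have mfg n : cmeasurable (fun x => f x + (t_ n)%:C%C * g x).
  have := cmeasurable_comb _ _ 1 (t_ n) mf mg.
  by under eq_fun do rewrite mul1r.
have fgi n : rintegrable mu (fun x => w x * nc (f x + (t_ n)%:C%C * g x) `^ e).
  have := rintegrable_comb mu _ mw w0 _ _ 1 (t_ n) _ e0 mf mg fi gi.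
  by under eq_fun do rewrite mul1r.
pose q n x := w x * ((t_ n)^-1 * (nc (f x + (t_ n)%:C%C * g x) `^ e - nc (f x) `^ e)).
have qE n : (t_ n)^-1 * ((\int[mu]_x (w x * nc (f x + (t_ n)%:C%C * g x) `^ e)) -
     \int[mu]_x (w x * nc (f x) `^ e)) = \int[mu]_x q n x.
  rewrite -rintegralB// -rintegralZ; last exact: rintegrableB.
  by apply: eq_Rintegral => x _; rewrite /q; ring.
rewrite -rintegralZ; last exact: rintegrable_cdual.
under eq_fun do rewrite qE.
(* With [P] equal to zero this is plain dominated convergence. *)
have [] // := @cvg_Rintegral_equi _ _ _ mu q (fun _ _ => 0) (fun x => e * (w x * cdual e (f x) (g x))) 0.
- move=> n; apply: measurable_funM => //; apply: measurable_funM => //.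
  by apply: measurable_funB; exact: cmeasurable_normc_powR.
- apply: measurable_funM => //; apply: measurable_funM => //.
  exact: cmeasurable_cdual.
- apply: aeW => x; rewrite mulrCA; apply: cvgM; first exact: cvg_cst.
  exact: cvg_normc_powR_quotient.
- by move=> n; rewrite integral0.
- move=> eps eps0.
  exists (fun x => e * 2 `^ e * (w x * nc (f x) `^ e + w x * nc (g x) `^ e)).
    by apply: rintegrableZ; exact: rintegrableD.
  move=> n x; rewrite mulr0 add0r /q normrM (ger0_norm (w0 x)).
  rewrite -mulrDr [leRHS]mulrCA ler_wpM2l//.
  exact: normc_powR_quotient_le.
Qed.

End gateaux.

Section interpolation.
Context {d} {T : measurableType d} {R : realType}.
Variable mu : {measure set T -> \bar R}.

(** Young's inequality for normalized factors. When [a] and [b] bound the integrals of [h^Q] and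
    [u^Q], the bracket integrates to at most 1, which turns this into Hölder's inequality with
    exponents [Q / (Q - e)] and [Q / e]. *)
Lemma powR_young (h u a b e Q : R) : 0 <= h -> 0 <= u -> 0 < a -> 0 < b ->
  0 < e -> e < Q ->
  h `^ (Q - e) * u `^ e <= a `^ (1 - e / Q) * b `^ (e / Q) *
    ((1 - e / Q) * (h `^ Q / a) + e / Q * (u `^ Q / b)).
Proof.
move=> h0 u0 a0 b0 e0 eQ; have Q0 : 0 < Q by exact: lt_trans eQ.
have Qe0 : 0 < Q - e by rewrite subr_gt0.
pose X := (h / a `^ Q^-1) `^ (Q - e); pose Y := (u / b `^ Q^-1) `^ e.
have root c x : 0 < c -> 0 <= x -> (x / c `^ Q^-1) `^ Q = x `^ Q / c.
  move=> c0 x0; rewrite powRM ?invr_ge0 ?powR_ge0// -powRN -powRrM mulNr mulVf ?gt_eqF//.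
  by rewrite powR_inv1 ?ltW.
have scale c x al : 0 < c -> 0 <= x ->
    x `^ al = c `^ (al / Q) * (x / c `^ Q^-1) `^ al.
  move=> c0 x0; rewrite powRM ?invr_ge0 ?powR_ge0// mulrCA.
  rewrite -powRN -powRrM mulNr [Q^-1 * _]mulrC powRN divff ?mulr1//.
  by rewrite gt_eqF// powR_gt0.
rewrite (scale a h)// (scale b u)// -/X -/Y.
have -> : (Q - e) / Q = 1 - e / Q by field; rewrite gt_eqF.
rewrite mulrACA ler_wpM2l ?mulr_ge0 ?powR_ge0//.
have := @conjugate_powR _ X Y (Q / (Q - e)) (Q / e) (powR_ge0 _ _) (powR_ge0 _ _)
  (divr_gt0 Q0 Qe0) (divr_gt0 Q0 e0).
rewrite !invf_div -mulrDl subrK divff ?gt_eqF// => /(_ erefl) H.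
have XE : X `^ (Q / (Q - e)) = h `^ Q / a.
  rewrite /X -powRrM (_ : (Q - e) * (Q / (Q - e)) = Q) ?root//.
  by field; rewrite gt_eqF.
have YE : Y `^ (Q / e) = u `^ Q / b.
  rewrite /Y -powRrM (_ : e * (Q / e) = Q) ?root//.
  by field; rewrite gt_eqF.
clearbody X Y; rewrite (le_trans H)// XE YE; apply: eq_ler; field.
by rewrite !gt_eqF.
Qed.

Lemma rintegral_interp_le (k h u : T -> R) (kap a b e Q : R) :
  measurable_fun setT k -> measurable_fun setT h -> measurable_fun setT u ->
  (forall x, 0 <= k x <= kap) -> (forall x, 0 <= h x) -> (forall x, 0 <= u x) ->
  0 <= kap -> 0 < a -> 0 < b -> 0 < e -> e < Q ->
  rintegrable mu (fun x => h x `^ Q) -> rintegrable mu (fun x => u x `^ Q) ->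
  \int[mu]_x (h x `^ Q) <= a -> \int[mu]_x (u x `^ Q) <= b ->
  rintegrable mu (fun x => k x * h x `^ (Q - e) * u x `^ e) /\
  \int[mu]_x (k x * h x `^ (Q - e) * u x `^ e) <= kap * (a `^ (1 - e / Q) * b `^ (e / Q)).
Proof.
move=> mk mh mu_ k0 h0 u0 kap0 a0 b0 e0 eQ hi ui ha ub.
have Q0 : 0 < Q by exact: lt_trans eQ.
have eQ1 : 0 <= 1 - e / Q by rewrite subr_ge0 ler_pdivrMr// mul1r ltW.
pose A := a `^ (1 - e / Q) * b `^ (e / Q).
pose D x := kap * A * ((1 - e / Q) / a * h x `^ Q + e / Q / b * u x `^ Q).
have Di : rintegrable mu D.
  by apply: rintegrableZ; apply: rintegrableD; exact: rintegrableZ.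
have le x : k x * h x `^ (Q - e) * u x `^ e <= D x.
  have /andP[k0x kx] := k0 x.
  rewrite -mulrA; apply: (@le_trans _ _ (kap * (h x `^ (Q - e) * u x `^ e))).
    by rewrite ler_wpM2r// mulr_ge0// powR_ge0.
  rewrite /D -mulrA ler_wpM2l //.
  apply: (le_trans (powR_young _ _ _ _ _ _ (h0 x) (u0 x) a0 b0 e0 eQ)).
  by apply: eq_ler; rewrite /A; ring.
have Bi : rintegrable mu (fun x => k x * h x `^ (Q - e) * u x `^ e).
  apply: (@le_rintegrable _ _ _ _ _ D) => //.
    apply: measurable_funM; first (apply: measurable_funM => //).
      exact: (measurableT_comp (measurable_powR _)).
    exact: (measurableT_comp (measurable_powR _)).
  move=> x; rewrite ger0_norm//.
  by have /andP[? ?] := k0 x; rewrite !mulr_ge0// powR_ge0.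
split=> //.
apply: (le_trans (le_rintegral _ _ _ Bi Di le)).
rewrite /D rintegralZ; last by apply: rintegrableD; exact: rintegrableZ.
rewrite rintegralD; [|exact: rintegrableZ|exact: rintegrableZ].
rewrite !rintegralZ// -mulrA.
rewrite ler_wpM2l// -/A -[leRHS]mulr1 ler_wpM2l ?mulr_ge0 ?powR_ge0//.
apply: (@le_trans _ _ ((1 - e / Q) / a * a + e / Q / b * b)).
  by apply: lerD; rewrite ler_wpM2l// divr_ge0 ?(ltW a0) ?(ltW b0)// divr_ge0 ?ltW.
by rewrite !divfK ?gt_eqF// subrK.
Qed.

End interpolation.

(** * Weighted terms up to the critical exponent *)

Section perturbed_powers.
Context {d} {T : measurableType d} {R : realType}.
Variable mu : {measure set T -> \bar R}.
Local Notation C := R[i].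
Local Notation nc := (@ComplexField.Normc.normc R).
Variable Q : R.

(* With [h `^ Q] integrable, the term of exponent [e <= Q] is controlled by the
   [L^Q] norm of [u] alone; at [e = Q] the weight is [k], because [0 `^ 0 = 1]. *)
Definition pweight (k h : T -> R) (e : R) (x : T) : R := k x * h x `^ (Q - e).

(* Locked: unification must not compare two distinct integrals by unfolding. *)
Definition pterm := locked (fun (k h : T -> R) (e : R) (u : T -> C) =>
  \int[mu]_x (pweight k h e x * nc (u x) `^ e)).

Definition dpterm := locked (fun (k h : T -> R) (e : R) (u v : T -> C) =>
  \int[mu]_x (pweight k h e x * cdual e (u x) (v x))).

Lemma ptermE k h e u :
  pterm k h e u = \int[mu]_x (pweight k h e x * nc (u x) `^ e).
Proof. by rewrite /pterm -lock. Qed.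

Lemma dptermE k h e u v :
  dpterm k h e u v = \int[mu]_x (pweight k h e x * cdual e (u x) (v x)).
Proof. by rewrite /dpterm -lock. Qed.

Definition admissible (kap : R) (k h : T -> R) :=
  [/\ measurable_fun setT k, forall x, 0 <= k x <= kap, measurable_fun setT h,
      forall x, 0 <= h x & rintegrable mu (fun x => h x `^ Q)].

Definition LQ (u : T -> C) :=
  cmeasurable u /\ rintegrable mu (fun x => nc (u x) `^ Q).

Variables (kap : R) (k h : T -> R).
Hypotheses (kap0 : 0 <= kap) (adm : admissible kap k h).

Lemma pweight_ge0 e x : 0 <= pweight k h e x.
Proof.
by case: adm => _ k0 _ _ _; rewrite mulr_ge0 ?powR_ge0//; have /andP[] := k0 x.
Qed.

Lemma measurable_pweight e : measurable_fun setT (pweight k h e).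
Proof.
case: adm => mk _ mh _ _; apply: measurable_funM => //.
exact: (measurableT_comp (measurable_powR _)).
Qed.

(** A crude bound whose constant is free of [e] and that includes [e = Q]. It yields integrability
    for all exponents and an energy estimate for the test function that is uniform along the
    approximation. *)
Lemma pweight_powR_le e (u : R) x : 0 < e -> e <= Q -> 0 <= u ->
  pweight k h e x * u `^ e <= kap * 2 `^ Q * (h x `^ Q + u `^ Q).
Proof.
move=> e0 eQ u0; case: adm => _ k0 _ h0 _; have /andP[k0x kx] := k0 x.
have Q0 : 0 < Q by exact: lt_le_trans eQ.
rewrite /pweight -!mulrA.
apply: (@le_trans _ _ (kap * (h x `^ (Q - e) * u `^ e))).
  by rewrite ler_wpM2r// mulr_ge0// powR_ge0.
rewrite ler_wpM2l//; apply: (le_trans _ (powR_addl_le _ _ _ Q0 (h0 x) u0)).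
have hu0 : 0 <= h x + u by rewrite addr_ge0.
apply: (@le_trans _ _ ((h x + u) `^ (Q - e) * (h x + u) `^ e)).
  apply: ler_pM; rewrite ?powR_ge0//.
    by rewrite ge0_ler_powR ?subr_ge0 ?nnegrE// lerDl.
  by rewrite ge0_ler_powR ?(ltW e0) ?nnegrE// lerDr.
by rewrite -powRD subrK// gt_eqF.
Qed.

Lemma rintegrable_pterm e (u : T -> C) : 0 < e -> e <= Q -> LQ u ->
  rintegrable mu (fun x => pweight k h e x * nc (u x) `^ e).
Proof.
move=> e0 eQ [mu_ ui]; case: (adm) => _ _ _ h0 hi.
apply: (@le_rintegrable _ _ _ _ _ (fun x => kap * 2 `^ Q * (h x `^ Q + nc (u x) `^ Q))).
- apply: measurable_funM; first exact: measurable_pweight.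
  exact: cmeasurable_normc_powR.
- move=> x; rewrite ger0_norm; last by rewrite mulr_ge0 ?pweight_ge0 ?powR_ge0.
  by apply: pweight_powR_le => //; exact: normc_ge0.
- by apply: rintegrableZ; exact: rintegrableD.
Qed.

Lemma pterm_ge0 e (u : T -> C) : 0 <= pterm k h e u.
Proof. by rewrite ptermE; apply: rintegral_ge0 => x; rewrite mulr_ge0 ?pweight_ge0 ?powR_ge0. Qed.

Lemma pterm_le_crude e (u : T -> C) : 0 < e -> e <= Q -> LQ u ->
  pterm k h e u <=
  kap * 2 `^ Q * (\int[mu]_x (h x `^ Q) + \int[mu]_x (nc (u x) `^ Q)).
Proof.
move=> e0 eQ uQ; case: (uQ) => mu_ ui; case: (adm) => _ _ _ h0 hi.
rewrite ptermE -rintegralD// -rintegralZ; last exact: rintegrableD.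
apply: le_rintegral; first exact: rintegrable_pterm.
  by apply: rintegrableZ; exact: rintegrableD.
by move=> x; apply: pweight_powR_le => //; exact: normc_ge0.
Qed.

(** Hölder's inequality puts the mass of [h] to the power [1 - e / Q]. Enlarging that mass by 1
    makes the power at most the enlarged mass itself, so the constant does not depend on [e]. *)
Lemma pterm_le_interp e (u : T -> C) (b : R) : 0 < e -> e < Q -> LQ u -> 0 < b ->
  \int[mu]_x (nc (u x) `^ Q) <= b ->
  pterm k h e u <= kap * (1 + \int[mu]_x (h x `^ Q)) * b `^ (e / Q).
Proof.
move=> e0 eQ [mu_ ui] b0 ub; case: (adm) => mk k0 mh h0 hi.
have Q0 : 0 < Q by exact: lt_trans eQ.
have I0 : 0 <= \int[mu]_x (h x `^ Q) by apply: rintegral_ge0 => x; exact: powR_ge0.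
set a := 1 + _.
have a1 : 1 <= a by rewrite lerDl.
have a0 : 0 < a by exact: lt_le_trans a1.
have ha : \int[mu]_x (h x `^ Q) <= a by rewrite /a lerDr.
have [_ H] := @rintegral_interp_le _ _ _ mu k h (nc \o u) kap a b e Q mk mh
  (cmeasurable_normc _ mu_) k0 h0 (fun x => normc_ge0 _) kap0 a0 b0 e0 eQ hi ui ha ub.
rewrite ptermE; apply: (le_trans H); rewrite -mulrA ler_wpM2l// ler_wpM2r ?powR_ge0//.
by apply: ler1_powR => //; rewrite gerBl divr_ge0 ?ltW.
Qed.

(** Here [e < Q] is decisive: the integrand is at most [eps |u_n|^Q] plus a fixed multiple of [h^Q],
    so a.e. convergence and bounded mass exclude any loss. *)
Lemma cvg_pterm (u_ : nat -> T -> C) (u : T -> C) (e M : R) : 0 < e -> e < Q ->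
  (forall n, LQ (u_ n)) -> cmeasurable u ->
  {ae mu, forall x, ccvg (fun n => u_ n x) (u x)} ->
  (forall n, \int[mu]_x (nc (u_ n x) `^ Q) <= M) ->
  (fun n => pterm k h e (u_ n)) @ \oo --> pterm k h e u.
Proof.
move=> e0 eQ u_Q mu_ u_u u_M; have Qe0 : 0 < Q - e by rewrite subr_gt0.
case: (adm) => mk k0 mh h0 hi.
rewrite ptermE; under eq_fun do rewrite ptermE.
have [] // := @cvg_Rintegral_equi _ _ _ mu (fun n x => pweight k h e x * nc (u_ n x) `^ e)
  (fun n x => nc (u_ n x) `^ Q) (fun x => pweight k h e x * nc (u x) `^ e) M.
- move=> n; apply: measurable_funM; first exact: measurable_pweight.
  by apply: cmeasurable_normc_powR; have [] := u_Q n.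
- apply: measurable_funM; first exact: measurable_pweight.
  exact: cmeasurable_normc_powR.
- apply: filterS u_u => x ux; apply: cvgM; first exact: cvg_cst.
  apply: (@cvg_powR _ _ _ _ _ e) => //; last exact: cvg_cst.
  - by move=> n; rewrite normc_ge0.
  - exact: ccvg_normc.
- by move=> n; apply: cmeasurable_normc_powR; have [] := u_Q n.
- by move=> n x; rewrite powR_ge0.
- by move=> n; rewrite rintegrableE ?lee_fin//; have [] := u_Q n.
- move=> eps eps0; pose eps' := eps / (kap + 1).
  have kap1 : 0 < kap + 1 by rewrite ltr_wpDl.
  have eps'0 : 0 < eps' by rewrite divr_gt0.
  exists (fun x => kap * (eps' `^ (Q - e)^-1) `^ (- e) * h x `^ Q).
    exact: rintegrableZ.
  move=> n x; rewrite ger0_norm; last by rewrite mulr_ge0 ?pweight_ge0 ?powR_ge0.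
  have /andP[k0x kx] := k0 x.
  rewrite /pweight -mulrA.
  apply: (@le_trans _ _ (kap * (h x `^ (Q - e) * nc (u_ n x) `^ e))).
    by rewrite ler_wpM2r// mulr_ge0// powR_ge0.
  have := powR_mixed_small (nc (u_ n x)) (h x) _ _ _ e0 Qe0 eps'0 (normc_ge0 _) (h0 x).
  have eQE : e + (Q - e) = Q by rewrite addrC subrK.
  rewrite eQE [nc (u_ n x) `^ e * _]mulrC => H.
  apply: (le_trans (ler_wpM2l kap0 H)); rewrite mulrDr mulrA lerD//.
    rewrite ler_wpM2r ?powR_ge0// /eps' mulrCA ler_piMr ?(ltW eps0)//.
    by rewrite ler_pdivrMr// mul1r lerDl.
  by rewrite mulrA.
Qed.

(** The exponents may move and may tend to [Q]. Equi-integrability comes from the fixed [v]: the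
    integrand is at most a multiple of [(h + |u_n|)^(Q-1) |v|], to which Young's inequality applies.
    Convergence of [h^(Q - e_n)] is assumed because it fails at zeros of [h] when [e_n < Q] tends to
    [Q], again by [0^0 = 1]. *)
Lemma cvg_dpterm (u_ : nat -> T -> C) (u v : T -> C) (e_ : nat -> R) (e eb M : R) :
  1 < eb -> (forall n, eb <= e_ n) -> (forall n, e_ n <= Q) -> e_ @ \oo --> e ->
  (forall x, (fun n => h x `^ (Q - e_ n)) @ \oo --> h x `^ (Q - e)) ->
  (forall n, LQ (u_ n)) -> cmeasurable u -> LQ v ->
  {ae mu, forall x, ccvg (fun n => u_ n x) (u x)} ->
  (forall n, \int[mu]_x (nc (u_ n x) `^ Q) <= M) ->
  (fun n => dpterm k h (e_ n) (u_ n) v) @ \oo --> dpterm k h e u v.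
Proof.
move=> eb1 ebe eQ ee he u_Q mu_ [mv vi] u_u u_M.
case: (adm) => mk k0 mh h0 hi.
have e1 n : 1 < e_ n by exact: lt_le_trans (ebe n).
have Q1 : 1 < Q by exact: lt_le_trans (eQ 0%N).
have Q0 : 0 < Q by exact: lt_trans Q1.
have QB : 0 < Q - 1 by rewrite subr_gt0.
have hum n : measurable_fun setT (fun x => (h x + nc (u_ n x)) `^ Q).
  apply: (measurableT_comp (measurable_powR _)); apply: measurable_funD => //.
  by apply: cmeasurable_normc; have [] := u_Q n.
have hui n : rintegrable mu (fun x => h x `^ Q + nc (u_ n x) `^ Q).
  by apply: rintegrableD => //; have [] := u_Q n.
have hu0 n x : 0 <= h x + nc (u_ n x) by rewrite addr_ge0// normc_ge0.
rewrite dptermE; under eq_fun do rewrite dptermE.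
have [] // := @cvg_Rintegral_equi _ _ _ mu
  (fun n x => pweight k h (e_ n) x * cdual (e_ n) (u_ n x) (v x))
  (fun n x => (h x + nc (u_ n x)) `^ Q)
  (fun x => pweight k h e x * cdual e (u x) (v x))
  (2 `^ Q * (\int[mu]_x (h x `^ Q) + M)).
- move=> n; apply: measurable_funM; first exact: measurable_pweight.
  by apply: cmeasurable_cdual => //; have [] := u_Q n.
- apply: measurable_funM; first exact: measurable_pweight.
  exact: cmeasurable_cdual.
- apply: filterS u_u => x ux; apply: cvgM.
    by apply: cvgM; [exact: cvg_cst|exact: he].
  exact: (ccvg_cdual _ _ _ _ _ eb).
- by move=> n x; rewrite powR_ge0.
- move=> n; apply: (@le_trans _ _ (\int[mu]_x (2 `^ Q * (h x `^ Q + nc (u_ n x) `^ Q))%:E)%E).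
    apply: ge0_le_integral => //.
    + by move=> x _; rewrite lee_fin powR_ge0.
    + exact/measurable_EFinP.
    + apply/measurable_EFinP/measurable_funM => //.
      by apply: (@rintegrable_measurable _ _ _ mu).
    + by move=> x _; rewrite lee_fin powR_addl_le ?normc_ge0.
  rewrite rintegrableE; last exact: rintegrableZ.
  rewrite lee_fin rintegralZ// ler_wpM2l ?powR_ge0// rintegralD ?lerD//.
  by have [] := u_Q n.
- move=> eps eps0; pose eps' := eps / (kap + 1).
  have kap1 : 0 < kap + 1 by rewrite ltr_wpDl.
  have eps'0 : 0 < eps' by rewrite divr_gt0.
  exists (fun x => kap * (eps' `^ 1^-1) `^ (- (Q - 1)) * nc (v x) `^ Q).
    exact: rintegrableZ.
  move=> n x; have /andP[k0x kx] := k0 x.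
  rewrite normrM ger0_norm ?pweight_ge0// /pweight -!mulrA.
  apply: (@le_trans _ _ (kap * ((h x + nc (u_ n x)) `^ (Q - 1) * nc (v x) `^ 1))).
    apply: ler_pM => //; first by rewrite mulr_ge0 ?powR_ge0.
    apply: (@le_trans _ _ (h x `^ (Q - e_ n) * (nc (u_ n x) `^ (e_ n - 1) * nc (v x)))).
      by rewrite ler_wpM2l ?powR_ge0// norm_cdual_le.
    rewrite powRr1 ?normc_ge0// mulrA ler_wpM2r ?normc_ge0//.
    by apply: powR_interp_le; rewrite ?normc_ge0.
  have := powR_mixed_small _ (nc (v x)) _ _ _ QB ltr01 eps'0 (hu0 n x) (normc_ge0 _).
  rewrite subrK => H.
  apply: (le_trans (ler_wpM2l kap0 H)); rewrite mulrDr lerD//.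
    rewrite mulrA ler_wpM2r ?powR_ge0// /eps' mulrCA ler_piMr ?(ltW eps0)//.
    by rewrite ler_pdivrMr// mul1r lerDl.
Qed.

Lemma dptermzz e (u : T -> C) : 1 < e -> dpterm k h e u u = pterm k h e u.
Proof. by move=> e1; rewrite dptermE ptermE; apply: eq_Rintegral => x _; rewrite cdualzz. Qed.

Lemma dpterm_comb e (u v y : T -> C) (a b : R) : 1 < e -> e <= Q ->
  LQ u -> LQ v -> LQ y ->
  dpterm k h e u (fun x => a%:C%C * v x + b%:C%C * y x) =
  a * dpterm k h e u v + b * dpterm k h e u y.
Proof.
move=> e1 eQ uQ vQ yQ; have e0 : 0 < e by exact: lt_trans e1.
have I z : LQ z -> rintegrable mu (fun x => pweight k h e x * cdual e (u x) (z x)).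
  move=> zQ; apply: rintegrable_cdual => //.
  - exact: measurable_pweight.
  - by move=> x; exact: pweight_ge0.
  - by case: uQ.
  - by case: zQ.
  - exact: rintegrable_pterm.
  - exact: rintegrable_pterm.
rewrite !dptermE -!rintegralZ ?I// -rintegralD; [|exact: rintegrableZ (I _ vQ)|exact: rintegrableZ (I _ yQ)].
apply: eq_Rintegral => x _.
by rewrite /cdual /cdot complexReD complexImD !complexReZ !complexImZ; ring.
Qed.

Lemma ptermZ e (u : T -> C) (t : R) : 0 < e -> 0 <= t -> e <= Q -> LQ u ->
  pterm k h e (fun x => t%:C%C * u x) = t `^ e * pterm k h e u.
Proof.
move=> e0 t0 eQ uQ; rewrite !ptermE -rintegralZ; last exact: rintegrable_pterm.
apply: eq_Rintegral => x _.
by rewrite normcZ ger0_norm// powRM ?normc_ge0// mulrCA.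
Qed.

End perturbed_powers.

(** * The perturbed variational problem and its critical limit *)

Section small_powers.
Context {R : realType}.

(** For [x < 1] both powers are at most [x^c], so [x^(c-1)] is at least [1 / (2 C)]. The bound
    depends on the exponents only through [c], hence stays uniform when they vary. *)
Lemma powR_sum_lower_bound (C c : R) : 0 < C -> 1 < c ->
  exists2 delta : R, 0 < delta & forall x a b, 0 < x -> c <= a -> c <= b ->
    x <= C * (x `^ a + x `^ b) -> delta <= x.
Proof.
move=> C0 c1; have cB : 0 < c - 1 by rewrite subr_gt0.
have C20 : 0 < (2 * C)^-1 by rewrite invr_gt0 mulr_gt0.
exists (Num.min 1 ((2 * C)^-1 `^ (c - 1)^-1)); first by rewrite lt_min ltr01 powR_gt0.
move=> x a b x0 ca cb H; rewrite ge_min; apply/orP.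
have [x1|/ltW x1] := leP 1 x; [by left|right].
have H2 : x <= 2 * C * (x * x `^ (c - 1)).
  apply: (le_trans H); rewrite mulr_powRB1 ?(ltW x0)// ?(lt_trans _ c1)//.
  have x01 : 0 < x <= 1 by rewrite x0.
  have := ger_powR x01 ca; have := ger_powR x01 cb.
  by move=> h1 h2; rewrite [2 * C]mulrC -mulrA ler_wpM2l ?(ltW C0)// mulr_natl mulr2n lerD.
have : (2 * C)^-1 <= x `^ (c - 1).
  move: H2; rewrite mulrCA ler_pMr// => H2.
  by rewrite -[leLHS]mulr1 ler_pdivrMl ?mulr_gt0.
move=> H3; rewrite [leRHS](_ : x = (x `^ (c - 1)) `^ (c - 1)^-1); last first.
  by rewrite -powRrM divff ?gt_eqF// powRr1// ltW.
by rewrite ge0_ler_powR ?nnegrE ?(ltW C20) ?powR_ge0 ?invr_ge0 ?(ltW cB).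
Qed.

Lemma cvg_of_quotient (F_ t_ : nat -> R) (F0 l : R) : (forall n, 0 < t_ n) ->
  t_ @ \oo --> (0 : R) -> (fun n => (t_ n)^-1 * (F_ n - F0)) @ \oo --> l ->
  F_ @ \oo --> F0.
Proof.
move=> t0 tcv Fl.
have H : (fun n => F0 + t_ n * ((t_ n)^-1 * (F_ n - F0))) @ \oo --> F0 + 0 * l.
  by apply: cvgD; [exact: cvg_cst|exact: cvgM].
rewrite mul0r addr0 in H; apply: cvg_trans H; apply: near_eq_cvg; apply: nearW => n.
by rewrite mulrA divff ?gt_eqF// mul1r addrC subrK.
Qed.

End small_powers.

(** * The variational problem for an abstract linear map [L] *)

Section variational.
Context {d1 d2} {T1 : measurableType d1} {T2 : measurableType d2} {R : realType}.
Variables (mu1 : {measure set T1 -> \bar R}) (mu2 : {measure set T2 -> \bar R}).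
Local Notation C := R[i].
Local Notation nc := (@ComplexField.Normc.normc R).
Variables (p Q S : R) (w : T2 -> R) (L : (T1 -> C) -> T2 -> C).

Definition dirichlet := locked (fun u : T1 -> C =>
  \int[mu2]_z (w z * nc (L u z) `^ p)).

Definition ddirichlet := locked (fun u v : T1 -> C =>
  \int[mu2]_z (w z * cdual p (L u z) (L v z))).

Lemma dirichletE u : dirichlet u = \int[mu2]_z (w z * nc (L u z) `^ p).
Proof. by rewrite /dirichlet -lock. Qed.

Lemma ddirichletE u v :
  ddirichlet u v = \int[mu2]_z (w z * cdual p (L u z) (L v z)).
Proof. by rewrite /ddirichlet -lock. Qed.

Definition energy_space (u : T1 -> C) :=
  [/\ LQ mu1 Q u, cmeasurable (L u) & rintegrable mu2 (fun z => w z * nc (L u z) `^ p)].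

Definition ae_ccvg (u_ : nat -> T1 -> C) (u : T1 -> C) :=
  {ae mu1, forall x, ccvg (fun n => u_ n x) (u x)} /\
  {ae mu2, forall z, ccvg (fun n => L (u_ n) z) (L u z)}.

Local Notation E := energy_space.
Local Notation N := dirichlet.
Local Notation mass u := (\int[mu1]_x (nc (u x) `^ Q)).

Hypotheses (p1 : 1 < p) (pQ : p < Q) (S0 : 0 <= S).
Hypotheses (mw : measurable_fun setT w) (w0 : forall z, 0 <= w z).
Hypothesis L_lin : forall (a b : R) (u v : T1 -> C) z,
  L (fun x => a%:C%C * u x + b%:C%C * v x) z = a%:C%C * L u z + b%:C%C * L v z.
Hypothesis sobolev : forall u, E u -> mass u <= S * N u `^ (Q / p).
Hypothesis bounded_compact : forall (u_ : nat -> T1 -> C) (B : R),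
  (forall n, E (u_ n)) -> (forall n, N (u_ n) <= B) ->
  exists (sigma : nat -> nat) (u : T1 -> C),
    [/\ forall n, (n <= sigma n)%N, cmeasurable u, cmeasurable (L u) &
        ae_ccvg (u_ \o sigma) u].

Let p0 : 0 < p. Proof. exact: lt_trans p1. Qed.
Let Q0 : 0 < Q. Proof. exact: lt_trans pQ. Qed.

Lemma dirichlet_ge0 u : 0 <= N u.
Proof. by rewrite dirichletE; apply: rintegral_ge0 => z; rewrite mulr_ge0 ?powR_ge0. Qed.

Lemma energy_space_comb u v (a b : R) : E u -> E v ->
  E (fun x => a%:C%C * u x + b%:C%C * v x).
Proof.
move=> [[mu_ ui] mLu Lui] [[mv vi] mLv Lvi].
have LE : L (fun x => a%:C%C * u x + b%:C%C * v x) =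
   (fun z => a%:C%C * L u z + b%:C%C * L v z) by apply/funext => z; exact: L_lin.
split; [split|rewrite LE|rewrite LE]; try exact: cmeasurable_comb.
  have ui' : rintegrable mu1 (fun x => cst 1 x * nc (u x) `^ Q).
    by under eq_fun do rewrite mul1r.
  have vi' : rintegrable mu1 (fun x => cst 1 x * nc (v x) `^ Q).
    by under eq_fun do rewrite mul1r.
  have := rintegrable_comb mu1 (cst 1) (measurable_cst _) (fun=> ler01) _ _ a b _ Q0 mu_ mv ui' vi'.
  by under eq_fun do rewrite mul1r.
exact: rintegrable_comb.
Qed.

Lemma energy_spaceD u v (t : R) : E u -> E v -> E (fun x => u x + t%:C%C * v x).
Proof.
move=> uE vE; have := energy_space_comb _ _ 1 t uE vE.
by under eq_fun do rewrite mul1r.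
Qed.

Lemma L_linD u v (t : R) z : L (fun x => u x + t%:C%C * v x) z = L u z + t%:C%C * L v z.
Proof. by rewrite -[in RHS](mul1r (L u z)) -L_lin; congr L; apply/funext => x; rewrite mul1r. Qed.

Lemma energy_spaceZ u (t : R) : E u -> E (fun x => t%:C%C * u x).
Proof.
move=> uE; have := energy_space_comb _ _ t 0 uE uE.
by under eq_fun do rewrite mul0r addr0.
Qed.

Lemma dirichletZ u (t : R) : 0 <= t -> E u -> N (fun x => t%:C%C * u x) = t `^ p * N u.
Proof.
move=> t0 [_ _ ui]; rewrite !dirichletE -rintegralZ//; apply: eq_Rintegral => z _.
have -> : L (fun x => t%:C%C * u x) z = t%:C%C * L u z.
  have := L_lin t 0 u u z; rewrite mul0r addr0 => <-.
  by congr L; apply/funext => x; rewrite mul0r addr0.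
by rewrite normcZ ger0_norm// powRM ?normc_ge0// mulrCA.
Qed.

Lemma ddirichletzz u : ddirichlet u u = N u.
Proof. by rewrite dirichletE ddirichletE; apply: eq_Rintegral => z _; rewrite cdualzz. Qed.

Lemma ddirichlet_comb u v y (a b : R) : E u -> E v -> E y ->
  ddirichlet u (fun x => a%:C%C * v x + b%:C%C * y x) =
  a * ddirichlet u v + b * ddirichlet u y.
Proof.
move=> [_ mu_ ui] [_ mv vi] [_ my yi].
rewrite !ddirichletE -!rintegralZ; [|exact: rintegrable_cdual..].
rewrite -rintegralD; [|exact/rintegrableZ/rintegrable_cdual..].
apply: eq_Rintegral => z _; rewrite L_lin.
by rewrite /cdual /cdot complexReD complexImD !complexReZ !complexImZ; ring.
Qed.

Lemma cvg_dirichlet_quotient u v (t_ : nat -> R) :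
  (forall n, 0 < t_ n) -> (forall n, t_ n <= 1) -> t_ @ \oo --> (0 : R) -> E u -> E v ->
  (fun n => (t_ n)^-1 * (N (fun x => u x + (t_ n)%:C%C * v x) - N u)) @ \oo -->
  p * ddirichlet u v.
Proof.
move=> t0 t1 tcv [_ mu_ ui] [_ mv vi].
have NE n : N (fun x => u x + (t_ n)%:C%C * v x) =
    \int[mu2]_z (w z * nc (L u z + (t_ n)%:C%C * L v z) `^ p).
  by rewrite dirichletE; apply: eq_Rintegral => z _; rewrite L_linD.
under eq_fun do rewrite NE.
rewrite dirichletE ddirichletE.
exact: cvg_wpower_quotient.
Qed.

Lemma cvg_pterm_quotient kap k h (e : R) u v (t_ : nat -> R) :
  0 <= kap -> admissible mu1 Q kap k h -> 1 < e -> e <= Q ->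
  (forall n, 0 < t_ n) -> (forall n, t_ n <= 1) -> t_ @ \oo --> (0 : R) -> E u -> E v ->
  (fun n => (t_ n)^-1 * (pterm mu1 Q k h e (fun x => u x + (t_ n)%:C%C * v x)
     - pterm mu1 Q k h e u)) @ \oo --> e * dpterm mu1 Q k h e u v.
Proof.
move=> kap0 adm e1 eQ t0 t1 tcv [uQ _ _] [vQ _ _].
have e0 : 0 < e by exact: lt_trans e1.
rewrite dptermE ptermE; under eq_fun do rewrite ptermE.
apply: cvg_wpower_quotient => //.
- exact: (measurable_pweight mu1 Q kap k h).
- by move=> x; exact: (pweight_ge0 mu1 Q kap k h).
- by case: uQ.
- by case: vQ.
- exact: (rintegrable_pterm mu1 Q kap k h).
- exact: (rintegrable_pterm mu1 Q kap k h).
Qed.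

(** Lower semicontinuity by Fatou's lemma. The bounds [c_] vary with [n] so that a constraint with
    convergent right-hand side passes to the limit. *)
Lemma dirichlet_liminf (u_ : nat -> T1 -> C) u (c_ : nat -> R) (c : R) :
  (forall n, E (u_ n)) -> cmeasurable (L u) -> ae_ccvg u_ u ->
  (forall n, N (u_ n) <= c_ n) -> c_ @ \oo --> c ->
  rintegrable mu2 (fun z => w z * nc (L u z) `^ p) /\ N u <= c.
Proof.
move=> u_E mLu [_ Lcv] Nc cc.
have H : (\int[mu2]_z (w z * nc (L u z) `^ p)%:E <= c%:E)%E.
  apply: (@fatou_cvg _ _ _ mu2 (fun n z => w z * nc (L (u_ n) z) `^ p) _ c_) => //.
  - move=> n; apply: measurable_funM => //; apply: cmeasurable_normc_powR.
    by have [] := u_E n.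
  - by apply: measurable_funM => //; apply: cmeasurable_normc_powR.
  - by move=> n z; rewrite mulr_ge0 ?powR_ge0.
  - by move=> z; rewrite mulr_ge0 ?powR_ge0.
  - apply: filterS Lcv => z Lz; apply: cvgM; first exact: cvg_cst.
    apply: (@cvg_powR _ _ _ _ _ p) => //; last exact: cvg_cst.
    + by move=> n; rewrite normc_ge0.
    + exact: ccvg_normc.
  - move=> n; rewrite rintegrableE; last by have [] := u_E n.
    by rewrite lee_fin -dirichletE; exact: Nc.
have I : rintegrable mu2 (fun z => w z * nc (L u z) `^ p).
  apply: ge0_rintegrable.
  - by apply: measurable_funM => //; apply: cmeasurable_normc_powR.
  - by move=> z; rewrite mulr_ge0 ?powR_ge0.
  - by apply: le_lt_trans H _; rewrite ltry.
by split => //; rewrite dirichletE -lee_fin -rintegrableE.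
Qed.

Lemma mass_le u (B : R) : E u -> N u <= B -> mass u <= S * B `^ (Q / p).
Proof.
move=> uE uB; apply: (le_trans (sobolev _ uE)); rewrite ler_wpM2l//.
have B0 : 0 <= B := le_trans (dirichlet_ge0 u) uB.
have Qp : 0 <= Q / p by rewrite divr_ge0 ?ltW.
by rewrite ge0_ler_powR ?nnegrE ?dirichlet_ge0.
Qed.

Lemma bounded_subsequence (u_ : nat -> T1 -> C) (B : R) :
  (forall n, E (u_ n)) -> (forall n, N (u_ n) <= B) ->
  exists (sigma : nat -> nat) (u : T1 -> C),
    [/\ forall n, (n <= sigma n)%N, E u & ae_ccvg (u_ \o sigma) u].
Proof.
move=> u_E u_B; have [sigma [u [sn mu_ mLu cv]]] := bounded_compact _ _ u_E u_B.
exists sigma, u; split => //.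
have [Li _] := dirichlet_liminf _ _ _ B (fun n => u_E (sigma n)) mLu cv
  (fun n => u_B (sigma n)) (@cvg_cst _ _ _ _ _).
split => //; split => //.
apply: ge0_rintegrable.
- exact: cmeasurable_normc_powR.
- by move=> x; rewrite powR_ge0.
- apply: (@le_lt_trans _ _ (S * B `^ (Q / p))%:E); last by rewrite ltry.
  apply: (@fatou_bound _ _ _ mu1 (fun n x => nc (u_ (sigma n) x) `^ Q)) => //.
  + by move=> n; apply: cmeasurable_normc_powR; have [[]] := u_E (sigma n).
  + exact: cmeasurable_normc_powR.
  + by move=> n x; rewrite powR_ge0.
  + by move=> x; rewrite powR_ge0.
  + case: cv => cv _; apply: filterS cv => x ux.
    apply: (@cvg_powR _ _ _ _ _ Q) => //; last exact: cvg_cst.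
    * by move=> n; rewrite normc_ge0.
    * exact: ccvg_normc.
  + move=> n; have [[_ ui] _ _] := u_E (sigma n).
    by rewrite rintegrableE// lee_fin mass_le.
Qed.

(** The exponent [e] is absent on purpose: the added 1's make both bases at least 1, so their powers
    [1 - e / Q] and [e / Q] are bounded by the bases. *)
Definition growth_constant := locked (fun (kap : R) (h : T1 -> R) =>
  kap * (1 + \int[mu1]_x (h x `^ Q)) * (1 + S)).

Lemma pterm_le_dirichlet kap k h (e m : R) u :
  0 <= kap -> admissible mu1 Q kap k h -> 0 < e -> e < Q -> E u -> 0 < m -> N u <= m ->
  pterm mu1 Q k h e u <= growth_constant kap h * m `^ (e / p).
Proof.
move=> kap0 adm e0 eQ uE m0 um; have [uQ _ _] := uE.
have b0 : 0 < (1 + S) * m `^ (Q / p) by rewrite mulr_gt0 ?powR_gt0// ltr_wpDr.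
have ub : mass u <= (1 + S) * m `^ (Q / p).
  by apply: (le_trans (mass_le _ _ uE um)); rewrite ler_wpM2r ?powR_ge0// lerDr.
have := pterm_le_interp _ _ _ _ _ kap0 adm _ _ _ e0 eQ uQ b0 ub.
move=> H; apply: (le_trans H); rewrite /growth_constant -lock -[leRHS]mulrA ler_wpM2l//.
  rewrite mulr_ge0// addr_ge0//; apply: rintegral_ge0 => x; exact: powR_ge0.
have Se : 1 <= 1 + S by rewrite lerDl.
rewrite powRM ?powR_ge0 ?(le_trans ler01)// -powRrM.
have -> : Q / p * (e / Q) = e / p by field; rewrite !gt_eqF.
rewrite ler_wpM2r ?powR_ge0//; apply: ler1_powR => //.
by rewrite ler_pdivrMr// mul1r ltW.
Qed.

(** * Constrained minimizers of the subcritical problem *)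

Section ground_state.
Variables (kap1 kap2 e1 e2 : R) (k1 h1 k2 h2 : T1 -> R).
Hypotheses (kap1_ge0 : 0 <= kap1) (kap2_ge0 : 0 <= kap2).
Hypotheses (adm1 : admissible mu1 Q kap1 k1 h1) (adm2 : admissible mu1 Q kap2 k2 h2).
Hypotheses (pe1 : p < e1) (e1Q : e1 < Q) (pe2 : p < e2) (e2Q : e2 < Q).
Local Notation B1 := (pterm mu1 Q k1 h1 e1).
Local Notation B2 := (pterm mu1 Q k2 h2 e2).
Local Notation dB1 := (dpterm mu1 Q k1 h1 e1).
Local Notation dB2 := (dpterm mu1 Q k2 h2 e2).
Local Notation a1 := (p^-1 - e1^-1).
Local Notation a2 := (p^-1 - e2^-1).

(** Where [N = B1 + B2], this is the energy [N / p - B1 / e1 - B2 / e2]. *)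
Definition nehari_energy u := a1 * B1 u + a2 * B2 u.

(* An inequality, unlike the usual Nehari constraint, passes to weak limits;
   minimizers turn it into an equality. *)
Definition nehari_feasible u := [/\ E u, 0 < N u & N u <= B1 u + B2 u].

Definition nehari_minimizer u := nehari_feasible u /\
  forall v, nehari_feasible v -> nehari_energy u <= nehari_energy v.

Let e1_gt1 : 1 < e1. Proof. exact: lt_trans pe1. Qed.
Let e2_gt1 : 1 < e2. Proof. exact: lt_trans pe2. Qed.
Let e1_gt0 : 0 < e1. Proof. exact: lt_trans e1_gt1. Qed.
Let e2_gt0 : 0 < e2. Proof. exact: lt_trans e2_gt1. Qed.
Let a1_gt0 : 0 < a1. Proof. by rewrite subr_gt0 ltf_pV2 ?posrE. Qed.
Let a2_gt0 : 0 < a2. Proof. by rewrite subr_gt0 ltf_pV2 ?posrE. Qed.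

Lemma pterm1_ge0 u : 0 <= B1 u. Proof. exact: (pterm_ge0 mu1 Q kap1). Qed.
Lemma pterm2_ge0 u : 0 <= B2 u. Proof. exact: (pterm_ge0 mu1 Q kap2). Qed.

Lemma nehari_energy_ge0 u : 0 <= nehari_energy u.
Proof.
by apply: addr_ge0; apply: mulr_ge0; rewrite ?pterm1_ge0 ?pterm2_ge0 ?(ltW a1_gt0) ?(ltW a2_gt0).
Qed.

Lemma dirichlet_le_energy u (a : R) : 0 < a -> a <= a1 -> a <= a2 -> N u <= B1 u + B2 u ->
  N u <= a^-1 * nehari_energy u.
Proof.
move=> a0 aa1 aa2 NB; apply: (le_trans NB); rewrite ler_pdivlMl// mulrDr.
by rewrite lerD// ler_wpM2r ?pterm1_ge0 ?pterm2_ge0.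
Qed.

Lemma pterms_le (c m : R) u : growth_constant kap1 h1 <= c -> growth_constant kap2 h2 <= c ->
  0 < m -> E u -> N u <= m -> B1 u + B2 u <= c * (m `^ (e1 / p) + m `^ (e2 / p)).
Proof.
move=> g1 g2 m0 uE um; rewrite mulrDr lerD//.
  apply: (le_trans (pterm_le_dirichlet _ _ _ _ _ _ kap1_ge0 adm1 e1_gt0 e1Q uE m0 um)).
  by apply: ler_wpM2r => //; exact: powR_ge0.
apply: (le_trans (pterm_le_dirichlet _ _ _ _ _ _ kap2_ge0 adm2 e2_gt0 e2Q uE m0 um)).
by apply: ler_wpM2r => //; exact: powR_ge0.
Qed.

(** Direct method: on the feasible set the energy controls [N], so a minimizing sequence is bounded;
    [B1] and [B2] converge along a subsequence and [N] is lower semicontinuous. The limit is not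
    zero because the growth of [B1 + B2] beyond first order in [N] keeps [N] above a fixed [delta]
    on the feasible set. *)
Lemma exists_nehari_minimizer phi : nehari_feasible phi -> exists u, nehari_minimizer u.
Proof.
move=> phiF.
pose V := [set nehari_energy u | u in nehari_feasible].
have Vinf : has_inf V.
  split; first by exists (nehari_energy phi), phi.
  by exists 0 => _ [u _ <-]; exact: nehari_energy_ge0.
have /choice[u_ u_P] n : exists u, nehari_feasible u /\ nehari_energy u < inf V + n.+1%:R^-1.
  have n0 : 0 < n.+1%:R^-1 :> R by rewrite invr_gt0.
  by have [_ [u uF <-] Hu] := inf_adherent n0 Vinf; exists u.
pose a := Num.min a1 a2.
have a_gt0 : 0 < a by rewrite lt_min a1_gt0.
have u_N n : N (u_ n) <= a^-1 * (inf V + 1).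
  have [[_ _ NB] lt] := u_P n.
  have aa1 : a <= a1 by rewrite ge_min lexx.
  have aa2 : a <= a2 by rewrite ge_min lexx orbT.
  apply: (le_trans (dirichlet_le_energy _ _ a_gt0 aa1 aa2 NB)).
  rewrite ler_wpM2l ?invr_ge0 ?(ltW a_gt0)// (le_trans (ltW lt))// lerD2l.
  by rewrite invf_le1// ler1n.
have u_E n : E (u_ n) by have [[]] := u_P n.
have [sigma [u [sn uE cv]]] := bounded_subsequence _ _ u_E u_N.
have vE n : E ((u_ \o sigma) n) by exact: u_E.
have vQ n : LQ mu1 Q ((u_ \o sigma) n) by have [] := vE n.
have muu : cmeasurable u by have [[]] := uE.
have mLu : cmeasurable (L u) by case: uE.
have vM n : mass ((u_ \o sigma) n) <= S * (a^-1 * (inf V + 1)) `^ (Q / p).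
  by apply: mass_le => //; exact: u_N.
have cv1 := cvg_pterm _ _ _ _ _ kap1_ge0 adm1 _ _ _ _ e1_gt0 e1Q vQ muu cv.1 vM.
have cv2 := cvg_pterm _ _ _ _ _ kap2_ge0 adm2 _ _ _ _ e2_gt0 e2Q vQ muu cv.1 vM.
have cvB : (fun n => B1 ((u_ \o sigma) n) + B2 ((u_ \o sigma) n)) @ \oo --> B1 u + B2 u.
  exact: cvgD.
have vNB n : N ((u_ \o sigma) n) <= B1 ((u_ \o sigma) n) + B2 ((u_ \o sigma) n).
  by have [[]] := u_P (sigma n).
have [_ uNB] := dirichlet_liminf _ _ _ _ vE mLu cv vNB cvB.
pose g := 1 + `|growth_constant kap1 h1| + `|growth_constant kap2 h2|.
have g0 : 0 < g by rewrite !ltr_wpDr.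
have g1 : growth_constant kap1 h1 <= g.
  by rewrite (le_trans (ler_norm _))// /g addrAC lerDr addr_ge0.
have g2 : growth_constant kap2 h2 <= g.
  by rewrite (le_trans (ler_norm _))// /g lerDr addr_ge0.
pose c := Num.min (e1 / p) (e2 / p).
have c1 : 1 < c by rewrite lt_min !ltr_pdivlMr// !mul1r pe1.
have ce1 : c <= e1 / p by rewrite ge_min lexx.
have ce2 : c <= e2 / p by rewrite ge_min lexx orbT.
have [delta delta0 Hdelta] := powR_sum_lower_bound _ _ g0 c1.
have v_delta n : delta <= N ((u_ \o sigma) n).
  have [[_ N0 NB] _] := u_P (sigma n).
  apply: (Hdelta _ (e1 / p) (e2 / p)) => //; apply: (le_trans NB).
  exact: pterms_le.
have B_delta : delta <= B1 u + B2 u.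
  rewrite -(cvg_lim _ cvB)//; apply: limr_ge; first exact: cvgP cvB.
  by apply: nearW => n; exact: le_trans (v_delta n) (vNB n).
(* Lower semicontinuity gives no lower bound for [N u]; the bound [delta] survives only in
   [B1 u + B2 u]. If [N u] vanished, the growth estimate at radius [delta / 2] would force
   [delta <= delta / 2]. *)
have N_gt0 : 0 < N u.
  rewrite ltNge; apply/negP => N0.
  have d20 : 0 < delta / 2 by rewrite divr_gt0.
  have := pterms_le _ _ _ g1 g2 d20 uE (le_trans N0 (ltW d20)).
  move=> /(le_trans B_delta) H.
  have := Hdelta _ _ _ d20 ce1 ce2 (le_trans _ H).
  lra.
exists u; split => // v vF.
apply: (@le_trans _ _ (inf V)); last by apply: ge_inf; [case: Vinf|exists v].
have cvPhi : (fun n => nehari_energy ((u_ \o sigma) n)) @ \oo --> nehari_energy u.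
  by apply: cvgD; (apply: cvgM; [exact: cvg_cst|]).
have cvV : (fun n => inf V + n.+1%:R^-1) @ \oo --> inf V.
  rewrite -[X in _ --> X]addr0; apply: cvgD; first exact: cvg_cst.
  exact: cvg_harmonic.
apply: (ler_cvg_to cvPhi cvV); apply: nearW => n /=.
have [_ /ltW H] := u_P (sigma n); apply: (le_trans H).
by rewrite lerD2l lef_pV2 ?posrE// ler_nat ltnS.
Qed.

(* First-order optimality: along [u + t y] the energy would decrease for small
   [t > 0] while the constraint stays satisfied. *)
Lemma no_descent u y : nehari_minimizer u -> E y ->
  a1 * (e1 * dB1 u y) + a2 * (e2 * dB2 u y) < 0 ->
  (N u < B1 u + B2 u \/ p * ddirichlet u y < e1 * dB1 u y + e2 * dB2 u y) -> False.
Proof.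
move=> [[uE N0 NB] umin] yE dPhi descent.
pose t_ n : R := n.+1%:R^-1.
have t0 n : 0 < t_ n by rewrite invr_gt0.
have t1 n : t_ n <= 1 by rewrite invf_le1// ler1n.
have tcv : t_ @ \oo --> (0 : R) by exact: cvg_harmonic.
pose v n x := u x + (t_ n)%:C%C * y x.
have vE n : E (v n) by exact: energy_spaceD.
have qN : (fun n => (t_ n)^-1 * (N (v n) - N u)) @ \oo --> p * ddirichlet u y.
  exact: cvg_dirichlet_quotient.
have q1 : (fun n => (t_ n)^-1 * (B1 (v n) - B1 u)) @ \oo --> e1 * dB1 u y.
  by apply: (cvg_pterm_quotient kap1) => //; exact: ltW.
have q2 : (fun n => (t_ n)^-1 * (B2 (v n) - B2 u)) @ \oo --> e2 * dB2 u y.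
  by apply: (cvg_pterm_quotient kap2) => //; exact: ltW.
have cN := cvg_of_quotient _ _ _ _ t0 tcv qN.
have c1 := cvg_of_quotient _ _ _ _ t0 tcv q1.
have c2 := cvg_of_quotient _ _ _ _ t0 tcv q2.
have nearN : \forall n \near \oo, 0 < N (v n) by exact: cvgr_gt cN _ N0.
have nearPhi : \forall n \near \oo, nehari_energy (v n) < nehari_energy u.
  have qPhi : (fun n => a1 * ((t_ n)^-1 * (B1 (v n) - B1 u)) +
      a2 * ((t_ n)^-1 * (B2 (v n) - B2 u))) @ \oo -->
      a1 * (e1 * dB1 u y) + a2 * (e2 * dB2 u y).
    by apply: cvgD; (apply: cvgM; first exact: cvg_cst).
  have near0 : \forall n \near \oo, a1 * ((t_ n)^-1 * (B1 (v n) - B1 u)) +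
      a2 * ((t_ n)^-1 * (B2 (v n) - B2 u)) < 0 by exact: cvgr_lt qPhi _ dPhi.
  apply: filterS near0 => n.
  have -> : a1 * ((t_ n)^-1 * (B1 (v n) - B1 u)) +
      a2 * ((t_ n)^-1 * (B2 (v n) - B2 u)) =
      (t_ n)^-1 * (nehari_energy (v n) - nehari_energy u).
    by rewrite /nehari_energy; ring.
  by rewrite pmulr_rlt0 ?invr_gt0// subr_lt0.
have nearNB : \forall n \near \oo, N (v n) <= B1 (v n) + B2 (v n).
  case: descent => [NBlt|dlt].
    have cNB : (fun n => N (v n) - (B1 (v n) + B2 (v n))) @ \oo -->
        N u - (B1 u + B2 u) by apply: cvgB => //; exact: cvgD.
    have NBlt' : N u - (B1 u + B2 u) < 0 by rewrite subr_lt0.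
    have near0 : \forall n \near \oo, N (v n) - (B1 (v n) + B2 (v n)) < 0.
      exact: cvgr_lt cNB _ NBlt'.
    by apply: filterS near0 => n; rewrite subr_lt0 => /ltW.
  have qNB : (fun n => (t_ n)^-1 * (N (v n) - N u) -
      ((t_ n)^-1 * (B1 (v n) - B1 u) + (t_ n)^-1 * (B2 (v n) - B2 u))) @ \oo -->
      p * ddirichlet u y - (e1 * dB1 u y + e2 * dB2 u y).
    by apply: cvgB => //; exact: cvgD.
  have dlt' : p * ddirichlet u y - (e1 * dB1 u y + e2 * dB2 u y) < 0 by rewrite subr_lt0.
  have near0 : \forall n \near \oo, (t_ n)^-1 * (N (v n) - N u) -
      ((t_ n)^-1 * (B1 (v n) - B1 u) + (t_ n)^-1 * (B2 (v n) - B2 u)) < 0.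
    exact: cvgr_lt qNB _ dlt'.
  apply: filterS near0 => n.
  have -> : (t_ n)^-1 * (N (v n) - N u) -
      ((t_ n)^-1 * (B1 (v n) - B1 u) + (t_ n)^-1 * (B2 (v n) - B2 u)) =
      (t_ n)^-1 * ((N (v n) - (B1 (v n) + B2 (v n))) - (N u - (B1 u + B2 u))) by ring.
  rewrite pmulr_rlt0 ?invr_gt0// subr_lt0 => H.
  by rewrite -subr_le0 (le_trans (ltW H))// subr_le0.
have [n [Nn [Phin NBn]]] := filter_ex (filterI nearN (filterI nearPhi nearNB)).
by have := umin (v n) (And3 (vE n) Nn NBn); rewrite leNgt Phin.
Qed.

(** Where the constraint is strict it is inactive, and shrinking [u] lowers the energy: this is
    descent along [y = - u]. *)
Lemma minimizer_on_nehari u : nehari_minimizer u -> N u = B1 u + B2 u.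
Proof.
move=> umin; have [[uE N0 NB] _] := umin.
apply/eqP; rewrite eq_le NB /= leNgt; apply/negP => NBlt.
have yE : E (fun x => (-1)%:C%C * u x) by exact: energy_spaceZ.
have uQ : LQ mu1 Q u by case: uE.
have d1E : dB1 u (fun x => (-1)%:C%C * u x) = - B1 u.
  have := dpterm_comb _ _ _ _ _ kap1_ge0 adm1 e1 u u u (-1) 0 e1_gt1 (ltW e1Q) uQ uQ uQ.
  rewrite dptermzz// mul0r addr0 mulN1r => <-.
  by congr (dpterm _ _ _ _ _ _ _); apply/funext => x; rewrite mul0r addr0.
have d2E : dB2 u (fun x => (-1)%:C%C * u x) = - B2 u.
  have := dpterm_comb _ _ _ _ _ kap2_ge0 adm2 e2 u u u (-1) 0 e2_gt1 (ltW e2Q) uQ uQ uQ.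
  rewrite dptermzz// mul0r addr0 mulN1r => <-.
  by congr (dpterm _ _ _ _ _ _ _); apply/funext => x; rewrite mul0r addr0.
apply: (no_descent _ _ umin yE); last by left.
rewrite d1E d2E !mulrN -opprD oppr_lt0.
have Bpos : 0 < B1 u + B2 u by exact: lt_le_trans NB.
have c1 : 0 < a1 * e1 by rewrite mulr_gt0.
have c2 : 0 < a2 * e2 by rewrite mulr_gt0.
have := pterm1_ge0 u; have := pterm2_ge0 u; rewrite !mulrA.
move: (B1 u) (B2 u) Bpos => b1 b2 Bpos b2_0 b1_0.
have [b1z|b1nz] := eqVneq b1 0.
  by rewrite b1z mulr0 add0r mulr_gt0//; move: Bpos; rewrite b1z add0r.
apply: ltr_pwDl; last by apply: mulr_ge0 => //; exact: ltW.
by apply: mulr_gt0 => //; rewrite lt_neqAle eq_sym b1nz.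
Qed.

(** In any direction, [1/p] times the derivative of [N - B1' - B2'], with [p], [e1], [e2] produced
    by differentiation, plus the derivative of the energy is [ddirichlet - dB1 - dB2]. Along [u]
    this sum is [N - B1 - B2 = 0], so along [c u + s v] it is [s D]. If [D] were not 0, the sign [s]
    makes it negative and a suitable [c] makes both summands negative, which [no_descent] excludes.
    This replaces a Lagrange multiplier. *)
Lemma minimizer_weak_solution u v : nehari_minimizer u -> E v ->
  ddirichlet u v = dB1 u v + dB2 u v.
Proof.
move=> umin vE; have NB := minimizer_on_nehari _ umin.
have [[uE N0 _] _] := umin.
have uQ : LQ mu1 Q u by case: uE.
have vQ : LQ mu1 Q v by case: vE.
apply/eqP; rewrite -subr_eq0; apply/negPn/negP.
set D := _ - _ => D0.
pose s : R := - Num.sg D.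
have sD : s * D < 0 by rewrite /s mulNr oppr_lt0 -normrEsg normr_gt0.
pose den := a1 * (e1 * B1 u) + a2 * (e2 * B2 u).
have den0 : 0 < den.
  have c1 : 0 < a1 * e1 by rewrite mulr_gt0.
  have c2 : 0 < a2 * e2 by rewrite mulr_gt0.
  have Bpos : 0 < B1 u + B2 u by rewrite -NB.
  have := pterm1_ge0 u; have := pterm2_ge0 u; rewrite /den !mulrA.
  move: (B1 u) (B2 u) Bpos => b1 b2 Bpos b2_0 b1_0.
  have [b1z|b1nz] := eqVneq b1 0.
    by rewrite b1z mulr0 add0r mulr_gt0//; move: Bpos; rewrite b1z add0r.
  apply: ltr_pwDl; last by apply: mulr_ge0 => //; exact: ltW.
by apply: mulr_gt0 => //; rewrite lt_neqAle eq_sym b1nz.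
pose rest := a1 * (e1 * dB1 u v) + a2 * (e2 * dB2 u v).
(* [c] solves [c * den + s * rest = s * D / 2]: the energy derivative takes one half of [s * D] and
   leaves the other half to the constraint. *)
pose c := (s * D / 2 - s * rest) / den.
have yE : E (fun x => c%:C%C * u x + s%:C%C * v x) by exact: energy_space_comb.
have d1E := dpterm_comb _ _ _ _ _ kap1_ge0 adm1 e1 u u v c s e1_gt1 (ltW e1Q) uQ uQ vQ.
have d2E := dpterm_comb _ _ _ _ _ kap2_ge0 adm2 e2 u u v c s e2_gt1 (ltW e2Q) uQ uQ vQ.
have dNE := ddirichlet_comb _ _ _ c s uE uE vE.
rewrite dptermzz// in d1E; rewrite dptermzz// in d2E; rewrite ddirichletzz in dNE.
have Phi' : a1 * (e1 * dB1 u (fun x => c%:C%C * u x + s%:C%C * v x)) +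
    a2 * (e2 * dB2 u (fun x => c%:C%C * u x + s%:C%C * v x)) = s * D / 2.
  rewrite d1E d2E.
  transitivity (c * den + s * rest); first by rewrite /den /rest; ring.
  by rewrite /c divfK ?gt_eqF// subrK.
apply: (no_descent _ _ umin yE); first by rewrite Phi' pmulr_llt0.
right; rewrite -subr_lt0.
suff : p^-1 * (p * ddirichlet u (fun x => c%:C%C * u x + s%:C%C * v x) -
   (e1 * dB1 u (fun x => c%:C%C * u x + s%:C%C * v x) +
    e2 * dB2 u (fun x => c%:C%C * u x + s%:C%C * v x))) = s * D / 2.
  by move=> H; rewrite -(pmulr_rlt0 _ (_ : 0 < p^-1)) ?invr_gt0// H pmulr_llt0.
have -> : s * D / 2 = s * D - s * D / 2 by field.
rewrite -[in X in _ = _ - X]Phi' dNE d1E d2E NB /D.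
by field; rewrite !gt_eqF.
Qed.

End ground_state.

Lemma pterm_gt0_dirichlet kap k h (e : R) u : 0 <= kap -> admissible mu1 Q kap k h ->
  0 < e -> e < Q -> E u -> 0 < pterm mu1 Q k h e u -> 0 < N u.
Proof.
move=> kap0 adm e0 eQ uE B0; rewrite ltNge; apply/negP => N0.
set B := pterm _ _ _ _ _ _ in B0.
pose g := 1 + `|growth_constant kap h|.
have g0 : 0 < g by rewrite ltr_wpDr.
(* The radius at which the growth bound [g * m^(e/p)] equals [B / 2]. *)
pose m := (B / (2 * g)) `^ (p / e).
have Bg : 0 < B / (2 * g) by rewrite divr_gt0// mulr_gt0.
have m0 : 0 < m by rewrite powR_gt0.
have := pterm_le_dirichlet _ _ _ _ _ _ kap0 adm e0 eQ uE m0 (le_trans N0 (ltW m0)).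
have -> : m `^ (e / p) = B / (2 * g).
  rewrite /m -powRrM (_ : p / e * (e / p) = 1) ?powRr1 ?(ltW Bg)//.
  by field; rewrite !gt_eqF.
rewrite -/B => H.
have H2 : B <= g * (B / (2 * g)).
  apply: (le_trans H); rewrite ler_wpM2r ?(ltW Bg)//.
  by rewrite (le_trans (ler_norm _))// lerDr.
have E2 : g * (B / (2 * g)) = B / 2 by field; rewrite gt_eqF.
move: H2; rewrite E2; lra.
Qed.

(** The direction [v] is fixed, so the integrand is at most [eps |L u_n|^p] plus a multiple of
    [|L v|^p], both against the weight; boundedness of [N] replaces strong convergence. *)
Lemma cvg_ddirichlet (u_ : nat -> T1 -> C) (u v : T1 -> C) (B : R) :
  (forall n, E (u_ n)) -> (forall n, N (u_ n) <= B) -> E u -> E v -> ae_ccvg u_ u ->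
  (fun n => ddirichlet (u_ n) v) @ \oo --> ddirichlet u v.
Proof.
move=> u_E u_B [_ mLu ui] [_ mLv vi] [_ cv].
have pB : 0 < p - 1 by rewrite subr_gt0.
rewrite ddirichletE; under eq_fun do rewrite ddirichletE.
have [] // := @cvg_Rintegral_equi _ _ _ mu2
  (fun n z => w z * cdual p (L (u_ n) z) (L v z))
  (fun n z => w z * nc (L (u_ n) z) `^ p)
  (fun z => w z * cdual p (L u z) (L v z)) B.
- by move=> n; apply: measurable_funM => //; apply: cmeasurable_cdual => //; have [] := u_E n.
- by apply: measurable_funM => //; apply: cmeasurable_cdual.
- apply: filterS cv => z Lz; apply: cvgM; first exact: cvg_cst.
  by apply: (ccvg_cdual _ _ _ _ _ p) => //; exact: cvg_cst.
- by move=> n; apply: measurable_funM => //; apply: cmeasurable_normc_powR; have [] := u_E n.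
- by move=> n z; rewrite mulr_ge0 ?powR_ge0.
- move=> n; rewrite rintegrableE; last by have [] := u_E n.
  by rewrite lee_fin -dirichletE; exact: u_B.
- move=> eps eps0.
  exists (fun z => (eps `^ 1^-1) `^ (- (p - 1)) * (w z * nc (L v z) `^ p)).
    exact: rintegrableZ.
  move=> n z; rewrite normrM (ger0_norm (w0 z)) ![_ * (w z * _)]mulrCA -mulrDr.
  rewrite ler_wpM2l// (le_trans (norm_cdual_le _ _ _ p1))//.
  have := powR_mixed_small (nc (L (u_ n) z)) (nc (L v z)) _ _ _ pB ltr01 eps0
    (normc_ge0 _) (normc_ge0 _).
  by rewrite subrK powRr1 ?normc_ge0.
Qed.

(** * Passage to the critical exponent *)

Section critical_limit.
Variables (kapK q : R) (h K W : T1 -> R).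
Hypotheses (kapK_ge0 : 0 <= kapK) (admH : admissible mu1 Q 1 (cst 1) h).
Hypotheses (admK : admissible mu1 Q kapK K W) (W_gt0 : forall x, 0 < W x).
Hypotheses (pq : p < q) (qQ : q < Q).
Local Notation BH := (pterm mu1 Q (cst 1) h q).
Local Notation dBH := (dpterm mu1 Q (cst 1) h q).
Local Notation gK := (growth_constant kapK W).

Let q_gt0 : 0 < q. Proof. exact: lt_trans pq. Qed.
Let q_gt1 : 1 < q. Proof. exact: lt_trans pq. Qed.
Let qp_gt0 : 0 < q - p. Proof. by rewrite subr_gt0. Qed.

Lemma admissible_cst (lam : R) : 0 <= lam -> admissible mu1 Q lam (cst lam) h.
Proof. by case: admH => _ _ mh h0 hi lam0; split => // x; rewrite lam0/=. Qed.

Lemma pterm_cst (lam : R) u : E u -> pterm mu1 Q (cst lam) h q u = lam * BH u.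
Proof.
move=> [uQ _ _].
have I : rintegrable mu1 (fun x => pweight Q (cst 1) h q x * nc (u x) `^ q).
  exact: (rintegrable_pterm mu1 Q 1 (cst 1) h ler01 admH q u q_gt0 (ltW qQ) uQ).
rewrite !ptermE -rintegralZ//.
by apply: eq_Rintegral => x _; rewrite /pweight/= mul1r mulrA.
Qed.

Lemma dpterm_cst (lam : R) u v : E u -> E v ->
  dpterm mu1 Q (cst lam) h q u v = lam * dBH u v.
Proof.
move=> [uQ _ _] [vQ _ _].
rewrite !dptermE -rintegralZ; last first.
  apply: rintegrable_cdual => //.
  - exact: (measurable_pweight mu1 Q 1).
  - by move=> x; exact: (pweight_ge0 mu1 Q 1).
  - by case: uQ.
  - by case: vQ.
  - exact: (rintegrable_pterm mu1 Q 1 (cst 1) h ler01 admH q _ q_gt0 (ltW qQ)).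
  - exact: (rintegrable_pterm mu1 Q 1 (cst 1) h ler01 admH q _ q_gt0 (ltW qQ)).
by apply: eq_Rintegral => x _; rewrite /pweight/= mul1r mulrA.
Qed.

(** The denominator starts at 2 so that already the first exponent exceeds [q]. *)
Definition exponents (n : nat) : R := Q - (Q - q) / n.+2%:R.

Lemma exponents_gt n : q < exponents n.
Proof.
rewrite ltrBrDl -ltrBrDr ltr_pdivrMr// -ltr_pdivrMl ?subr_gt0// mulVf ?gt_eqF ?subr_gt0//.
by rewrite ltr1n.
Qed.

Lemma exponents_lt n : exponents n < Q.
Proof. by rewrite gtrBl divr_gt0// subr_gt0. Qed.

Lemma cvg_exponents (sigma : nat -> nat) : (forall n, (n <= sigma n)%N) ->
  (exponents \o sigma) @ \oo --> Q.
Proof.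
move=> sn; apply: (@squeeze_cvgr _ _ _ _ (fun n => Q - (Q - q) * n.+1%:R^-1) (cst Q)).
- apply: nearW => n; apply/andP; split; last exact/ltW/exponents_lt.
  rewrite lerD2l lerN2; apply: ler_wpM2l; first by rewrite subr_ge0 ltW.
  by rewrite lef_pV2 ?posrE// ler_nat ltnS leqW.
- rewrite -[X in _ --> X]subr0; apply: cvgB; first exact: cvg_cst.
  rewrite -(mulr0 (Q - q)); apply: cvgM; first exact: cvg_cst.
  exact: cvg_harmonic.
- exact: cvg_cst.
Qed.

(** For [N <= rho] the K-term is at most [gK * N^(e/p)]; since [rho <= 1] and [e > q], this is at
    most [gK * rho^(q/p - 1) * N], hence at most [N / 2] for every exponent of the approximation. *)
Lemma small_radius : exists rho : R, [/\ 0 < rho, rho <= 1 & gK * rho `^ (q / p - 1) <= 2^-1].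
Proof.
pose g := 1 + `|gK|; have g0 : 0 < g by rewrite ltr_wpDr.
have e0 : 0 < q / p - 1 by rewrite subr_gt0 ltr_pdivlMr// mul1r.
pose r := (2 * g)^-1; have r0 : 0 < r by rewrite invr_gt0 mulr_gt0.
exists (Num.min 1 (r `^ (q / p - 1)^-1)); split.
- by rewrite lt_min ltr01 powR_gt0.
- by rewrite ge_min lexx.
set m := Num.min _ _.
have m0 : 0 <= m by rewrite le_min ler01 powR_ge0.
have mr : m `^ (q / p - 1) <= r.
  have -> : r = (r `^ (q / p - 1)^-1) `^ (q / p - 1).
    by rewrite -powRrM mulVf ?gt_eqF// powRr1// ltW.
  apply: ge0_ler_powR; rewrite ?nnegrE ?powR_ge0// ?(ltW e0)//.
  by rewrite ge_min lexx orbT.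
apply: (@le_trans _ _ (g * r)).
  apply: (@le_trans _ _ (g * m `^ (q / p - 1))).
    by rewrite ler_wpM2r ?powR_ge0// (le_trans (ler_norm _))// lerDr.
  by rewrite ler_wpM2l// ltW.
by rewrite /r invfM mulrCA divff ?mulr1// gt_eqF.
Qed.

Local Notation a1 := (p^-1 - q^-1).

(** By the choice of [t] the H-term of [t phi] alone equals its [N], so [t phi] is feasible for
    every [n]. Its energy bounds that of the minimizer, and the energy controls [N] through the
    smaller coefficient [a1]. The smallness condition does not involve [n], because [t^e <= t^p] and
    the crude bound of the K-term is uniform in [e]. *)
Lemma approximate_solution phi lam t rho n :
  0 < rho -> 0 <= lam -> E phi -> 0 < t -> t <= 1 ->
  lam * t `^ q * BH phi = t `^ p * N phi -> 0 < N phi ->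
  t `^ p * (a1 * N phi +
     p^-1 * (kapK * 2 `^ Q * (\int[mu1]_x (W x `^ Q) + mass phi))) <= rho * a1 ->
  exists u, [/\ E u, 0 < N u, N u <= rho,
    N u = lam * BH u + pterm mu1 Q K W (exponents n) u &
    forall v, E v -> ddirichlet u v = lam * dBH u v + dpterm mu1 Q K W (exponents n) u v].
Proof.
move=> rho0 lam0 phiE t0 t1 tE Nphi0 small.
set e := exponents n.
have qe : q < e := exponents_gt n; have eQ : e < Q := exponents_lt n.
have e0 : 0 < e by exact: lt_trans qe.
have pe : p < e by exact: lt_trans qe.
have a1_gt0 : 0 < a1 by rewrite subr_gt0 ltf_pV2 ?posrE.
have a12 : a1 <= p^-1 - e^-1 by rewrite lerD2l lerN2 lef_pV2 ?posrE// ltW.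
have a2p : p^-1 - e^-1 <= p^-1 by rewrite gerBl invr_ge0 ltW.
have admL := admissible_cst _ lam0.
have tE' : E (fun x => t%:C%C * phi x) by exact: energy_spaceZ.
have phiQ : LQ mu1 Q phi by case: phiE.
have NtE : N (fun x => t%:C%C * phi x) = t `^ p * N phi by exact: dirichletZ (ltW t0) phiE.
have B1tE : pterm mu1 Q (cst lam) h q (fun x => t%:C%C * phi x) = t `^ p * N phi.
  by rewrite pterm_cst// -tE -mulrA (ptermZ _ _ 1)// ?ltW.
have B2tE : pterm mu1 Q K W e (fun x => t%:C%C * phi x) = t `^ e * pterm mu1 Q K W e phi.
  by rewrite (ptermZ _ _ kapK)// ?ltW.
have B2phi0 : 0 <= pterm mu1 Q K W e phi by exact: (pterm_ge0 mu1 Q kapK).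
have feas : nehari_feasible q e (cst lam) h K W (fun x => t%:C%C * phi x).
  split => //; first by rewrite NtE mulr_gt0 ?powR_gt0.
  by rewrite NtE B1tE B2tE lerDl mulr_ge0 ?powR_ge0.
have [u umin] := exists_nehari_minimizer _ _ _ _ _ _ _ _ lam0 kapK_ge0 admL admK
   pq qQ pe eQ _ feas.
have [[uE Nu0 uNB] ulow] := umin.
have NB := minimizer_on_nehari _ _ _ _ _ _ _ _ lam0 kapK_ge0 admL admK pq qQ pe eQ _ umin.
exists u; split => //.
- apply: (le_trans (dirichlet_le_energy _ _ _ _ _ _ _ _ admL admK _ _ a1_gt0 (lexx _) a12 uNB)).
  rewrite ler_pdivrMl// mulrC; apply: (le_trans (ulow _ feas)); apply: le_trans small.
  rewrite /nehari_energy B1tE B2tE mulrDr [_ * (t `^ p * _)]mulrCA lerD2l.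
  rewrite [leRHS]mulrCA; apply: ler_pM; rewrite ?mulr_ge0 ?powR_ge0//.
    by rewrite (le_trans (ltW a1_gt0)).
  apply: ler_pM; rewrite ?powR_ge0//.
    by apply: ger_powR; rewrite ?t0// ltW.
  exact: (pterm_le_crude mu1 Q kapK K W kapK_ge0 admK e phi e0 (ltW eQ) phiQ).
- by rewrite NB pterm_cst.
- move=> v vE; rewrite -dpterm_cst//.
  exact: (minimizer_weak_solution _ _ _ _ _ _ _ _ lam0 kapK_ge0 admL admK pq qQ pe eQ).
Qed.

Lemma critical_solution phi : E phi -> 0 < BH phi ->
  exists2 lam0 : R, 0 < lam0 & forall lam, lam0 < lam ->
  exists u, [/\ E u, 0 < BH u, 0 < N u &
    forall v, E v -> ddirichlet u v = lam * dBH u v + dpterm mu1 Q K W Q u v].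
Proof.
move=> phiE X0_gt0; set X0 := BH phi in X0_gt0 *.
have N0_gt0 : 0 < N phi.
  exact: (pterm_gt0_dirichlet 1 (cst 1) h q phi ler01 admH q_gt0 qQ phiE X0_gt0).
have a1_gt0 : 0 < a1 by rewrite subr_gt0 ltf_pV2 ?posrE.
(* On the ball of radius [rho] the [K]-term is at most half of [N], so that the
   [H]-term, which is subcritical and hence weakly continuous, carries the rest. *)
have [rho [rho0 rho1 Hrho]] := small_radius.
pose G := a1 * N phi +
  p^-1 * (kapK * 2 `^ Q * (\int[mu1]_x (W x `^ Q) + mass phi)).
have G0 : 0 < G.
  rewrite ltr_pwDl ?mulr_gt0// mulr_ge0 ?invr_ge0 ?(ltW p0)//.
  apply: mulr_ge0; first by rewrite mulr_ge0 ?powR_ge0.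
  by apply: addr_ge0; apply: rintegral_ge0 => x; exact: powR_ge0.
(* Up to [t0] both [t <= 1] and the smallness condition [t^p * G <= rho * a1] hold. *)
pose t0 := Num.min 1 ((rho * a1 / G) `^ p^-1).
have rG : 0 < rho * a1 / G by rewrite divr_gt0// mulr_gt0.
have t0_gt0 : 0 < t0 by rewrite lt_min ltr01 powR_gt0.
have t0q : 0 < t0 `^ (q - p) by exact: powR_gt0.
(* The root of [lam * t^q * X0 = t^p * N phi] satisfies [t^(q-p) = N phi / (lam * X0)]; beyond this
   value of [lam] it lies below [t0]. *)
exists (N phi / (X0 * t0 `^ (q - p))); first by rewrite divr_gt0// mulr_gt0.
move=> lam Hlam.
have lam_gt0 : 0 < lam by apply: lt_trans Hlam; rewrite divr_gt0// mulr_gt0.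
(* [t phi] is feasible, with an energy that tends to 0 as [lam] grows. *)
pose t := (N phi / (lam * X0)) `^ (q - p)^-1.
have s0 : 0 < N phi / (lam * X0) by rewrite divr_gt0// mulr_gt0.
have t_gt0 : 0 < t by exact: powR_gt0.
have tq : t `^ (q - p) = N phi / (lam * X0).
  by rewrite /t -powRrM mulVf ?gt_eqF// powRr1// ltW.
have tt0 : t <= t0.
  have st0 : N phi / (lam * X0) <= t0 `^ (q - p).
    rewrite ler_pdivrMr ?mulr_gt0// mulrCA -ler_pdivrMr; last by rewrite mulrC mulr_gt0.
    by rewrite [_ * X0]mulrC ltW.
  have -> : t0 = (t0 `^ (q - p)) `^ (q - p)^-1.
    by rewrite -powRrM divff ?gt_eqF// powRr1// ltW.
  by rewrite /t ge0_ler_powR ?nnegrE ?invr_ge0 ?(ltW qp_gt0) ?(ltW s0) ?(ltW t0q).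
have t1 : t <= 1 by apply: (le_trans tt0); rewrite ge_min lexx.
have tE : lam * t `^ q * X0 = t `^ p * N phi.
  have -> : q = p + (q - p) by rewrite addrC subrK.
  rewrite powRD; last by rewrite (gt_eqF t_gt0) implybT.
  rewrite tq; field; rewrite !gt_eqF//.
have small : t `^ p * G <= rho * a1.
  rewrite -ler_pdivlMr//; have -> : rho * a1 / G = ((rho * a1 / G) `^ p^-1) `^ p.
    by rewrite -powRrM mulVf ?gt_eqF// powRr1// ltW.
  rewrite ge0_ler_powR ?(ltW p0) ?nnegrE ?(ltW t_gt0) ?powR_ge0//.
  by apply: (le_trans tt0); rewrite ge_min lexx orbT.
have /choice[u_ u_P] n := approximate_solution _ _ _ _ n rho0 (ltW lam_gt0) phiE
  t_gt0 t1 tE N0_gt0 small.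
have u_E n : E (u_ n) by have [] := u_P n.
have u_N n : N (u_ n) <= rho by have [] := u_P n.
have admL := admissible_cst _ (ltW lam_gt0).
pose g := 1 + `|growth_constant lam h| + `|gK|.
have g_gt0 : 0 < g by rewrite !ltr_wpDr.
have g1 : growth_constant lam h <= g.
  by rewrite (le_trans (ler_norm _))// /g addrAC lerDr addr_ge0.
have g2 : gK <= g by rewrite (le_trans (ler_norm _))// /g lerDr addr_ge0.
have qp1 : 1 < q / p by rewrite ltr_pdivlMr// mul1r.
have [delta delta0 Hdelta] := powR_sum_lower_bound _ _ g_gt0 qp1.
have qpe n : q / p <= exponents n / p.
  by rewrite ler_wpM2r ?invr_ge0 ?(ltW p0)//; exact/ltW/exponents_gt.
have u_delta n : delta <= N (u_ n).
  have [uE Nu0 _ NB _] := u_P n.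
  apply: (Hdelta _ (q / p) (exponents n / p)) => //.
  rewrite [leLHS]NB -(pterm_cst _ _ uE).
  apply: (pterms_le _ _ _ _ _ _ _ _ (ltW lam_gt0) kapK_ge0 admL admK) => //.
  - by apply: lt_trans pq (exponents_gt n).
  - exact: exponents_lt.
have u_BH n : delta / (2 * lam) <= BH (u_ n).
  have [uE Nu0 Nrho NB _] := u_P n.
  have e0 : 0 < exponents n by exact: lt_trans (exponents_gt n).
  have H1 := pterm_le_dirichlet _ _ _ _ _ _ kapK_ge0 admK e0 (exponents_lt n) uE Nu0 (lexx _).
  have gK0 : 0 <= gK.
    rewrite /growth_constant -lock !mulr_ge0 ?addr_ge0//.
    by apply: rintegral_ge0 => x; exact: powR_ge0.
  have x01 : 0 < N (u_ n) <= 1 by rewrite Nu0 (le_trans Nrho).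
  (* As [N <= 1], the exponent may be lowered to [q / p], which frees the estimate from [n]. *)
  have H2 : N (u_ n) `^ (exponents n / p) <= N (u_ n) * rho `^ (q / p - 1).
    apply: (le_trans (ger_powR x01 (qpe n))).
    rewrite -[leLHS](mulr_powRB1 (ltW Nu0)) ?(lt_trans _ qp1)//.
    rewrite ler_wpM2l ?(ltW Nu0)// ge0_ler_powR ?subr_ge0 ?(ltW qp1)// nnegrE ltW//.
  have H3 : pterm mu1 Q K W (exponents n) (u_ n) <= N (u_ n) / 2.
    apply: (le_trans H1); apply: (le_trans (ler_wpM2l gK0 H2)).
    by rewrite mulrCA ler_wpM2l ?(ltW Nu0).
  rewrite ler_pdivrMr ?mulr_gt0//; have := u_delta n; nra.
have [sigma [u [sn uE cv]]] := bounded_subsequence _ _ u_E u_N.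
have muu : cmeasurable u by have [[]] := uE.
have vE n : E ((u_ \o sigma) n) by exact: u_E.
have vN n : N ((u_ \o sigma) n) <= rho by exact: u_N.
have vQ n : LQ mu1 Q ((u_ \o sigma) n) by have [] := vE n.
have vM n : mass ((u_ \o sigma) n) <= S * rho `^ (Q / p) by exact: mass_le.
have cvBH := cvg_pterm _ _ _ _ _ ler01 admH _ _ _ _ q_gt0 qQ vQ muu cv.1 vM.
have BHu : 0 < BH u.
  apply: (@lt_le_trans _ _ (delta / (2 * lam))); first by rewrite divr_gt0// mulr_gt0.
  rewrite -(cvg_lim _ cvBH)//; apply: limr_ge; first exact: cvgP cvBH.
  by apply: nearW => n; exact: u_BH.
exists u; split => //.
  exact: (pterm_gt0_dirichlet 1 (cst 1) h q u ler01 admH q_gt0 qQ uE BHu).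
move=> v vE'; have vQ' : LQ mu1 Q v by case: vE'.
have cvd := cvg_ddirichlet _ _ _ _ vE vN uE vE' cv.
have q1 : (fun n => dBH ((u_ \o sigma) n) v) @ \oo --> dBH u v.
  apply: (cvg_dpterm _ _ _ _ _ ler01 admH _ _ _ (fun=> q) q q (S * rho `^ (Q / p))) => //.
  - by move=> n; exact: ltW.
  - exact: cvg_cst.
  - by move=> x; exact: cvg_cst.
  - exact: cv.1.
have q2 : (fun n => dpterm mu1 Q K W ((exponents \o sigma) n) ((u_ \o sigma) n) v) @ \oo -->
    dpterm mu1 Q K W Q u v.
  apply: (cvg_dpterm _ _ _ _ _ kapK_ge0 admK _ _ _ _ _ q (S * rho `^ (Q / p))) => //.
  - by move=> n; exact/ltW/exponents_gt.
  - by move=> n; exact/ltW/exponents_lt.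
  - exact: cvg_exponents.
  (* Positivity of [W] is used here: [W^(Q - e)] tends to [W^0 = 1] only where [W] does not
     vanish. *)
  - move=> x; rewrite /powR gt_eqF//.
    apply: continuous_cvg; first exact: continuous_expR.
    apply: cvgM; last exact: cvg_cst.
    by apply: cvgB; [exact: cvg_cst|exact: cvg_exponents].
  - exact: cv.1.
have cvr : (fun n => lam * dBH ((u_ \o sigma) n) v +
    dpterm mu1 Q K W ((exponents \o sigma) n) ((u_ \o sigma) n) v) @ \oo -->
    lam * dBH u v + dpterm mu1 Q K W Q u v.
  by apply: cvgD => //; apply: cvgM => //; exact: cvg_cst.
have cvl : (fun n => ddirichlet ((u_ \o sigma) n) v) @ \oo -->
    lam * dBH u v + dpterm mu1 Q K W Q u v.
  apply: cvg_trans cvr; apply: near_eq_cvg; apply: nearW => n.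
  by have [_ _ _ _ ->] := u_P (sigma n).
exact: (cvg_unique _ cvd cvl).
Qed.

End critical_limit.

End variational.

(** * Measurability of the magnetic difference *)

Section grid.
Context {R : realType}.
Local Notation R3 := (R3 R).

Definition grid_index (m : nat) (x : R3) : int * int * int :=
  (Num.floor (m.+1%:R * x.1.1), Num.floor (m.+1%:R * x.1.2), Num.floor (m.+1%:R * x.2)).

Definition grid_point (m : nat) (j : int * int * int) : R3 :=
  (j.1.1%:~R / m.+1%:R, j.1.2%:~R / m.+1%:R, j.2%:~R / m.+1%:R).

Lemma measurable_fst11 : measurable_fun setT (fun x : R3 => x.1.1).
Proof. exact: (measurableT_comp measurable_fst measurable_fst). Qed.

Lemma measurable_fst12 : measurable_fun setT (fun x : R3 => x.1.2).
Proof. exact: (measurableT_comp measurable_snd measurable_fst). Qed.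

Lemma measurable_snd3 : measurable_fun setT (fun x : R3 => x.2).
Proof. exact: measurable_snd. Qed.

Lemma measurable_floor_eq d (T : measurableType d) (f : T -> R) (j : int) :
  measurable_fun setT f -> measurable [set x | Num.floor (f x) = j].
Proof.
move=> mf; rewrite (_ : [set x | _] = setT `&` (f @^-1` `[j%:~R, (j + 1)%:~R[)); last first.
  rewrite setTI; apply/seteqP; split => x /=; rewrite in_itv/=.
    by move=> <-; exact: floor_itv.
  by move=> /floor_def.
by apply: mf => //; exact: measurable_itv.
Qed.

Lemma measurable_grid_index (m : nat) (j : int * int * int) :
  measurable [set x : R3 | grid_index m x = j].
Proof.
rewrite (_ : [set x | _] = [set x | Num.floor (m.+1%:R * x.1.1) = j.1.1] `&`
   [set x | Num.floor (m.+1%:R * x.1.2) = j.1.2] `&` [set x | Num.floor (m.+1%:R * x.2) = j.2]).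
  apply: measurableI; [apply: measurableI|]; apply: measurable_floor_eq; apply: measurable_funM => //.
  - exact: measurable_fst11.
  - exact: measurable_fst12.
apply/seteqP; split => x /=; first by move=> <-.
by case: j => [[j1 j2] j3] /= [[<- <-] <-].
Qed.

Lemma measurable_grid_fun (m : nat) (g : int * int * int -> R) :
  measurable_fun setT (fun x : R3 => g (grid_index m x)).
Proof.
move=> _ B mB; rewrite setTI.
rewrite (_ : _ @^-1` B = \bigcup_j ([set x | grid_index m x = j] `&` [set _ | B (g j)])).
  apply: countable_bigcupT_measurable; first exact: (@countableP (int * int * int)%type).
  move=> j; have [Bj|nBj] := pselect (B (g j)).
    rewrite (_ : [set _ | B (g j)] = setT) ?setIT; first exact: measurable_grid_index.
    by apply/seteqP; split.
  rewrite (_ : [set _ | B (g j)] = set0) ?setI0//.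
  by apply/seteqP; split.
apply/seteqP; split => x /=; first by move=> Bx; exists (grid_index m x).
by move=> [j _ [<-]].
Qed.

Lemma cvg_grid_point (x : R3) :
  (fun m => grid_point m (grid_index m x)) @ \oo --> x.
Proof.
have h (t : R) : (fun m => (Num.floor (m.+1%:R * t))%:~R / m.+1%:R : R) @ \oo --> t.
  apply: (@squeeze_cvgr _ _ _ _ (fun m => t - m.+1%:R^-1) (cst t)).
  - apply: nearW => m; have m0 : 0 < m.+1%:R :> R by rewrite ltr0n.
    have /andP[h1 h2] := floor_itv (m.+1%:R * t).
    apply/andP; split; last by rewrite /= ler_pdivrMr// [leRHS]mulrC.
    rewrite ler_pdivlMr// mulrBl mulVf ?gt_eqF// lerBlDr mulrC ltW//.
    by rewrite intrD in h2.
  - rewrite -[X in _ --> X]subr0; apply: cvgB; first exact: cvg_cst.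
    exact: cvg_harmonic.
  - exact: cvg_cst.
case: x => [[x1 x2] x3].
apply: (@cvg_pair _ _ _ _ (nbhs (x1, x2)) (nbhs x3)); last exact: h.
by apply: (@cvg_pair _ _ _ _ (nbhs x1) (nbhs x2)); exact: h.
Qed.

(** Measurability refers to the product sigma-algebra. A continuous function is the pointwise limit
    of its samples on finer grids, and a sample takes countably many values, each on measurable
    cells. *)
Lemma continuous_measurable3 (f : R3 -> R) : continuous f -> measurable_fun setT f.
Proof.
move=> cf; apply: (@measurable_fun_cvg _ _ _ setT
  (fun m x => f (grid_point m (grid_index m x)))).
- by move=> m; exact: (measurable_grid_fun m (fun j => f (grid_point m j))).
- by move=> x _; apply: continuous_cvg; [exact: cf|exact: cvg_grid_point].
Qed.

End grid.

Section magnetic_measurability.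
Context {R : realType}.
Local Notation R3 := (R3 R).
Local Notation Re := (@complex.Re R).
Local Notation Im := (@complex.Im R).
Local Notation nc := (@ComplexField.Normc.normc R).
Variables (A : R3 -> R3).
Hypothesis cA : continuous A.

Lemma continuous_field : [/\ continuous (fun x => (A x).1.1),
  continuous (fun x => (A x).1.2) & continuous (fun x => (A x).2)].
Proof.
split=> x.
- apply: (@continuous_comp _ _ _ (fun y => (A y).1) fst); last exact: cvg_fst.
  by apply: (@continuous_comp _ _ _ A fst); [exact: cA|exact: cvg_fst].
- apply: (@continuous_comp _ _ _ (fun y => (A y).1) snd); last exact: cvg_snd.
  by apply: (@continuous_comp _ _ _ A fst); [exact: cA|exact: cvg_fst].
- by apply: (@continuous_comp _ _ _ A snd); [exact: cA|exact: cvg_snd].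
Qed.

Section components.
Context {d} {T : measurableType d}.
Variables (f g : T -> R3).
Hypotheses (mf : measurable_fun setT f) (mg : measurable_fun setT g).

Lemma measurable_components (h : T -> R3) : measurable_fun setT h ->
  [/\ measurable_fun setT (fun x => (h x).1.1), measurable_fun setT (fun x => (h x).1.2) &
      measurable_fun setT (fun x => (h x).2)].
Proof.
move=> mh; split; [exact: (measurableT_comp (@measurable_fst11 R) mh)|
  exact: (measurableT_comp (@measurable_fst12 R) mh)|exact: (measurableT_comp (@measurable_snd3 R) mh)].
Qed.

Lemma measurable_fun3 (h : T -> R3) : measurable_fun setT (fun x => (h x).1.1) ->
  measurable_fun setT (fun x => (h x).1.2) -> measurable_fun setT (fun x => (h x).2) ->
  measurable_fun setT h.
Proof.
move=> h1 h2 h3; apply/measurable_fun_pairP; split => //.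
by apply/measurable_fun_pairP; split.
Qed.

Lemma measurable_dot3 : measurable_fun setT (fun x => dot3 (f x) (g x)).
Proof.
have [f1 f2 f3] := measurable_components f mf.
have [g1 g2 g3] := measurable_components g mg.
by apply: measurable_funD; [apply: measurable_funD|]; exact: measurable_funM.
Qed.

Lemma measurable_funB3 : measurable_fun setT (fun x => f x - g x).
Proof.
have [f1 f2 f3] := measurable_components f mf.
have [g1 g2 g3] := measurable_components g mg.
apply: measurable_fun3;
  [exact: (measurable_funB f1 g1)|exact: (measurable_funB f2 g2)|exact: (measurable_funB f3 g3)].
Qed.

Lemma measurable_midpoint : measurable_fun setT (fun x => 2^-1 *: (f x + g x) : R3).
Proof.
have [f1 f2 f3] := measurable_components f mf.
have [g1 g2 g3] := measurable_components g mg.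
have m2 (a b : T -> R) : measurable_fun setT a -> measurable_fun setT b ->
    measurable_fun setT (fun x => 2^-1 * (a x + b x)).
  by move=> ma mb; apply: measurable_funM => //; exact: measurable_funD.
apply: measurable_fun3; [exact: (m2 _ _ f1 g1)|exact: (m2 _ _ f2 g2)|exact: (m2 _ _ f3 g3)].
Qed.

End components.

Lemma measurable_sub6 : measurable_fun setT (fun z : R3 * R3 => z.1 - z.2).
Proof. exact: (measurable_funB3 fst snd measurable_fst measurable_snd). Qed.

Definition phase (z : R3 * R3) : R := - dot3 (z.1 - z.2) (A (2^-1 *: (z.1 + z.2))).

Lemma measurable_phase : measurable_fun setT phase.
Proof.
apply: measurableT_comp => //; apply: measurable_dot3; first exact: measurable_sub6.
have [c1 c2 c3] := continuous_field.
apply: (measurableT_comp (f := A)); last first.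
  exact: (measurable_midpoint fst snd measurable_fst measurable_snd).
by apply: measurable_fun3; exact: continuous_measurable3.
Qed.

Lemma cmeasurable_magnetic_diff (u : R3 -> R[i]) : cmeasurable u ->
  cmeasurable (magnetic_diff A u).
Proof.
move=> [uR uI].
have mcos : measurable_fun setT (fun z => cos (phase z)).
  apply: (measurableT_comp (f := cos)); last exact: measurable_phase.
  by apply: continuous_measurable_fun; exact: continuous_cos.
have msin : measurable_fun setT (fun z => sin (phase z)).
  apply: (measurableT_comp (f := sin)); last exact: measurable_phase.
  by apply: continuous_measurable_fun; exact: continuous_sin.
have R1 : measurable_fun setT (fun z : R3 * R3 => Re (u z.1)) := measurableT_comp uR measurable_fst.
have I1 : measurable_fun setT (fun z : R3 * R3 => Im (u z.1)) := measurableT_comp uI measurable_fst.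
have R2 : measurable_fun setT (fun z : R3 * R3 => Re (u z.2)) := measurableT_comp uR measurable_snd.
have I2 : measurable_fun setT (fun z : R3 * R3 => Im (u z.2)) := measurableT_comp uI measurable_snd.
split.
  rewrite (_ : _ \o _ = (fun z => cos (phase z) * Re (u z.1) - sin (phase z) * Im (u z.1) - Re (u z.2))).
    by apply: measurable_funB => //; apply: measurable_funB; exact: measurable_funM.
  apply/funext => z; rewrite /= /magnetic_diff complexReB; congr (_ - _).
  by rewrite -/(phase z) /expi; case: (u z.1).
rewrite (_ : _ \o _ = (fun z => cos (phase z) * Im (u z.1) + sin (phase z) * Re (u z.1) - Im (u z.2))).
  by apply: measurable_funB => //; apply: measurable_funD; exact: measurable_funM.
apply/funext => z; rewrite /= /magnetic_diff complexImB; congr (_ - _).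
by rewrite -/(phase z) /expi; case: (u z.1).
Qed.

Lemma magnetic_diff_lin (a b : R) (u v : R3 -> R[i]) z :
  magnetic_diff A (fun x => a%:C%C * u x + b%:C%C * v x) z =
  a%:C%C * magnetic_diff A u z + b%:C%C * magnetic_diff A v z.
Proof. by rewrite /magnetic_diff; ring. Qed.

Definition gagliardo_weight (s p : R) (z : R3 * R3) : R := (gagliardo_denom s p z)^-1.

Lemma gagliardo_weight_ge0 s p z : 0 <= gagliardo_weight s p z.
Proof. by rewrite invr_ge0 powR_ge0. Qed.

Lemma measurable_enorm_sub : measurable_fun setT (fun z : R3 * R3 => enorm (z.1 - z.2)).
Proof.
rewrite (_ : (fun z => _) = (fun z => (@powR R)^~ 2^-1 (dot3 (z.1 - z.2) (z.1 - z.2)))); last first.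
  by apply/funext => z; rewrite /= powR12_sqrt// /dot3 -!expr2 !addr_ge0// sqr_ge0.
apply: (measurableT_comp (measurable_powR _)).
by apply: measurable_dot3; exact: measurable_sub6.
Qed.

Lemma measurable_gagliardo_weight s p : measurable_fun setT (gagliardo_weight s p).
Proof.
rewrite (_ : gagliardo_weight s p = (fun z => (@powR R)^~ (- (3 + s * p)) (enorm (z.1 - z.2)))); last first.
  by apply/funext => z; rewrite /gagliardo_weight /= powRN.
exact: (measurableT_comp (measurable_powR _) measurable_enorm_sub).
Qed.

Lemma expi_normc t : nc (expi t) = 1.
Proof. by rewrite /expi /= cos2Dsin2 sqrtr1. Qed.

Lemma normc_le_magnetic_diff (u : R3 -> R[i]) z :
  nc (u z.1) <= nc (magnetic_diff A u z) + nc (u z.2).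
Proof.
rewrite -[leLHS]mul1r -(expi_normc (phase z)) -ComplexField.Normc.normcM.
have := ler_normcD (magnetic_diff A u z) (u z.2).
by rewrite /magnetic_diff subrK.
Qed.

End magnetic_measurability.

(** * The fractional Sobolev inequality *)

Section cubes.
Context {R : realType}.
Local Notation R3 := (R3 R).
Local Notation mu3 := (@lebesgue3 R).

Definition cube (x : R3) (r : R) : set R3 :=
  `]x.1.1 - r, x.1.1 + r[ `*` `]x.1.2 - r, x.1.2 + r[ `*` `]x.2 - r, x.2 + r[.

Lemma measurable_cube x r : measurable (cube x r).
Proof. by apply: measurableX => //; apply: measurableX. Qed.

Definition volume : {measure set R3 -> \bar R} := mu3.

Lemma volume_cube x r : 0 <= r -> volume (cube x r) = ((2 * r) ^+ 3)%:E.
Proof.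
move=> r0; have itv (t : R) : lebesgue_measure `]t - r, t + r[%classic = (2 * r)%:E.
  rewrite lebesgue_measure_itv/= lte_fin; case: ltP => [_|h].
    by rewrite -EFinD; congr EFin; ring.
  by congr EFin; apply/eqP; rewrite eq_le; apply/andP; split; lra.
rewrite /volume /lebesgue3 [LHS]product_measure1E//; last by apply: measurableX.
rewrite /lebesgue2 [X in (X * _)%E]product_measure1E//.
rewrite [X in (X * _ * _)%E]itv [X in (_ * X * _)%E]itv [X in (_ * X)%E]itv.
by rewrite -!EFinM; congr EFin; rewrite !exprS expr0; ring.
Qed.

Lemma rintegrable_cube x r : 0 <= r -> rintegrable mu3 (\1_(cube x r) : R3 -> R).
Proof.
move=> r0; apply: rintegrable_indic; first exact: measurable_cube.
by rewrite [X in (X < _)%E](volume_cube _ _ r0) ltry.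
Qed.

Lemma rintegral_cube x r : 0 <= r -> \int[mu3]_y (\1_(cube x r) y : R) = (2 * r) ^+ 3.
Proof.
move=> r0; rewrite rintegral_indic; last exact: measurable_cube.
by rewrite [X in fine X](volume_cube _ _ r0).
Qed.

Lemma measurable_indic_cube x r : measurable_fun setT (\1_(cube x r) : R3 -> R).
Proof. by apply/measurable_indicP; exact: measurable_cube. Qed.

Lemma cubeP x r y : cube x r y <->
  [/\ `|x.1.1 - y.1.1| < r, `|x.1.2 - y.1.2| < r & `|x.2 - y.2| < r].
Proof.
rewrite /cube /= !in_itv/=.
have h (a b : R) : (a - r < b < a + r) = (`|a - b| < r).
  by rewrite ltr_norml; apply/andP/andP => -[]; split; lra.
by rewrite !h; split => [[[? ?] ?]|[? ? ?]].
Qed.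

Lemma dot3_ge0 (x : R3) : 0 <= dot3 x x.
Proof. by rewrite /dot3 -!expr2 !addr_ge0// sqr_ge0. Qed.

(** The factor 2 stands for the square root of 3. *)
Lemma enorm_le_of_coords (x : R3) (r : R) : 0 <= r ->
  `|x.1.1| <= r -> `|x.1.2| <= r -> `|x.2| <= r -> enorm x <= 2 * r.
Proof.
move=> r0; have h (a : R) : `|a| <= r -> a * a <= r * r.
  by rewrite ler_norml => /andP[? ?]; nra.
move=> /h h1 /h h2 /h h3; have r20 : 0 <= 2 * r by rewrite mulr_ge0.
rewrite -(ger0_norm r20) -sqrtr_sqr; apply: ler_wsqrtr.
rewrite /dot3; nra.
Qed.

Lemma enorm_cube_le x r y : 0 <= r -> cube x r y -> enorm (x - y) <= 2 * r.
Proof.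
by move=> r0 /cubeP[/ltW h1 /ltW h2 /ltW h3]; apply: enorm_le_of_coords.
Qed.

Lemma enorm_ge_coords (x : R3) :
  [/\ `|x.1.1| <= enorm x, `|x.1.2| <= enorm x & `|x.2| <= enorm x].
Proof.
have h (a b : R) : 0 <= b -> a * a <= b -> `|a| <= Num.sqrt b.
  by move=> b0 ab; rewrite -sqrtr_sqr; apply: ler_wsqrtr; rewrite expr2.
have s1 := sqr_ge0 x.1.1; have s2 := sqr_ge0 x.1.2; have s3 := sqr_ge0 x.2.
by split; apply: h; rewrite ?dot3_ge0// /dot3 -!expr2; lra.
Qed.

Lemma enorm_eq0 (x y : R3) : enorm (x - y) = 0 -> x = y.
Proof.
move=> xy0; have [] := enorm_ge_coords (x - y); rewrite xy0 !normr_le0 !subr_eq0.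
case: x xy0 => [[x1 x2] x3] _; case: y => [[y1 y2] y3] /=.
by move=> /eqP -> /eqP -> /eqP ->.
Qed.

Lemma enorm_ge0 (x : R3) : 0 <= enorm x.
Proof. exact: sqrtr_ge0. Qed.

End cubes.

Section sobolev.
Context {R : realType}.
Local Notation R3 := (R3 R).
Local Notation mu3 := (@lebesgue3 R).
Local Notation mu6 := (@lebesgue3 R \x @lebesgue3 R)%E.
Local Notation nc := (@ComplexField.Normc.normc R).
Variables (A : R3 -> R3) (s p : R).
Hypotheses (cA : continuous A) (s0 : 0 < s) (p1 : 1 < p) (sp3 : s * p < 3).
Local Notation Q := (pstar s p).
Local Notation w := (gagliardo_weight s p).
Local Notation L := (magnetic_diff A).
Local Notation E := (energy_space mu3 mu6 p Q w L).

Let p0 : 0 < p. Proof. exact: lt_trans p1. Qed.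
Let sp0 : 0 < s * p. Proof. exact: mulr_gt0. Qed.

Lemma lt_pstar : p < Q.
Proof. by rewrite /pstar ltr_pdivlMr ?subr_gt0// mulrC ltr_pM2r// gtrBl. Qed.

Let Q1 : 1 < Q. Proof. exact: lt_trans lt_pstar. Qed.
Let Q0 : 0 < Q. Proof. exact: lt_trans Q1. Qed.

Lemma pstar_conj : 1 - s * p / 3 = p / Q.
Proof. by rewrite /pstar; field; rewrite !gt_eqF ?subr_gt0. Qed.

Lemma magnetic_diff_diag u x : L u (x, x) = 0.
Proof.
rewrite /magnetic_diff subrr (_ : dot3 0 _ = 0); last by rewrite /dot3/= !mul0r !addr0.
by rewrite oppr0 /expi cos0 sin0 mul1r subrr.
Qed.

Lemma local_energy_le u x y (delta : R) : enorm (x - y) <= delta ->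
  nc (L u (x, y)) `^ p <= delta `^ (3 + s * p) * (w (x, y) * nc (L u (x, y)) `^ p).
Proof.
(* On the diagonal the weight is 0 by convention, but so is the magnetic difference. *)
move=> xyd; have [xy0|xy_neq0] := eqVneq (enorm (x - y)) 0.
  rewrite (enorm_eq0 _ _ xy0) magnetic_diff_diag ComplexField.Normc.normc0 powR0 ?gt_eqF//.
  by rewrite !mulr0.
have xy_gt0 : 0 < enorm (x - y) by rewrite lt_neqAle eq_sym xy_neq0 enorm_ge0.
rewrite mulrA ler_peMl ?powR_ge0// /gagliardo_weight /gagliardo_denom /=.
rewrite ler_pdivlMr ?powR_gt0// mul1r ge0_ler_powR ?nnegrE ?enorm_ge0//.
  by rewrite addr_ge0// ltW.
exact: le_trans (enorm_ge0 _) xyd.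
Qed.

(** It may be infinite at some points, hence the extended values. *)
Definition local_energy u (x : R3) : \bar R :=
  (\int[mu3]_y (w (x, y) * nc (L u (x, y)) `^ p)%:E)%E.

Lemma measurable_energy_density u : cmeasurable u ->
  measurable_fun setT (fun z => w z * nc (L u z) `^ p).
Proof.
move=> mu_; apply: measurable_funM; first exact: measurable_gagliardo_weight.
by apply: cmeasurable_normc_powR; exact: cmeasurable_magnetic_diff.
Qed.

Lemma slice_integral u x (gam : R) : cmeasurable u -> local_energy u x = gam%:E ->
  rintegrable mu3 (fun y => w (x, y) * nc (L u (x, y)) `^ p) /\
  gam = \int[mu3]_y (w (x, y) * nc (L u (x, y)) `^ p).
Proof.
move=> mu_ gE; split; last by rewrite /Rintegral -/(local_energy u x) gE.
apply: ge0_rintegrable.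
- exact: (measurable_fun_pair2 x (measurable_energy_density _ mu_)).
- by move=> y; rewrite mulr_ge0 ?powR_ge0 ?gagliardo_weight_ge0.
- by rewrite -/(local_energy u x) gE ltry.
Qed.

(** Integration of [|u(x)| <= |U(x,y)| + |u(y)|] over the cube of side [rho] around [x]. Both terms
    are truncated at the level [al], which costs [2 * al] per unit of volume; the rest is paid by
    the energy and by the total mass. *)
Lemma average_bound u x (al rho gam : R) : E u -> 0 < al -> 0 < rho ->
  local_energy u x = gam%:E ->
  nc (u x) * rho ^+ 3 <= 2 * al * rho ^+ 3 + al `^ (1 - p) * rho `^ (3 + s * p) * gam +
     al `^ (1 - Q) * \int[mu3]_x (nc (u x) `^ Q).
Proof.
move=> [[mu_ ui] mLu Lui] al0 rho0 gE.
pose r := rho / 2; have r0 : 0 <= r by rewrite divr_ge0// ltW.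
have rE : 2 * r = rho by rewrite /r; field.
have ci := rintegrable_cube x r r0; have cE := rintegral_cube x r r0; rewrite rE in cE.
have [di gamE] := slice_integral u x gam mu_ gE.
have c1 := rintegrableZ mu3 (nc (u x)) _ ci.
have c2 := rintegrableZ mu3 (2 * al) _ ci.
have d1 := rintegrableZ mu3 (al `^ (1 - p) * rho `^ (3 + s * p)) _ di.
have u1 := rintegrableZ mu3 (al `^ (1 - Q)) _ ui.
have cd := rintegrableD _ _ _ c2 d1; have cdu := rintegrableD _ _ _ cd u1.
suff : \int[mu3]_y (nc (u x) * \1_(cube x r) y) <= \int[mu3]_y (2 * al * \1_(cube x r) y +
    al `^ (1 - p) * rho `^ (3 + s * p) * (w (x, y) * nc (L u (x, y)) `^ p) +
    al `^ (1 - Q) * nc (u y) `^ Q).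
  rewrite (rintegralD _ _ _ cd u1) (rintegralD _ _ _ c2 d1).
  rewrite (rintegralZ _ _ _ ci) (rintegralZ _ _ _ ci) (rintegralZ _ _ _ di) (rintegralZ _ _ _ ui).
  by rewrite cE -gamE.
apply: (le_rintegral _ _ _ c1 cdu).
move=> y; rewrite indicE; have [yc|_] := boolP (y \in cube x r); last first.
  by rewrite !mulr0 add0r addr_ge0// !mulr_ge0 ?powR_ge0 ?gagliardo_weight_ge0.
rewrite !mulr1; have yc' := enorm_cube_le _ _ _ r0 (set_mem yc).
apply: (le_trans (normc_le_magnetic_diff A u (x, y))) => /=.
have h1 := le_truncated _ _ _ p1 al0 (normc_ge0 (L u (x, y))).
have h2 := le_truncated _ _ _ Q1 al0 (normc_ge0 (u y)).
rewrite rE in yc'; have h3 := local_energy_le u _ _ _ yc'.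
have h4 := ler_wpM2l (powR_ge0 al (1 - p)) h3.
apply: (le_trans (lerD h1 h2)).
apply: (le_trans (lerD (lerD (lexx al) h4) (lexx _))).
apply: eq_ler; ring.
Qed.

Lemma local_energy_ge0 u x : (0 <= local_energy u x)%E.
Proof.
apply: integral_ge0 => y _; rewrite lee_fin mulr_ge0 ?powR_ge0//.
exact: gagliardo_weight_ge0.
Qed.

(** The average bound with optimal level and radius. The mass enters with the power [s p / 3 < 1],
    so that it can be absorbed after integration over [x]. *)
Lemma pointwise_sobolev u x (gam : R) : E u -> 0 < \int[mu3]_x (nc (u x) `^ Q) ->
  local_energy u x = gam%:E ->
  nc (u x) `^ Q <= 6 `^ Q * (\int[mu3]_x (nc (u x) `^ Q)) `^ (s * p / 3) * gam.
Proof.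
move=> uE F0 gE; set F := Rintegral _ _ _ in F0 *.
have gam0 : 0 <= gam by rewrite -lee_fin -gE local_energy_ge0.
have [a0|a_neq0] := eqVneq (nc (u x)) 0.
  by rewrite a0 powR0 ?gt_eqF// !mulr_ge0 ?powR_ge0.
have a_gt0 : 0 < nc (u x) by rewrite lt_neqAle eq_sym a_neq0 normc_ge0.
(* One sixth leaves room: of [6 * al], the truncation takes two parts and the mass term one, so
   three remain against the energy. *)
pose al := nc (u x) / 6; have al0 : 0 < al by rewrite divr_gt0.
have aE : nc (u x) = 6 * al by rewrite /al; field.
(* [b] is the volume of the cube, chosen so that the mass term [al^(1-Q) * F] is exactly
   [al * b]. *)
pose b := F * al `^ (- Q); have b0 : 0 < b by rewrite mulr_gt0// powR_gt0.
pose rho := b `^ (3^-1); have rho0 : 0 < rho by rewrite powR_gt0.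
have rho3 : rho ^+ 3 = b.
  by rewrite -powR_mulrn ?ltW// /rho -powRrM mulVf// powRr1// ltW.
have rhosp : rho `^ (3 + s * p) = b * (F `^ (s * p / 3) * al `^ (- (Q * (s * p / 3)))).
  rewrite powRD; last by rewrite (gt_eqF rho0) implybT.
  rewrite (_ : rho `^ 3 = rho ^+ 3); last by rewrite -powR_mulrn ?ltW.
  rewrite rho3; congr (_ * _); rewrite /rho -powRrM [3^-1 * _]mulrC /b.
  by rewrite (powRM _ (ltW F0) (powR_ge0 _ _)) -(powRrM al) mulNr.
have H := average_bound _ _ _ _ _ uE al0 rho0 gE.
rewrite rhosp rho3 aE -/F in H.
have alF : al `^ (1 - Q) * F = al * b.
  rewrite /b mulrCA powRD; last by rewrite (gt_eqF al0) implybT.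
  by rewrite powRr1 ?ltW//; ring.
have alp : al `^ (1 - p) * al `^ (- (Q * (s * p / 3))) = al `^ (1 - Q).
  rewrite -powRD; last by rewrite (gt_eqF al0) implybT.
  congr (_ `^ _); have : Q * (1 - s * p / 3) = p by rewrite pstar_conj mulrC divfK// gt_eqF.
  lra.
rewrite alF in H.
have H2 : 3 * al <= al `^ (1 - Q) * F `^ (s * p / 3) * gam.
  rewrite -alp -(ler_pM2l b0).
  move: (al `^ (1 - p)) (F `^ (s * p / 3)) (al `^ (- (Q * (s * p / 3)))) H => X Y Z; lra.
have alQ : al `^ (1 - Q) * al `^ (Q - 1) = 1.
  by rewrite -powRD ?(gt_eqF al0) ?implybT// (_ : 1 - Q + (Q - 1) = 0) ?powRr0//; lra.
have H3 : 3 * al `^ Q <= F `^ (s * p / 3) * gam.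
  rewrite -(mulr_powRB1 (ltW al0) Q0) mulrA.
  apply: (le_trans (ler_wpM2r (powR_ge0 _ _) H2)); apply: eq_ler.
  transitivity ((al `^ (1 - Q) * al `^ (Q - 1)) * (F `^ (s * p / 3) * gam)).
    by ring.
  by rewrite alQ mul1r.
rewrite aE powRM ?(ltW al0)// -mulrA ler_wpM2l ?powR_ge0//.
apply: le_trans H3; rewrite ler_peMl ?powR_ge0//; lra.
Qed.

Lemma dirichlet_local_energy u : E u ->
  (\int[mu3]_x local_energy u x = (dirichlet mu6 p w L u)%:E)%E.
Proof.
move=> [[mu_ ui] mLu Lui]; rewrite dirichletE -rintegrableE//.
symmetry; apply: (@fubini_tonelli1 _ _ _ _ _ (@lebesgue3 R) (@lebesgue3 R)
  (fun z => (w z * nc (L u z) `^ p)%:E)).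
- apply/measurable_EFinP; exact: measurable_energy_density.
- by move=> z; rewrite lee_fin mulr_ge0 ?powR_ge0// gagliardo_weight_ge0.
Qed.

Definition sobolev_constant : R := (6 `^ Q) `^ (Q / p).

(** Integrating the pointwise bound gives [F <= 6^Q F^(s p / 3) N]. Since [F] is finite and may be
    taken positive, its power on the right is divided out, and [1 - s p / 3 = p / Q] produces the
    exponent. *)
Lemma sobolev_inequality u : E u ->
  \int[mu3]_x (nc (u x) `^ Q) <= sobolev_constant * dirichlet mu6 p w L u `^ (Q / p).
Proof.
move=> uE; have [[mu_ ui] mLu Lui] := uE.
set F := Rintegral _ _ _; set N := dirichlet _ _ _ _ _.
have N0 : 0 <= N by apply: dirichlet_ge0 => z; exact: gagliardo_weight_ge0.
have [F0|F_gt0] := leP F 0.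
  by rewrite (le_trans F0)// mulr_ge0 ?powR_ge0.
have c0 : 0 <= 6 `^ Q * F `^ (s * p / 3) by rewrite mulr_ge0 ?powR_ge0.
have mle : measurable_fun setT (local_energy u).
  apply: (@measurable_fun_fubini_tonelli_F _ _ _ _ _ (@lebesgue3 R)
    (fun z => (w z * nc (L u z) `^ p)%:E)).
  - by apply/measurable_EFinP; exact: measurable_energy_density.
  - by move=> z; rewrite lee_fin mulr_ge0 ?powR_ge0// gagliardo_weight_ge0.
have FN : F <= 6 `^ Q * F `^ (s * p / 3) * N.
  rewrite -lee_fin -rintegrableE// EFinM -(dirichlet_local_energy u uE).
  rewrite -ge0_integralZl_EFin//; last by move=> x _; exact: local_energy_ge0.
  apply: ge0_le_integral => //.
  - by move=> x _; rewrite lee_fin powR_ge0.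
  - by apply/measurable_EFinP; exact: cmeasurable_normc_powR.
  - exact: measurable_funeM.
  - move=> x _; have := local_energy_ge0 u x.
    case gE : (local_energy u x) => [gam| |] // _.
      by rewrite -EFinM lee_fin; exact: pointwise_sobolev.
    by rewrite gt0_muley ?leey// lte_fin mulr_gt0// powR_gt0.
have Fp : F `^ (p / Q) <= 6 `^ Q * N.
  have Fs : 0 < F `^ (s * p / 3) by exact: powR_gt0.
  rewrite -(ler_pM2l Fs) -powRD ?(gt_eqF F_gt0) ?implybT//.
  rewrite -pstar_conj addrC subrK powRr1 ?(ltW F_gt0)//.
  by apply: (le_trans FN); apply: eq_ler; ring.
rewrite /sobolev_constant -powRM ?powR_ge0//.
rewrite [leLHS](_ : F = (F `^ (p / Q)) `^ (Q / p)).
  have Qp0 : 0 <= Q / p by rewrite divr_ge0// ltW.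
  by rewrite ge0_ler_powR ?nnegrE ?powR_ge0// mulr_ge0 ?powR_ge0.
rewrite -powRrM (_ : p / Q * (Q / p) = 1) ?powRr1 ?ltW//.
by field; rewrite !gt_eqF.
Qed.

End sobolev.

(** * Local compactness *)

Section extraction.
Context {R : realType}.

(* A nonprincipal ultrafilter replaces the diagonal argument. *)
Lemma countable_extraction (I : countType) (a : nat -> I -> R) (b : I -> R) :
  (forall n i, `|a n i| <= b i) ->
  exists (sigma : nat -> nat) (l : I -> R), (forall m, (m <= sigma m)%N) /\
    forall i, (fun m => a (sigma m) i) @ \oo --> l i.
Proof.
move=> ab; have [U [UU sU]] := @ultraFilterLemma nat \oo _.
have PU : ProperFilter U := @ultra_proper _ _ UU.
have /choice[l lP] i : exists l : R, forall e : R, 0 < e -> U [set n | `|a n i - l| < e].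
  have cK : compact `[- b i, b i]%classic := @segment_compact R (- b i) (b i).
  have UK : U [set n | `[- b i, b i]%classic (a n i)].
    apply: filterS filterT => n _ /=.
    by rewrite in_itv/= -ler_norml ab.
  have [l [_ lcl]] := cK ((fun n => a n i) @ U) _ UK.
  exists l => e e0; have [//|UC] := in_ultra_setVsetC [set n | `|a n i - l| < e] UU.
  have Uim : U [set n | ((fun n => a n i) @` (~` [set n | `|a n i - l| < e])) (a n i)].
    by apply: filterS UC => n nC /=; exists n.
  have [] := lcl ((fun n => a n i) @` (~` [set n | `|a n i - l| < e])) (ball l e).
  - exact: Uim.
  - exact: nbhsx_ballx.
  - by move=> _ [[n nC <-]]; rewrite /ball/= distrC => h.
(* Diagonal selection: [n] is at least [m], and the coordinates of code below [m] are within
   [1 / (m + 1)] of their limits. These are finitely many conditions, each large for [U], so some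
   [n] satisfies them all. *)
pose good m := [set n | (m <= n)%N /\ forall k i, (k < m)%N -> unpickle k = Some i ->
  `|a n i - l i| < m.+1%:R^-1].
have Ugood m : U (good m).
  have U1 : U [set n | (m <= n)%N] by apply: sU; exists m.
  have U2 j : U [set n | forall k i, (k < j)%N -> unpickle k = Some i ->
      `|a n i - l i| < m.+1%:R^-1].
    elim: j => [|j IH]; first by apply: filterS filterT => n _ k i.
    have Uj : U [set n | forall i, unpickle j = Some i -> `|a n i - l i| < m.+1%:R^-1].
      case uj : (unpickle j) => [i|]; last by apply: filterS filterT => n _ i.
      have e0 : 0 < m.+1%:R^-1 :> R by rewrite invr_gt0.
      by apply: filterS (lP i _ e0) => n h i' [<-].
    apply: filterS (filterI IH Uj) => n [h1 h2] k i.
    by rewrite ltnS leq_eqVlt => /orP[/eqP ->|]; [exact: h2|exact: h1].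
  by apply: filterS (filterI U1 (U2 m)) => n [].
have /choice[sigma sigmaP] m : exists n, good m n.
  exact: filter_ex (Ugood m).
exists sigma, l; split=> [m|i]; first by have [] := sigmaP m.
apply/cvgrPdist_lt => e e0.
have h : (fun m => m.+1%:R^-1) @ \oo --> (0 : R) by exact: cvg_harmonic.
have [N _ HN] : \forall m \near \oo, m.+1%:R^-1 < e by exact: cvgr_lt h _ e0.
exists (maxn N (pickle i).+1) => // m /=; rewrite geq_max => /andP[Nm im].
have [_ /(_ (pickle i) i im (pickleK i)) H] := sigmaP m.
by rewrite distrC (lt_trans H)//; exact: HN.
Qed.

End extraction.

Section ae_convergence.
Context {d} {T : measurableType d} {R : realType}.
Variable mu : {measure set T -> \bar R}.

(** The increments, cut off to [X i], have summable integrals, so their sum is finite a.e. At such a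
    point, which lies in [X i] from some index on, the telescoping series converges absolutely. *)
Lemma ae_cvg_of_summable (X : nat -> set T) (f : nat -> T -> R) :
  (forall i, measurable (X i)) ->
  (forall x, exists i, forall j, (i <= j)%N -> X j x) ->
  (forall i, measurable_fun setT (f i)) ->
  (forall i, \int[mu]_x (\1_(X i) x * `|f i.+1 x - f i x|)%:E <= (1 / (2 ^ i.+1)%:R)%:E)%E ->
  {ae mu, forall x, cvgn (fun i => f i x)}.
Proof.
move=> mX Xcov mf small.
pose g i x := \1_(X i) x * `|f i.+1 x - f i x|.
have mg i : measurable_fun setT (g i).
  apply: measurable_funM; first exact/measurable_indicP.
  by apply: measurableT_comp => //; exact: measurable_funB.
have g0 i x : 0 <= g i x by rewrite mulr_ge0.
have mgE i : measurable_fun setT (EFin \o g i) by exact/measurable_EFinP.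
have gi : mu.-integrable setT (fun x => \sum_(0 <= i <oo) (g i x)%:E)%E.
  apply/integrableP; split.
    apply: (@ge0_emeasurable_sum _ _ _ setT (fun i x => (g i x)%:E) xpredT).
      by move=> i x _ _; rewrite lee_fin.
    by move=> i _; exact: mgE.
  rewrite [ltLHS](_ : _ = (\int[mu]_x \sum_(0 <= i <oo) (g i x)%:E)%E); last first.
    apply: eq_integral => x _.
    by rewrite gee0_abs//; apply: nneseries_ge0 => i _ _; rewrite lee_fin.
  rewrite integral_nneseries//; last by move=> i x _; rewrite lee_fin.
  apply: (@le_lt_trans _ _ (\sum_(0 <= i <oo) (1 / (2 ^ i.+1)%:R : R)%:E)%E).
    apply: lee_nneseries => [i *|i *]; last exact: small.
    by apply: integral_ge0 => x _; rewrite lee_fin.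
  exact: le_lt_trans (epsilon_trick0 xpredT ler01) (ltry _).
apply: filterS (integrable_ae measurableT gi) => x /(_ Logic.I) Sfin.
set S := (\sum_(0 <= i <oo) _)%E in Sfin.
have part n : \sum_(0 <= i < n) g i x <= fine S.
  rewrite -lee_fin fineK// -sumEFin; apply: nneseries_lim_ge => i _.
  by rewrite lee_fin.
have [i0 Hi0] := Xcov x.
pose h i := `|f i.+1 x - f i x|.
have hb : cvgn (series h).
  apply: nondecreasing_is_cvgn.
    by apply: nondecreasing_series => i _ _; exact: normr_ge0.
  exists (\sum_(0 <= i < i0) h i + fine S) => _ [n _ <-]; rewrite /series/=.
  have S0 : 0 <= fine S by have := part 0%N; rewrite big_geq.
  have [ni0|i0n] := leqP n i0.
    rewrite (@big_cat_nat _ _ _ n 0 i0)//= -addrA lerDl addr_ge0//.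
    by apply: sumr_ge0 => i _; exact: normr_ge0.
  rewrite (@big_cat_nat _ _ _ i0 0 n)//= ?(ltnW i0n)// lerD2l.
  apply: le_trans (part n); rewrite [leRHS](@big_cat_nat _ _ _ i0 0 n)//= ?(ltnW i0n)//.
  rewrite -[leLHS]add0r lerD ?sumr_ge0// !big_nat; apply: ler_sum => i /andP[i0i _].
  by rewrite /g indicE mem_set ?mul1r//; exact: Hi0.
have tel : cvgn (series (fun i => f i.+1 x - f i x)) by exact: normed_cvg.
have -> : (fun i => f i x) = (fun i => f 0%N x + series (fun i => f i.+1 x - f i x) i).
  by apply/funext => i; rewrite /series/= telescope_sumr// addrC subrK.
by apply: is_cvgD => //; exact: is_cvg_cst.
Qed.

End ae_convergence.

Section phase_bound.
Context {R : realType}.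
Local Notation nc := (@ComplexField.Normc.normc R).

Lemma lipschitz1_at0 (f df : R -> R) : (forall x, is_derive x (1 : R) f (df x)) ->
  (forall x, `|df x| <= 1) -> forall t, `|f t - f 0| <= `|t|.
Proof.
move=> fdf df1 t.
have cf (a b : R) : {within `[a, b], continuous f}.
  apply: continuous_subspaceT => x; apply: differentiable_continuous.
  by apply/derivable1_diffP; have [] := fdf x.
have [t0|/ltW t0] := leP 0 t.
  have [c _ ->] := MVT_segment t0 (fun x _ => fdf x) (cf 0 t).
  by rewrite subr0 normrM ler_piMl.
have [c _] := MVT_segment t0 (fun x _ => fdf x) (cf t 0).
by rewrite distrC => ->; rewrite sub0r normrM normrN ler_piMl.
Qed.

(** The factor 2 comes from bounding the real and the imaginary part separately. *)
Lemma normc_expiB1_le (t : R) : nc (expi t - 1) <= 2 * `|t|.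
Proof.
apply: (le_trans (normc_le_ReIm _)); rewrite complexReB complexImB /=.
rewrite subr0 mulr_natl mulr2n; apply: lerD.
  rewrite -(cos0 R).
  apply: (lipschitz1_at0 cos (fun x => - sin x)) => x; rewrite normrN ler_norml.
  by rewrite sin_geN1 sin_le1.
rewrite -[sin t]subr0 -(sin0 R).
apply: (lipschitz1_at0 sin cos) => x; rewrite ler_norml.
by rewrite cos_geN1 cos_le1.
Qed.

End phase_bound.

Section grid_averages.
Context {R : realType}.
Local Notation R3 := (R3 R).
Local Notation mu3 := (@lebesgue3 R).
Local Notation cell m j := [set x : R3 | grid_index m x = j].

Lemma volume_cell m j : volume (cell m j) = ((m.+1%:R^-1) ^+ 3 : R)%:E.
Proof.
pose I (j : int) : set R := `[j%:~R / m.+1%:R, (j + 1)%:~R / m.+1%:R[%classic.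
have m0 : 0 < m.+1%:R :> R by rewrite ltr0n.
have IP (t : R) (i : int) : (Num.floor (m.+1%:R * t) = i) <-> I i t.
  rewrite /I/= in_itv/= ler_pdivrMr// ltr_pdivlMr// [t * _]mulrC.
  by split=> [<-|]; [exact: floor_itv|move=> /floor_def].
have -> : cell m j = I j.1.1 `*` I j.1.2 `*` I j.2.
  apply/seteqP; split=> x /=.
    by rewrite /grid_index => <-; split; [split|]; apply/IP.
  case: j => [[j1 j2] j3] /= [[/IP h1 /IP h2] /IP h3].
  by rewrite /grid_index h1 h2 h3.
have volI i : lebesgue_measure (I i) = (m.+1%:R^-1)%:E.
  rewrite lebesgue_measure_itv/= lte_fin ltr_pM2r ?invr_gt0// ltr_int ltzD1 lexx.
  by rewrite -EFinB -mulrBl intrD addrAC subrr add0r mul1r.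
have mI i : measurable (I i) by exact: measurable_itv.
have mII : measurable (I j.1.1 `*` I j.1.2) by exact: measurableX.
rewrite /volume /lebesgue3 [LHS]product_measure1E; [|exact: mII|exact: mI].
rewrite /lebesgue2 [X in (X * _)%E]product_measure1E; [|exact: mI|exact: mI].
rewrite [X in (X * _ * _)%E]volI [X in (_ * X * _)%E]volI [X in (_ * X)%E]volI.
by rewrite -!EFinM; congr EFin; rewrite !exprS expr0 mulr1 mulrA.
Qed.

Lemma cell_cube m (x y : R3) : grid_index m x = grid_index m y -> cube x (m.+1%:R^-1) y.
Proof.
have m0 : 0 < m.+1%:R :> R by rewrite ltr0n.
have h (a b : R) : Num.floor (m.+1%:R * a) = Num.floor (m.+1%:R * b) ->
    `|a - b| < m.+1%:R^-1.
  move=> ab; have := floor_itv (m.+1%:R * a); have := floor_itv (m.+1%:R * b).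
  rewrite ab intrD => /andP[b1 b2] /andP[a1 a2].
  rewrite -[ltRHS]mulr1 ltr_pdivlMl// -[X in X * _]gtr0_norm// -normrM mulrBr.
  by rewrite ltr_norml; apply/andP; split; lra.
by move=> [/h h1 /h h2 /h h3]; apply/cubeP.
Qed.

Definition grid_avg (m : nat) (f : R3 -> R) (j : int * int * int) : R :=
  m.+1%:R ^+ 3 * \int[mu3]_y (\1_(cell m j) y * f y).

Lemma measurable_cell m j : measurable (cell m j).
Proof. exact: measurable_grid_index. Qed.

Lemma rintegrable_cell m j : rintegrable mu3 (\1_(cell m j) : R3 -> R).
Proof.
apply: rintegrable_indic; first exact: measurable_cell.
by rewrite [X in (X < _)%E](volume_cell m j) ltry.
Qed.

Lemma rintegral_cell m j : \int[mu3]_y (\1_(cell m j) y : R) = m.+1%:R^-1 ^+ 3.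
Proof.
rewrite rintegral_indic; last exact: measurable_cell.
by rewrite [X in fine X](volume_cell m j).
Qed.

Lemma continuous_cube_bounded (g : R3 -> R) (M : R) : continuous g ->
  exists2 a : R, 0 <= a & forall x, cube 0 M x -> `|g x| <= a.
Proof.
move=> cg; pose K : set R3 := `[- M, M] `*` `[- M, M] `*` `[- M, M].
have cK : compact K by apply: compact_setX; [apply: compact_setX|]; exact: segment_compact.
have : compact (g @` K) by apply: continuous_compact => //; exact: continuous_subspaceT.
move=> /compact_bounded[a [ar Ha]].
exists (`|a| + 1); first by rewrite addr_ge0.
move=> x /cubeP /= [h1 h2 h3]; apply: (Ha (`|a| + 1)).
  by rewrite (le_lt_trans (ler_norm a))// ltrDl.
exists x => //; rewrite /K /= !in_itv/= -!ler_norml.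
by move: h1 h2 h3; rewrite !sub0r !normrN => /ltW ? /ltW ? /ltW ?.
Qed.

End grid_averages.

(** * Approximation by grid averages *)

Section local_compactness.
Context {R : realType}.
Local Notation R3 := (R3 R).
Local Notation mu3 := (@lebesgue3 R).
Local Notation mu6 := (@lebesgue3 R \x @lebesgue3 R)%E.
Local Notation nc := (@ComplexField.Normc.normc R).
Local Notation cell m j := [set x : R3 | grid_index m x = j].
Variables (A : R3 -> R3) (s p : R).
Hypotheses (cA : continuous A) (s0 : 0 < s) (p1 : 1 < p) (sp3 : s * p < 3).
Local Notation Q := (pstar s p).
Local Notation w := (gagliardo_weight s p).
Local Notation L := (magnetic_diff A).
Local Notation E := (energy_space mu3 mu6 p Q w L).
Local Notation N := (dirichlet mu6 p w L).
Local Notation mass u := (\int[mu3]_x (nc (u x) `^ Q)).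

Let Q1 : 1 < Q. Proof. exact: lt_trans (lt_pstar _ _ s0 p1 sp3). Qed.

(** Covers the real and the imaginary part at once, so that averages and limits are taken of real
    functions. *)
Definition component_of (u : R3 -> R[i]) (f : R3 -> R) :=
  [/\ measurable_fun setT f, forall x, `|f x| <= nc (u x) &
      forall x y, `|f x - f y| <= nc (u x - u y)].

Lemma component_Re u : cmeasurable u -> component_of u (fun x => complex.Re (u x)).
Proof.
move=> [mR _]; split => // [x|x y]; first exact: norm_Re_le.
by rewrite -complexReB norm_Re_le.
Qed.

Lemma component_Im u : cmeasurable u -> component_of u (fun x => complex.Im (u x)).
Proof.
move=> [_ mI]; split => // [x|x y]; first exact: norm_Im_le.
by rewrite -complexImB norm_Im_le.
Qed.

Lemma normc_le_mass (u : R3 -> R[i]) x : nc (u x) <= 1 + nc (u x) `^ Q.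
Proof. by have := le_truncated _ _ _ Q1 ltr01 (normc_ge0 (u x)); rewrite powR1 mul1r. Qed.

Lemma rintegrable_indic_normc (X : set R3) u : measurable X ->
  rintegrable mu3 (\1_X : R3 -> R) -> E u ->
  rintegrable mu3 (fun x => \1_X x * nc (u x)) /\
  \int[mu3]_x (\1_X x * nc (u x)) <= \int[mu3]_x \1_X x + mass u.
Proof.
move=> mX Xi [[mu_ ui] _ _].
have le x : \1_X x * nc (u x) <= \1_X x + nc (u x) `^ Q.
  rewrite indicE; case: (x \in X); first by rewrite mul1r; exact: normc_le_mass.
  by rewrite mul0r add0r powR_ge0.
have I : rintegrable mu3 (fun x => \1_X x * nc (u x)).
  apply: (le_rintegrable _ _ (fun x => \1_X x + nc (u x) `^ Q)).
  - by apply: measurable_funM; [exact/measurable_indicP|exact: cmeasurable_normc].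
  - by move=> x; rewrite ger0_norm// mulr_ge0 ?normc_ge0.
  - exact: rintegrableD.
split=> //; rewrite -(rintegralD _ _ _ Xi ui); apply: le_rintegral => //.
exact: rintegrableD.
Qed.

Lemma rintegrable_cell_component m j u f : E u -> component_of u f ->
  rintegrable mu3 (fun y => \1_(cell m j) y * f y).
Proof.
move=> uE [mf fu _].
have [I _] := rintegrable_indic_normc _ _ (measurable_cell m j) (rintegrable_cell m j) uE.
apply: (le_rintegrable _ _ _ _ _ I).
  by apply: measurable_funM => //; apply/measurable_indicP; exact: measurable_cell.
by move=> x; rewrite normrM ger0_norm// ler_wpM2l.
Qed.

Lemma grid_avg_bound m j u f : E u -> component_of u f ->
  `|grid_avg m f j| <= m.+1%:R ^+ 3 * (m.+1%:R^-1 ^+ 3 + mass u).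
Proof.
move=> uE cf; have [mf fu _] := cf.
have Ic := rintegrable_cell_component m j _ _ uE cf.
have [I Ile] := rintegrable_indic_normc _ _ (measurable_cell m j) (rintegrable_cell m j) uE.
rewrite rintegral_cell in Ile.
have m0 : 0 <= m.+1%:R ^+ 3 :> R by rewrite exprn_ge0.
rewrite /grid_avg normrM ger0_norm// ler_wpM2l//; apply: le_trans Ile.
apply: (@le_trans _ _ (\int[mu3]_y `|\1_(cell m j) y * f y|)).
  by apply: le_normr_Rintegral.
apply: le_rintegral => //; first exact: rintegrable_norm.
by move=> x; rewrite normrM ger0_norm// ler_wpM2l.
Qed.

Lemma phase_le x y (r M a : R) : 0 <= r -> r <= 1 -> cube 0 M x -> cube x r y ->
  (forall z, cube 0 (M + 1) z -> [/\ `|(A z).1.1| <= a, `|(A z).1.2| <= a & `|(A z).2| <= a]) ->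
  `|phase A (x, y)| <= 3 * r * a.
Proof.
move=> r0 r1 /cubeP[/= x1 x2 x3] /cubeP[/= y1 y2 y3] Ha.
have mid (b c : R) : `|0 - b| < M -> `|b - c| < r -> `|0 - 2^-1 * (b + c)| < M + 1.
  by rewrite !ltr_norml => /andP[? ?] /andP[? ?]; apply/andP; split; lra.
(* The field is evaluated at the midpoint, which stays in the larger cube because [r <= 1]. *)
have [|a1 a2 a3] := Ha (2^-1 *: (x + y)).
  by apply/cubeP; split => /=; apply: mid.
have pr (b c : R) : `|b| <= r -> `|c| <= a -> `|b * c| <= r * a.
  by move=> ? ?; rewrite normrM ler_pM.
rewrite /phase normrN /dot3 /=.
have h1 := pr _ _ (ltW y1) a1; have h2 := pr _ _ (ltW y2) a2; have h3 := pr _ _ (ltW y3) a3.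
apply: (le_trans (ler_normD _ _)); apply: (le_trans (lerD (ler_normD _ _) (lexx _))).
apply: (le_trans (lerD (lerD h1 h2) h3)); apply: eq_ler; ring.
Qed.

(** The ordinary difference [u x - u y] is the magnetic one minus [(expi(phase) - 1) u(x)]: removing
    the phase costs only a small multiple of [|u(x)|]. *)
Lemma normc_diff_le u x y (theta : R) : `|phase A (x, y)| <= theta ->
  nc (u x - u y) <= nc (L u (x, y)) + 2 * theta * nc (u x).
Proof.
move=> th; have -> : u x - u y = L u (x, y) - (expi (phase A (x, y)) - 1) * u x.
  by rewrite /magnetic_diff /phase /=; ring.
apply: (le_trans (ler_normcD _ _)); rewrite normcN lerD2l ComplexField.Normc.normcM.
rewrite ler_wpM2r ?normc_ge0// (le_trans (normc_expiB1_le _))//.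
by rewrite ler_wpM2l.
Qed.

Local Notation field_bound M a := (forall z, cube 0 (M + 1) z ->
  [/\ `|(A z).1.1| <= a, `|(A z).1.2| <= a & `|(A z).2| <= a]).

(** The left side is the mean of [f x - f y] over the cell of [x]. Each difference costs the level
    [al], a truncated share of the energy and the phase error [2 * (3 r a) |u(x)|], with [r] the
    mesh. The energy coefficient is of order [r^(s p)]: the power [3 + s p] of the mesh outweighs
    the inverse volume of the cell. *)
Lemma oscillation_bound m (M a al gam : R) u f x : E u -> component_of u f ->
  0 < al -> 0 <= a -> field_bound M a -> cube 0 M x ->
  local_energy A s p u x = gam%:E ->
  `|f x - grid_avg m f (grid_index m x)| <=
  al + al `^ (1 - p) * (m.+1%:R ^+ 3 * (2 * m.+1%:R^-1) `^ (3 + s * p)) * gam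
     + 6 * a * m.+1%:R^-1 * nc (u x).
Proof.
move=> uE cf al0 a0 Ha xM gE.
have [[mu_ ui] mLu Lui] := uE; have [mf fu fuB] := cf.
pose r : R := m.+1%:R^-1; have r0 : 0 < r by rewrite invr_gt0.
have r1 : r <= 1 by rewrite invf_le1// ler1n.
pose J := grid_index m x.
have m0 : 0 < m.+1%:R ^+ 3 :> R by rewrite exprn_gt0.
have m3 : m.+1%:R ^+ 3 * r ^+ 3 = 1 by rewrite -exprMn divff// expr1n.
have Ic : rintegrable mu3 (\1_(cell m J) : R3 -> R) := rintegrable_cell m J.
have If := rintegrable_cell_component m J _ _ uE cf.
have [di gamE] := slice_integral A s p cA u x gam mu_ gE.
pose c1 := al + 6 * a * r * nc (u x); pose c2 := al `^ (1 - p) * (2 * r) `^ (3 + s * p).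
have Ix := rintegrableZ mu3 (f x) _ Ic; have I1 := rintegrableZ mu3 c1 _ Ic.
have I2 := rintegrableZ mu3 c2 _ di.
have E1 : f x - grid_avg m f J =
    m.+1%:R ^+ 3 * \int[mu3]_y (f x * \1_(cell m J) y - \1_(cell m J) y * f y).
  rewrite (rintegralB _ _ _ Ix If) (rintegralZ _ _ _ Ic) rintegral_cell /grid_avg.
  by rewrite mulrBr mulrCA m3 mulr1.
rewrite E1 normrM (ger0_norm (ltW m0)).
have Hle : `|\int[mu3]_y (f x * \1_(cell m J) y - \1_(cell m J) y * f y)| <=
   c1 * r ^+ 3 + c2 * gam.
  have IB := rintegrableB _ _ _ Ix If.
  apply: (@le_trans _ _ (\int[mu3]_y `|f x * \1_(cell m J) y - \1_(cell m J) y * f y|)).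
    by apply: le_normr_Rintegral.
  rewrite -(rintegral_cell m J) gamE -(rintegralZ _ _ _ Ic) -(rintegralZ _ _ _ di).
  rewrite -(rintegralD _ _ _ I1 I2).
  apply: le_rintegral; [exact: rintegrable_norm|exact: rintegrableD|].
  move=> y; rewrite indicE; have [/set_mem yc|_] := boolP (y \in cell m J); last first.
    rewrite !(mulr0, mul0r) subrr normr0 add0r mulr_ge0 ?mulr_ge0 ?powR_ge0//.
    exact: gagliardo_weight_ge0.
  rewrite !mulr1 mul1r; apply: (le_trans (fuB x y)).
  have xy : cube x r y by apply: cell_cube; rewrite yc.
  have := normc_diff_le u x y (3 * r * a) (phase_le _ _ _ _ _ (ltW r0) r1 xM xy Ha).
  have h1 := le_truncated _ _ _ p1 al0 (normc_ge0 (L u (x, y))).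
  have h2 := local_energy_le A s p s0 p1 u x y _ (enorm_cube_le _ _ _ (ltW r0) xy).
  have h3 := ler_wpM2l (powR_ge0 al (1 - p)) h2.
  move=> H; apply: (le_trans H); apply: (le_trans (lerD h1 (lexx _))).
  apply: (le_trans (lerD (lerD (lexx al) h3) (lexx _))).
  by apply: eq_ler; rewrite /c1 /c2; ring.
apply: (le_trans (ler_wpM2l (ltW m0) Hle)); apply: eq_ler.
rewrite mulrDr mulrCA m3 mulr1 /c1 /c2 -/r; ring.
Qed.

Lemma oscillation_L1 m (M a al B : R) u f : E u -> component_of u f -> N u <= B ->
  0 <= M -> 0 < al -> 0 <= a -> field_bound M a ->
  (\int[mu3]_x (\1_(cube 0 M) x * `|f x - grid_avg m f (grid_index m x)|)%:E <=
  (al * (2 * M) ^+ 3 +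
   al `^ (1 - p) * (m.+1%:R ^+ 3 * (2 * m.+1%:R^-1) `^ (3 + s * p)) * B +
   6 * a * m.+1%:R^-1 * ((2 * M) ^+ 3 + mass u))%:E)%E.
Proof.
move=> uE cf uB M0 al0 a0 Ha; have [[mu_ ui] mLu Lui] := uE; have [mf fu fuB] := cf.
set c := al `^ (1 - p) * _; set b := 6 * a * _.
have r0 : 0 < 2 * m.+1%:R^-1 :> R by rewrite mulr_gt0// invr_gt0.
have c0 : 0 < c by rewrite !mulr_gt0 ?powR_gt0// exprn_gt0.
have b0 : 0 <= b by rewrite !mulr_ge0// invr_ge0.
have mX := measurable_cube (0 : R3) M.
have Xi := rintegrable_cube (0 : R3) M M0; have XE := rintegral_cube (0 : R3) M M0.
have [In Inle] := rintegrable_indic_normc _ _ mX Xi uE; rewrite XE in Inle.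
have Id : rintegrable mu3 (fun x => al * \1_(cube 0 M) x + b * (\1_(cube 0 M) x * nc (u x))).
  by apply: rintegrableD; exact: rintegrableZ.
have mind := measurable_indic_cube (0 : R3) M.
have mle : measurable_fun setT (local_energy A s p u).
  apply: (@measurable_fun_fubini_tonelli_F _ _ _ _ _ (@lebesgue3 R)
    (fun z => (w z * nc (L u z) `^ p)%:E)).
  - by apply/measurable_EFinP; exact: measurable_energy_density.
  - by move=> z; rewrite lee_fin mulr_ge0 ?powR_ge0// gagliardo_weight_ge0.
have H1 x : setT x -> (0 <= (al * \1_(cube 0 M) x + b * (\1_(cube 0 M) x * nc (u x)))%:E)%E.
  by move=> _; rewrite lee_fin addr_ge0 ?mulr_ge0 ?normc_ge0// ltW.
have H2 : measurable_fun setT (fun x => (al * \1_(cube 0 M) x + b * (\1_(cube 0 M) x * nc (u x)))%:E).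
  apply/measurable_EFinP; exact: (rintegrable_measurable mu3 _ Id).
have H3 x : setT x -> (0 <= local_energy A s p u x)%E by move=> _; exact: local_energy_ge0.
have H4 x : setT x -> (0 <= c%:E * local_energy A s p u x)%E.
  by move=> _; rewrite mule_ge0 ?local_energy_ge0// lee_fin ltW.
have H5 : measurable_fun setT (fun x => c%:E * local_energy A s p u x)%E by exact: measurable_funeM.
apply: (@le_trans _ _ (\int[mu3]_x ((al * \1_(cube 0 M) x + b * (\1_(cube 0 M) x * nc (u x)))%:E
    + c%:E * local_energy A s p u x))%E).
  apply: ge0_le_integral => //.
  - apply/measurable_EFinP; apply: measurable_funM => //; apply: measurableT_comp => //.
    apply: measurable_funB => //; exact: measurable_grid_fun.
  - by apply: emeasurable_funD; [exact: H2|exact: H5].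
  - move=> x _; have := local_energy_ge0 A s p u x.
    case gE : (local_energy A s p u x) => [gam| |] // gam0; last first.
      by rewrite gt0_muley ?lte_fin// addey ?leey.
    rewrite lee_fin in gam0.
    rewrite -EFinM -EFinD lee_fin indicE.
    have [/set_mem xM|_] := boolP (x \in cube 0 M); last first.
      by rewrite !(mul0r, mulr0) !add0r mulr_ge0// ltW.
    rewrite !(mul1r, mulr1); apply: (le_trans (oscillation_bound m M a al gam u f x uE cf al0 a0 Ha xM gE)).
    by rewrite -/c -/b addrAC.
rewrite (ge0_integralD _ measurableT H1 H2 H4 H5).
rewrite (ge0_integralZl_EFin _ measurableT H3 mle (ltW c0)).
rewrite dirichlet_local_energy// rintegrableE// -EFinM -EFinD lee_fin.
rewrite rintegralD; [|exact: rintegrableZ..]; rewrite !rintegralZ// XE.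
rewrite addrAC; apply: lerD; last exact: ler_wpM2l.
by apply: lerD => //; rewrite ler_wpM2l// ltW.
Qed.

End local_compactness.

Section integral_triangle.
Context {d} {T : measurableType d} {R : realType}.
Variable mu : {measure set T -> \bar R}.

Lemma le_integral_add (a b c : T -> R) (x y : R) :
  measurable_fun setT a -> measurable_fun setT b -> measurable_fun setT c ->
  (forall t, 0 <= a t) -> (forall t, 0 <= b t) -> (forall t, 0 <= c t) ->
  (forall t, a t <= b t + c t) ->
  (\int[mu]_t (b t)%:E <= x%:E)%E -> (\int[mu]_t (c t)%:E <= y%:E)%E ->
  (\int[mu]_t (a t)%:E <= (x + y)%:E)%E.
Proof.
move=> ma mb mc a0 b0 c0 abc bx cy; rewrite EFinD; apply: le_trans (leeD bx cy).
rewrite -ge0_integralD; [|exact: measurableT|..].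
- apply: ge0_le_integral; first exact: measurableT.
  + by move=> t _; rewrite lee_fin.
  + exact/measurable_EFinP.
  + by apply: emeasurable_funD; exact/measurable_EFinP.
  + by move=> t _; rewrite -EFinD lee_fin.
- by move=> t _; rewrite lee_fin.
- exact/measurable_EFinP.
- by move=> t _; rewrite lee_fin.
- exact/measurable_EFinP.
Qed.

End integral_triangle.

(** * Almost everywhere convergent subsequences *)

Section rellich.
Context {R : realType}.
Local Notation R3 := (R3 R).
Local Notation mu3 := (@lebesgue3 R).
Local Notation mu6 := (@lebesgue3 R \x @lebesgue3 R)%E.
Local Notation nc := (@ComplexField.Normc.normc R).
Variables (A : R3 -> R3) (s p : R).
Hypotheses (cA : continuous A) (s0 : 0 < s) (p1 : 1 < p) (sp3 : s * p < 3).
Local Notation Q := (pstar s p).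
Local Notation w := (gagliardo_weight s p).
Local Notation L := (magnetic_diff A).
Local Notation E := (energy_space mu3 mu6 p Q w L).
Local Notation N := (dirichlet mu6 p w L).
Local Notation mass u := (\int[mu3]_x (nc (u x) `^ Q)).

Let p0 : 0 < p. Proof. exact: lt_trans p1. Qed.
Let sp0 : 0 < s * p. Proof. exact: mulr_gt0. Qed.

Lemma field_bounded M : exists2 a : R, 0 <= a & forall z, cube 0 M z ->
  [/\ `|(A z).1.1| <= a, `|(A z).1.2| <= a & `|(A z).2| <= a].
Proof.
have [c1 c2 c3] := continuous_field A cA.
have [a1 a10 H1] := continuous_cube_bounded _ M c1.
have [a2 a20 H2] := continuous_cube_bounded _ M c2.
have [a3 a30 H3] := continuous_cube_bounded _ M c3.
exists (a1 + a2 + a3); first by rewrite !addr_ge0.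
move=> z zM; have := H1 z zM; have := H2 z zM; have := H3 z zM => /= h3 h2 h1.
by split; lra.
Qed.

Definition mass_bound (B : R) := sobolev_constant s p * B `^ (Q / p).

Lemma le_mass_bound u B : E u -> N u <= B -> mass u <= mass_bound B.
Proof.
move=> uE uB; apply: (le_trans (sobolev_inequality A s p cA s0 p1 sp3 u uE)).
rewrite ler_wpM2l ?powR_ge0//.
have N0 : 0 <= N u by apply: dirichlet_ge0 => z; exact: gagliardo_weight_ge0.
have Qp0 : 0 <= Q / p by rewrite divr_ge0 ?(ltW p0)// (le_trans (ltW p0))// ltW// lt_pstar.
by rewrite ge0_ler_powR ?nnegrE// (le_trans N0).
Qed.

(** The level [al] is fixed first; then the energy and phase errors tend to 0 with the mesh. The
    mesh does not depend on [u], so a bounded set is uniformly close to step functions with finitely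
    many values on a cube. *)
Lemma uniform_grid_approximation (M B eps : R) : 0 <= M -> 0 <= B -> 0 < eps ->
  exists m : nat, forall u f, E u -> component_of u f -> N u <= B ->
  (\int[mu3]_x (\1_(cube 0 M) x * `|f x - grid_avg m f (grid_index m x)|)%:E <= eps%:E)%E.
Proof.
move=> M0 B0 eps0; have [a a0 Ha] := field_bounded (M + 1).
pose V := (2 * M) ^+ 3; have V0 : 0 <= V by rewrite exprn_ge0// mulr_ge0.
(* Makes the first of three errors at most [eps / 3]; the added 1 covers [M = 0]. *)
pose al := eps / (3 * (V + 1)).
have V1 : 0 < V + 1 by rewrite ltr_wpDl.
have al0 : 0 < al by rewrite divr_gt0// mulr_gt0.
pose F := mass_bound B.
have F0 : 0 <= F by rewrite mulr_ge0 ?powR_ge0.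
have hcv : (fun m : nat => m.+1%:R^-1) @ \oo --> (0 : R) by exact: cvg_harmonic.
have cvc : (fun m : nat => al `^ (1 - p) * (m.+1%:R ^+ 3 * (2 * m.+1%:R^-1) `^ (3 + s * p)) * B)
    @ \oo --> (0 : R).
  have -> : (fun m : nat => al `^ (1 - p) * (m.+1%:R ^+ 3 * (2 * m.+1%:R^-1) `^ (3 + s * p)) * B) =
      (fun m : nat => al `^ (1 - p) * 2 `^ (3 + s * p) * B * (m.+1%:R^-1) `^ (s * p)).
    apply/funext => m; have m0 : 0 < m.+1%:R :> R by rewrite ltr0n.
    have i0 : 0 < m.+1%:R^-1 :> R by rewrite invr_gt0.
    have -> : (2 * m.+1%:R^-1) `^ (3 + s * p) =
        2 `^ (3 + s * p) * (m.+1%:R^-1 ^+ 3 * m.+1%:R^-1 `^ (s * p)) :> R.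
      rewrite -(powR_mulrn 3 (ltW i0)) -powRD; last by rewrite (gt_eqF i0) implybT.
      by rewrite powRM// ltW.
    have m3 : m.+1%:R ^+ 3 * m.+1%:R^-1 ^+ 3 = 1 :> R.
      by rewrite -exprMn divff ?gt_eqF// expr1n.
    transitivity (al `^ (1 - p) * 2 `^ (3 + s * p) * B * m.+1%:R^-1 `^ (s * p) *
      (m.+1%:R ^+ 3 * m.+1%:R^-1 ^+ 3)); last by rewrite m3 mulr1.
    by move: (m.+1%:R^-1 `^ (s * p)) (m.+1%:R ^+ 3 : R) (m.+1%:R^-1 ^+ 3 : R) => X Y Z; ring.
  rewrite -(mulr0 (al `^ (1 - p) * 2 `^ (3 + s * p) * B)); apply: cvgM; first exact: cvg_cst.
  rewrite -[X in _ --> X](@powR0 _ (s * p)) ?gt_eqF//.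
  by apply: (@cvg_powR _ _ _ _ _ (s * p)) => //; exact: cvg_cst.
have cvb : (fun m : nat => 6 * a * m.+1%:R^-1 * (V + F)) @ \oo --> (0 : R).
  have -> : (fun m : nat => 6 * a * m.+1%:R^-1 * (V + F)) =
     (fun m : nat => 6 * a * (V + F) * m.+1%:R^-1) by apply/funext => m; ring.
  by rewrite -(mulr0 (6 * a * (V + F))); apply: cvgM => //; exact: cvg_cst.
have e3 : 0 < eps / 3 by rewrite divr_gt0.
have n1 : \forall m \near \oo,
    al `^ (1 - p) * (m.+1%:R ^+ 3 * (2 * m.+1%:R^-1) `^ (3 + s * p)) * B < eps / 3.
  exact: cvgr_lt cvc _ e3.
have n2 : \forall m \near \oo, 6 * a * m.+1%:R^-1 * (V + F) < eps / 3.
  exact: cvgr_lt cvb _ e3.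
have [m [h1 h2]] := filter_ex (filterI n1 n2).
exists m => u f uE cf uB.
apply: (le_trans (oscillation_L1 A s p cA s0 p1 sp3 m M a al B u f uE cf uB M0 al0 a0 Ha)).
rewrite lee_fin -/V.
have FM : mass u <= F by exact: le_mass_bound.
have h0 : al * V <= eps / 3.
  rewrite /al mulrAC ler_pdivrMr ?mulr_gt0//.
  rewrite (_ : eps / 3 * (3 * (V + 1)) = eps * (V + 1)); last by field.
  by rewrite ler_pM2l// lerDl.
have h3 : 6 * a * m.+1%:R^-1 * (V + mass u) <= 6 * a * m.+1%:R^-1 * (V + F).
  by rewrite ler_wpM2l ?mulr_ge0 ?invr_ge0// lerD2l.
apply: (le_trans (lerD (lerD h0 (ltW h1)) (le_trans h3 (ltW h2)))).
by apply: eq_ler; field.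
Qed.

(** For one mesh, each function is close to its averages and the averages converge on every cell,
    dominated by a constant on the cube. Passing from [f n] to its averages, to their limit and back
    gives four errors of [eps / 4]. *)
Lemma grid_limit_cauchy (v : nat -> R3 -> R[i]) (f : nat -> R3 -> R) (M B eps : R)
    (l : nat -> int * int * int -> R) :
  (forall n, E (v n)) -> (forall n, component_of (v n) (f n)) -> (forall n, N (v n) <= B) ->
  0 <= M -> 0 <= B -> 0 < eps ->
  (forall m j, (fun n => grid_avg m (f n) j) @ \oo --> l m j) ->
  exists n0 : nat, forall n k, (n0 <= n)%N -> (n0 <= k)%N ->
  (\int[mu3]_x (\1_(cube 0 M) x * `|f n x - f k x|)%:E <= eps%:E)%E.
Proof.
move=> vE vf vB M0 B0 eps0 fl.
have e4 : 0 < eps / 4 by rewrite divr_gt0.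
have [m Hm] := uniform_grid_approximation M B (eps / 4) M0 B0 e4.
pose F := mass_bound B.
have FM n : mass (v n) <= F by exact: le_mass_bound.
pose b := m.+1%:R ^+ 3 * (m.+1%:R^-1 ^+ 3 + F).
have avg_b n j : `|grid_avg m (f n) j| <= b.
  apply: (le_trans (grid_avg_bound A s p s0 p1 sp3 m j _ _ (vE n) (vf n))).
  by rewrite /b ler_wpM2l ?exprn_ge0// lerD2l.
have l_b j : `|l m j| <= b.
  rewrite -(cvg_lim _ (cvg_norm (fl m j)))//; apply: limr_le.
    exact: cvgP (cvg_norm (fl m j)).
  by apply: nearW => n; exact: avg_b.
have mind := measurable_indic_cube (0 : R3) M.
have Xi := rintegrable_cube (0 : R3) M M0.
pose g n x := \1_(cube 0 M) x * `|grid_avg m (f n) (grid_index m x) - l m (grid_index m x)|.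
have mg n : measurable_fun setT (g n).
  apply: measurable_funM => //; apply: measurableT_comp => //.
  exact: (measurable_grid_fun m (fun j => grid_avg m (f n) j - l m j)).
have [_ gi gcv] : [/\ rintegrable mu3 (fun=> 0 : R), forall n, rintegrable mu3 (g n) &
    (fun n => \int[mu3]_x g n x) @ \oo --> \int[mu3]_x ((fun=> 0) x : R)].
  apply: (@cvg_Rintegral_equi _ _ _ mu3 g (fun _ _ => 0) (fun=> 0) 0) => //.
  - apply: aeW => x; rewrite -[X in _ --> X](mulr0 (\1_(cube 0 M) x)).
    apply: cvgM; first exact: cvg_cst.
    rewrite -[X in _ --> X](normr0 R) -(subrr (l m (grid_index m x))).
    by apply: cvg_norm; apply: cvgB; [exact: fl|exact: cvg_cst].
  - by move=> n; rewrite integral0.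
  - move=> e e0; exists (fun x => (b + b) * \1_(cube 0 M) x); first exact: rintegrableZ.
    move=> n x; rewrite mulr0 add0r /g normrM normr_id ger0_norm// mulrC ler_wpM2r//.
    by rewrite (le_trans (ler_normB _ _))// lerD.
have z0 : \int[mu3]_x ((fun=> 0) x : R) = 0 by rewrite /Rintegral integral0.
rewrite z0 in gcv.
have [n0 _ Hn0] : \forall n \near \oo, \int[mu3]_x g n x < eps / 4 by exact: cvgr_lt gcv _ e4.
exists n0 => n k n0n n0k.
have gE i : (n0 <= i)%N -> (\int[mu3]_x (g i x)%:E <= (eps / 4)%:E)%E.
  by move=> n0i; rewrite rintegrableE// lee_fin ltW//; exact: Hn0.
pose o i x := \1_(cube 0 M) x * `|f i x - grid_avg m (f i) (grid_index m x)|.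
have mf i : measurable_fun setT (f i) by have [] := vf i.
have mo i : measurable_fun setT (o i).
  apply: measurable_funM => //; apply: measurableT_comp => //.
  by apply: measurable_funB => //; exact: measurable_grid_fun.
have oE i : (\int[mu3]_x (o i x)%:E <= (eps / 4)%:E)%E.
  exact: Hm (vE i) (vf i) (vB i).
have o0 i x : 0 <= o i x by rewrite mulr_ge0.
have g0 i x : 0 <= g i x by rewrite mulr_ge0.
have og i : (n0 <= i)%N -> (\int[mu3]_x (o i x + g i x)%:E <= (eps / 4 + eps / 4)%:E)%E.
  move=> n0i; apply: (le_integral_add mu3 _ (o i) (g i)) => //.
  - exact: measurable_funD.
  - by move=> x; rewrite addr_ge0.
  - exact: gE.
have -> : eps = (eps / 4 + eps / 4) + (eps / 4 + eps / 4) by field.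
apply: (le_integral_add mu3 _ (fun x => o n x + g n x) (fun x => o k x + g k x)).
- by apply: measurable_funM => //; apply: measurableT_comp => //; exact: measurable_funB.
- exact: measurable_funD.
- exact: measurable_funD.
- by move=> x; rewrite mulr_ge0.
- by move=> x; rewrite addr_ge0.
- by move=> x; rewrite addr_ge0.
- move=> x; rewrite /o /g -!mulrDr ler_wpM2l//.
  set P := grid_avg m (f n) _; set P' := grid_avg m (f k) _; set lx := l m _.
  rewrite (_ : f n x - f k x = (f n x - P) + (P - lx) - ((f k x - P') + (P' - lx))); last by ring.
  apply: (le_trans (ler_normB _ _)).
  by apply: lerD; exact: ler_normD.
- exact: og.
- exact: og.
Qed.

Lemma null_set_product (Z : set R3) : measurable Z -> mu3 Z = 0%E ->
  mu6.-negligible (Z `*` setT `|` setT `*` Z).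
Proof.
move=> mZ Z0; apply: negligibleU.
  apply/negligibleP; first exact: measurableX.
  rewrite [LHS]product_measure1E; [|exact: mZ|exact: measurableT].
  by rewrite [X in (X * _)%E]Z0 mul0e.
apply/negligibleP; first exact: measurableX.
rewrite [LHS]product_measure1E; [|exact: measurableT|exact: mZ].
by rewrite [X in (_ * X)%E]Z0 mule0.
Qed.

Lemma ccvg_magnetic_diff (v : nat -> R3 -> R[i]) u z :
  ccvg (fun n => v n z.1) (u z.1) -> ccvg (fun n => v n z.2) (u z.2) ->
  ccvg (fun n => L (v n) z) (L u z).
Proof.
move=> /ccvg_normcB h1 /ccvg_normcB h2; apply/ccvg_normcB.
have H : (fun n => nc (v n z.1 - u z.1) + nc (v n z.2 - u z.2)) @ \oo --> (0 : R).
  by rewrite -[X in _ --> X]addr0; exact: cvgD.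
apply: (@squeeze_cvgr _ _ _ _ (cst 0) (fun n => nc (v n z.1 - u z.1) + nc (v n z.2 - u z.2)));
  [|exact: cvg_cst|exact: H].
apply: nearW => n; rewrite normc_ge0 /=.
rewrite (_ : L (v n) z - L u z =
   expi (phase A z) * (v n z.1 - u z.1) - (v n z.2 - u z.2)); last first.
  by rewrite /magnetic_diff /phase; ring.
apply: (le_trans (ler_normcD _ _)); rewrite normcN ComplexField.Normc.normcM.
by rewrite expi_normc mul1r.
Qed.

(** Countably many averages (mesh, cell, real or imaginary part) converge along one subsequence,
    which is then Cauchy in mean on every cube; a further one with summable increments converges
    a.e. The differences [L u_n] follow off a null set of pairs, since they involve [u_n] at the two
    points only. *)
Lemma magnetic_bounded_compact (u_ : nat -> R3 -> R[i]) (B : R) :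
  (forall n, E (u_ n)) -> (forall n, N (u_ n) <= B) ->
  exists (sigma : nat -> nat) (u : R3 -> R[i]),
    [/\ forall n, (n <= sigma n)%N, cmeasurable u, cmeasurable (L u) &
        ae_ccvg mu3 mu6 L (u_ \o sigma) u].
Proof.
move=> u_E u_B.
have B0 : 0 <= B.
  apply: le_trans (u_B 0%N); apply: dirichlet_ge0 => z; exact: gagliardo_weight_ge0.
pose f_ (b : bool) n x := if b then complex.Re (u_ n x) else complex.Im (u_ n x).
have f_comp b n : component_of (u_ n) (f_ b n).
  have mu_ : cmeasurable (u_ n) by have [[]] := u_E n.
  by case: b; [exact: component_Re|exact: component_Im].
pose F := mass_bound B.
have FM n : mass (u_ n) <= F by exact: le_mass_bound.
have [sigma [l [sn lcv]]] := @countable_extraction R (nat * (int * int * int) * bool)%type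
  (fun n i => grid_avg i.1.1 (f_ i.2 n) i.1.2)
  (fun i => i.1.1.+1%:R ^+ 3 * (i.1.1.+1%:R^-1 ^+ 3 + F))
  (fun n i => le_trans (grid_avg_bound A s p s0 p1 sp3 _ _ _ _ (u_E n) (f_comp i.2 n))
     (ler_wpM2l (exprn_ge0 3 (ler0n R _)) (lerD (lexx _) (FM n)))).
have cauchy b (i : nat) : exists n0 : nat, forall n k, (n0 <= n)%N -> (n0 <= k)%N ->
    (\int[mu3]_x (\1_(cube (0%R : R3) i%:R) x * `|f_ b (sigma n) x - f_ b (sigma k) x|)%:E <=
     (1 / (2 ^ i.+1)%:R)%:E)%E.
  apply: (grid_limit_cauchy (u_ \o sigma) (f_ b \o sigma) i%:R B _ (fun m j => l (m, j, b))) => //.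
  - by move=> n; exact: u_E.
  - by move=> n; exact: f_comp.
  - by move=> n; exact: u_B.
  - by move=> m j; exact: (lcv (m, j, b)).
have /choice[nR nRP] := cauchy true; have /choice[nI nIP] := cauchy false.
(* Sums in place of maxima make [tau] monotone, so [tau i] and [tau i.+1] both lie past the
   thresholds for [i]; the summand [i] makes it tend to infinity. *)
pose tau i := (\sum_(j < i.+1) (nR j + nI j) + i)%N.
have tau_ge i : (nR i <= tau i)%N /\ (nI i <= tau i)%N.
  rewrite /tau big_ord_recr/=; split; lia.
have tau_geS i : (tau i <= tau i.+1)%N by rewrite /tau [in leqRHS]big_ord_recr/=; lia.
have tau_id i : (i <= tau i)%N by rewrite leq_addl.
pose h b i := f_ b (sigma (tau i)).
have mh b i : measurable_fun setT (h b i) by have [] := f_comp b (sigma (tau i)).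
have h_ae b : {ae mu3, forall x, cvgn (fun i => h b i x)}.
  apply: (ae_cvg_of_summable mu3 (fun i => cube (0%R : R3) i%:R) (h b)) => //.
  - by move=> i; exact: measurable_cube.
  - move=> x; pose a := `|x.1.1| + `|x.1.2| + `|x.2|.
    have a0 : 0 <= a by rewrite !addr_ge0.
    exists (Num.truncn a).+1 => j aj.
    have aj' : a < j%:R.
      by apply: (lt_le_trans (truncnS_gt a)); rewrite ler_nat.
    have := normr_ge0 x.1.1; have := normr_ge0 x.1.2; have := normr_ge0 x.2.
    by rewrite /a in aj'; move=> ? ? ?; apply/cubeP => /=; rewrite !sub0r !normrN; split; lra.
  - move=> i; have [tR tI] := tau_ge i; have tS := tau_geS i.
    by case: b; [apply: nRP|apply: nIP] => //; apply: leq_trans tS.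
have [Z [mZ Z0 Zsub]] : {ae mu3, forall x, cvgn (fun i => h true i x) /\ cvgn (fun i => h false i x)}.
  by apply: filterS2 (h_ae true) (h_ae false) => x.
have hcv b x : ~ Z x -> cvgn (fun i => h b i x).
  move=> nZ; have [h1 h2] : cvgn (fun i => h true i x) /\ cvgn (fun i => h false i x).
    by apply: contrapT => nc_; apply: nZ; exact: Zsub.
  by case: b.
(* Cutting off the null set makes the limit exist at every point, hence measurable as a pointwise
   limit. *)
pose g b i x := \1_(~` Z) x * h b i x.
have gcv b x : cvgn (fun i => g b i x).
  rewrite /g indicE; have [/set_mem xZ|xZ] := boolP (x \in ~` Z).
    under eq_fun do rewrite mul1r; exact: hcv.
  by under eq_fun do rewrite mul0r; exact: is_cvg_cst.
pose lg b x := limn (fun i => g b i x).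
have mlg b : measurable_fun setT (lg b).
  apply: (@measurable_fun_cvg _ _ _ setT (g b)); last by move=> x _; exact: gcv.
  move=> i; apply: measurable_funM => //; apply/measurable_indicP; exact: measurableC.
pose u x : R[i] := (lg true x +i* lg false x)%C.
have mu_ : cmeasurable u by split; [exact: (mlg true)|exact: (mlg false)].
have ucv x : ~ Z x -> ccvg (fun n => (u_ \o (sigma \o tau)) n x) (u x).
  move=> nZ; have gE b : (fun i => g b i x) = (fun i => h b i x).
    by apply/funext => i; rewrite /g indicE mem_set// mul1r.
  have lgcv b : (fun i => h b i x) @ \oo --> lg b x by rewrite /lg gE; exact: hcv.
  by split; [exact: (lgcv true)|exact: (lgcv false)].
exists (sigma \o tau), u; split.
- by move=> n; exact: leq_trans (tau_id n) (sn (tau n)).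
- exact: mu_.
- exact: cmeasurable_magnetic_diff.
split.
  by exists Z; split => // x /= nx; apply: contrapT => nZ; apply: nx; exact: ucv.
have [W [mW W0 Wsub]] := null_set_product Z mZ Z0.
exists W; split => // z nz; apply: Wsub; apply: contrapT => nZZ; apply: nz.
apply: ccvg_magnetic_diff; apply: ucv => Zz; apply: nZZ.
- by left; split.
- by right; split.
Qed.

End rellich.

(** * Test functions *)

Section singular_kernel.
Context {R : realType}.
Local Notation R3 := (R3 R).
Local Notation mu3 := (@lebesgue3 R).
Variables (s p : R).
Hypotheses (s0 : 0 < s) (s1 : s < 1) (p1 : 1 < p).
Local Notation w := (gagliardo_weight s p).

Let p0 : 0 < p. Proof. exact: lt_trans p1. Qed.
Let sp0 : 0 < s * p. Proof. exact: mulr_gt0. Qed.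

Lemma dyadic_scale (D : R) : 1 <= D -> exists i : nat, 2 ^+ i <= D < 2 ^+ i.+1.
Proof.
move=> D1; have D0 : 0 <= D by exact: le_trans D1.
pose n := Num.truncn D; have n0 : (0 < n)%N by rewrite truncn_gt0.
exists (trunc_log 2 n); have /andP[h1 h2] := trunc_log_bounds (isT : (1 < 2)%N) n0.
apply/andP; split.
  by apply: (@le_trans _ _ n%:R); [rewrite -natrX ler_nat|have /andP[] := truncn_itv D0].
by apply: (lt_le_trans (truncnS_gt D)); rewrite -natrX ler_nat.
Qed.

Lemma dyadic_cubes_integral (x : R3) (h rho : nat -> R) (C theta : R) :
  0 <= C -> 0 < theta -> theta < 1 -> (forall i, 0 <= h i) -> (forall i, 0 <= rho i) ->
  (forall i, h i * (2 * rho i) ^+ 3 <= C * theta ^+ i) ->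
  (\int[mu3]_y (\sum_(0 <= i <oo) (h i * \1_(cube x (rho i)) y)%:E) <=
   (C / (1 - theta))%:E)%E.
Proof.
move=> C0 t0 t1 h0 r0 hr.
have mc i : measurable (cube x (rho i)) := measurable_cube x (rho i).
have mterm i : measurable_fun setT (fun y => (h i * \1_(cube x (rho i)) y)%:E).
  by apply/measurable_EFinP; apply: measurable_funM => //; exact: measurable_indic_cube.
rewrite integral_nneseries//; last by move=> i y _; rewrite lee_fin mulr_ge0.
have term i : (\int[mu3]_y (h i * \1_(cube x (rho i)) y)%:E <= (C * theta ^+ i)%:E)%E.
  under eq_integral do rewrite EFinM.
  rewrite ge0_integralZl_EFin//; last first.
    by apply/measurable_EFinP/measurable_indicP.
  rewrite integral_indic// setIT [X in (_ * X)%E](volume_cube _ _ (r0 i)).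
  by rewrite -EFinM lee_fin.
apply: lime_le.
  apply: is_cvg_nneseries => i _ _; apply: integral_ge0 => y _.
  by rewrite lee_fin mulr_ge0.
apply: nearW => n.
apply: (@le_trans _ _ (\sum_(0 <= i < n) (C * theta ^+ i)%:E)%E).
  by apply: lee_sum => i _; exact: term.
rewrite sumEFin lee_fin.
have t1' : `|theta| < 1 by rewrite gtr0_norm.
by have := @geometric_le_lim _ n C theta C0 t0 t1'; rewrite /series.
Qed.

(** Models the seminorm integrand of a bounded Lipschitz function: small near the diagonal, bounded
    numerator far from it. *)
Definition kernel (z : R3 * R3) : R := Num.min 1 (enorm (z.1 - z.2)) `^ p * w z.

Lemma kernel_ge0 z : 0 <= kernel z.
Proof. by rewrite mulr_ge0 ?powR_ge0// gagliardo_weight_ge0. Qed.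

Lemma measurable_kernel : measurable_fun setT kernel.
Proof.
apply: measurable_funM; last exact: measurable_gagliardo_weight.
apply: (measurableT_comp (measurable_powR _)); apply: measurable_minr => //.
exact: measurable_enorm_sub.
Qed.

Lemma enormN (x : R3) : enorm (- x) = enorm x.
Proof. by rewrite /enorm /dot3 /= !mulrNN. Qed.

Lemma kernel_sym x y : kernel (x, y) = kernel (y, x).
Proof. by rewrite /kernel /gagliardo_weight /gagliardo_denom /= -opprB enormN. Qed.

Lemma mem_cube_enorm (x y : R3) r : enorm (x - y) < r -> cube x r y.
Proof.
have [h1 h2 h3] := enorm_ge_coords (x - y).
by move=> xyr; apply/cubeP; split; exact: le_lt_trans xyr.
Qed.

(** Bounds of the kernel on dyadic shells, which replace polar coordinates: [|x - y|] between [2^i]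
    and [2^(i+1)] for the far heights, between [2^-(i+1)] and [2^-i] for the near ones. *)
Definition far_height (i : nat) : R := (2 ^+ i) `^ (- (3 + s * p)).
Definition near_height (i : nat) : R := (2 ^+ i)^-1 `^ p * (2 ^+ i.+1) `^ (3 + s * p).

Lemma kernel_dyadic x y : exists i,
  kernel (x, y) <= far_height i * \1_(cube x (2 * 2 ^+ i)) y \/
  kernel (x, y) <= near_height i * \1_(cube x (2 * (2 ^+ i)^-1)) y.
Proof.
set D := enorm (x - y); have D0 : 0 <= D := enorm_ge0 _.
have wE : w (x, y) = D `^ (- (3 + s * p)) by rewrite powRN.
have [Dz|D_neq0] := eqVneq D 0.
  exists 0%N; left; rewrite /kernel wE Dz powR0 ?mulr0 ?mulr_ge0 ?powR_ge0//.
  by rewrite oppr_eq0 gt_eqF// addr_gt0.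
have D_gt0 : 0 < D by rewrite lt_neqAle eq_sym D_neq0.
have pow0 (i : nat) : 0 < 2 ^+ i :> R by rewrite exprn_gt0.
have e0 : 0 <= 3 + s * p by rewrite addr_ge0// ltW.
have antitone (a b : R) : 0 < a -> a <= b -> b `^ (- (3 + s * p)) <= a `^ (- (3 + s * p)).
  move=> a0 ab; have b0 : 0 < b by exact: lt_le_trans ab.
  by rewrite !powRN lef_pV2 ?posrE ?powR_gt0// ge0_ler_powR ?nnegrE ?(ltW a0) ?(ltW b0).
have [D1|D1] := leP 1 D.
  have [i /andP[iD Di]] := dyadic_scale _ D1; exists i; left.
  rewrite /kernel /= -/D (min_idPl D1) powR1 mul1r wE indicE mem_set ?mulr1.
    exact: antitone.
  by apply: mem_cube_enorm; rewrite -exprS.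
have D1' : 1 <= D^-1 by rewrite invf_ge1// ltW.
have [i /andP[iD Di]] := dyadic_scale _ D1'; exists i; right.
have Di' : D <= (2 ^+ i)^-1 by rewrite -[D]invrK lef_pV2 ?posrE ?invr_gt0.
have iD' : (2 ^+ i.+1)^-1 <= D by rewrite -[D]invrK lef_pV2 ?posrE ?invr_gt0// ltW.
rewrite /kernel /= -/D (min_idPr (ltW D1)) wE indicE mem_set ?mulr1; last first.
  (* The radius is doubled because the cube is open and [D] may equal [2^-i]. *)
  apply: mem_cube_enorm; rewrite -/D (le_lt_trans Di')// mulr_natl mulr2n ltrDl invr_gt0//.
rewrite /near_height; apply: ler_pM; rewrite ?powR_ge0//.
  by rewrite ge0_ler_powR ?nnegrE ?(ltW p0)// invr_ge0 ltW.
apply: (le_trans (antitone _ _ _ iD')); first by rewrite invr_gt0.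
by rewrite -(powR_inv1 (ltW (pow0 i.+1))) -powRrM mulN1r opprK.
Qed.

Lemma powR_exp2 (i : nat) (e : R) : (2 ^+ i) `^ e = (2 `^ e) ^+ i :> R.
Proof.
elim: i => [|i IH]; first by rewrite !expr0 powR1.
by rewrite !exprS powRM ?exprn_ge0// IH.
Qed.

Lemma far_height_sum i :
  far_height i * (2 * (2 * 2 ^+ i)) ^+ 3 <= 64 * (2 `^ (- (s * p))) ^+ i.
Proof.
have i0 : 0 < 2 ^+ i :> R by rewrite exprn_gt0.
rewrite /far_height opprD powRD; last by rewrite (gt_eqF i0) implybT.
have -> : (2 ^+ i) `^ (- 3) = ((2 ^+ i) ^+ 3)^-1 :> R by rewrite powRN -(powR_mulrn 3 (ltW i0)).
rewrite (powR_exp2 i (- (s * p))).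
apply: eq_ler; field; exact: lt0r_neq0.
Qed.

Lemma near_height_sum i :
  near_height i * (2 * (2 * (2 ^+ i)^-1)) ^+ 3 <=
  64 * 2 `^ (3 + s * p) * (2 `^ (s * p - p)) ^+ i.
Proof.
have i0 : 0 < 2 ^+ i :> R by rewrite exprn_gt0.
rewrite /near_height exprS powRM ?(ltW i0)//.
have -> : (2 ^+ i) `^ (3 + s * p) = (2 ^+ i) ^+ 3 * (2 ^+ i) `^ (s * p) :> R.
  rewrite powRD; last by rewrite (gt_eqF i0) implybT.
  by rewrite -(powR_mulrn 3 (ltW i0)).
have -> : (2 ^+ i)^-1 `^ p = (2 ^+ i) `^ (- p) :> R.
  by rewrite -powR_inv1 ?(ltW i0)// -powRrM mulN1r.
have -> : (2 `^ (s * p - p)) ^+ i = (2 ^+ i) `^ (- p) * (2 ^+ i) `^ (s * p) :> R.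
  rewrite -powRD; last by rewrite (gt_eqF i0) implybT.
  by rewrite powR_exp2 [- p + _]addrC.
move: (2 `^ (3 + s * p)) ((2 ^+ i) `^ (- p)) ((2 ^+ i) `^ (s * p)) => X Y Z.
apply: eq_ler; field; exact: lt0r_neq0.
Qed.

(** Height times volume is geometric in the shell number: the far ratio [2^(-sp)] is below 1 because
    [s > 0], the near ratio [2^(sp-p)] because [s < 1]. *)
Lemma kernel_integral_le : exists2 c : R, 0 <= c &
  forall x, (\int[mu3]_y (kernel (x, y))%:E <= c%:E)%E.
Proof.
pose th1 : R := 2 `^ (- (s * p)); pose th2 : R := 2 `^ (s * p - p).
have lt1 (a : R) : 0 < a -> 2 `^ (- a) < 1.
  move=> a0; rewrite powRN invf_lt1 ?powR_gt0//.
  have : 1 `^ a < 2 `^ a :> R by rewrite gt0_ltr_powR ?nnegrE// ltr1n.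
  by rewrite powR1.
have th1_lt1 : th1 < 1 by exact: lt1.
have th2_lt1 : th2 < 1.
  by rewrite /th2 -opprB; apply: lt1; rewrite subr_gt0 gtr_pMl.
have c1 : 0 <= 64 / (1 - th1) by rewrite divr_ge0// subr_ge0 ltW.
have c20 : 0 <= 64 * 2 `^ (3 + s * p) by rewrite mulr_ge0 ?powR_ge0.
have c2 : 0 <= 64 * 2 `^ (3 + s * p) / (1 - th2) by rewrite divr_ge0// subr_ge0 ltW.
exists (64 / (1 - th1) + 64 * 2 `^ (3 + s * p) / (1 - th2)); first by rewrite addr_ge0.
move=> x.
have pow0 (i : nat) : 0 < 2 ^+ i :> R by rewrite exprn_gt0.
have fh0 i : 0 <= far_height i by exact: powR_ge0.
have nh0 i : 0 <= near_height i by rewrite mulr_ge0 ?powR_ge0.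
pose S1 y := (\sum_(0 <= i <oo) (far_height i * \1_(cube x (2 * 2 ^+ i)) y)%:E)%E.
pose S2 y := (\sum_(0 <= i <oo) (near_height i * \1_(cube x (2 * (2 ^+ i)^-1)) y)%:E)%E.
have I1 : (\int[mu3]_y S1 y <= (64 / (1 - th1))%:E)%E.
  apply: dyadic_cubes_integral => //; first exact: powR_gt0.
  exact: far_height_sum.
have I2 : (\int[mu3]_y S2 y <= (64 * 2 `^ (3 + s * p) / (1 - th2))%:E)%E.
  apply: dyadic_cubes_integral => //; first exact: powR_gt0.
  exact: near_height_sum.
have t0 (h rho : nat -> R) : (forall i, 0 <= h i) ->
    forall i y, (0 <= (h i * \1_(cube x (rho i)) y)%:E)%E.
  by move=> h0 i y; rewrite lee_fin mulr_ge0.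
have mS (h rho : nat -> R) : (forall i, 0 <= h i) ->
    measurable_fun setT (fun y => \sum_(0 <= i <oo) (h i * \1_(cube x (rho i)) y)%:E)%E.
  move=> h0; apply: (@ge0_emeasurable_sum _ _ _ setT
    (fun i y => (h i * \1_(cube x (rho i)) y)%:E) xpredT) => [i y _ _|i _]; first exact: t0.
  by apply/measurable_EFinP; apply: measurable_funM => //; exact: measurable_indic_cube.
have t1 := t0 _ (fun i => 2 * 2 ^+ i) fh0; have t2 := t0 _ (fun i => 2 * (2 ^+ i)^-1) nh0.
have mS1 : measurable_fun setT S1 := mS _ (fun i => 2 * 2 ^+ i) fh0.
have mS2 : measurable_fun setT S2 := mS _ (fun i => 2 * (2 ^+ i)^-1) nh0.
have S10 y : (0 <= S1 y)%E by apply: nneseries_ge0 => i _ _.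
have S20 y : (0 <= S2 y)%E by apply: nneseries_ge0 => i _ _.
rewrite EFinD; apply: le_trans (leeD I1 I2); rewrite -ge0_integralD//.
apply: ge0_le_integral => //.
- by move=> y _; rewrite lee_fin kernel_ge0.
- apply/measurable_EFinP; exact: (measurable_fun_pair2 x measurable_kernel).
- exact: emeasurable_funD.
move=> y _; have single (f : nat -> \bar R) i : (forall i, (0 <= f i)%E) ->
    (f i <= \sum_(0 <= j <oo) f j)%E.
  move=> f0; apply: (@le_trans _ _ (\sum_(0 <= j < i.+1) f j)%E); last first.
    by apply: nneseries_lim_ge => j *; exact: f0.
  by rewrite big_nat_recr//= leeDr// sume_ge0.
have [i [H|H]] := kernel_dyadic x y.
  apply: (@le_trans _ _ (S1 y)); last by rewrite leeDl.
  by apply: le_trans (single _ i (t1 ^~ y)); rewrite lee_fin.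
apply: (@le_trans _ _ (S2 y)); last by rewrite leeDr.
by apply: le_trans (single _ i (t2 ^~ y)); rewrite lee_fin.
Qed.

End singular_kernel.

(** * Lipschitz bumps in the energy space *)

Section bump.
Context {R : realType}.
Local Notation R3 := (R3 R).
Local Notation mu3 := (@lebesgue3 R).
Local Notation mu6 := (@lebesgue3 R \x @lebesgue3 R)%E.
Local Notation nc := (@ComplexField.Normc.normc R).
Variables (A : R3 -> R3) (s p : R).
Hypotheses (cA : continuous A) (s0 : 0 < s) (s1 : s < 1) (p1 : 1 < p) (sp3 : s * p < 3).
Local Notation Q := (pstar s p).
Local Notation w := (gagliardo_weight s p).
Local Notation L := (magnetic_diff A).
Local Notation E := (energy_space mu3 mu6 p Q w L).

Let p0 : 0 < p. Proof. exact: lt_trans p1. Qed.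
Let Q0 : 0 < Q. Proof. exact: lt_trans p0 (lt_pstar _ _ s0 p1 sp3). Qed.

Variable M : R.
Hypothesis M0 : 0 <= M.

(** Lipschitz and supported in a cube, with positivity sets that exhaust the space as [M] grows. *)
Definition tent (x : R3) : R := Num.max 0 (M - (`|x.1.1| + `|x.1.2| + `|x.2|)).

Definition bump (x : R3) : R[i] := (tent x)%:C%C.

Lemma tent_ge0 x : 0 <= tent x.
Proof. by rewrite le_max lexx. Qed.

Lemma tent_le x : tent x <= M.
Proof. by rewrite ge_max M0 gerBl !addr_ge0. Qed.

Lemma tent_supp x : tent x != 0 -> cube 0 M x.
Proof.
have [n1 n2 n3] : [/\ 0 <= `|x.1.1|, 0 <= `|x.1.2| & 0 <= `|x.2|] by [].
move=> t0; have : 0 < tent x by rewrite lt_neqAle eq_sym t0 tent_ge0.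
rewrite lt_max ltxx /= subr_gt0 => H; apply/cubeP => /=; rewrite !sub0r !normrN.
by split; lra.
Qed.

Lemma tent_lipschitz x y : `|tent x - tent y| <= 3 * enorm (x - y).
Proof.
have [h1 h2 h3] := enorm_ge_coords (x - y).
have max_lip (a b : R) : `|Num.max 0 a - Num.max 0 b| <= `|a - b|.
  rewrite ler_norml.
  have [a0|a0] := leP 0 a; have [b0|b0] := leP 0 b; apply/andP; split;
    have := ler_norm (a - b); have := ler_norm (- (a - b)); rewrite normrN; lra.
apply: (le_trans (max_lip _ _)).
have d1 := ler_dist_dist y.1.1 x.1.1; have d2 := ler_dist_dist y.1.2 x.1.2.
have d3 := ler_dist_dist y.2 x.2; rewrite distrC in h1; rewrite distrC in h2.
rewrite distrC in h3.
rewrite (_ : _ - _ = (`|y.1.1| - `|x.1.1|) + (`|y.1.2| - `|x.1.2|) + (`|y.2| - `|x.2|)); last by ring.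
apply: (le_trans (ler_normD _ _)); apply: (le_trans (lerD (ler_normD _ _) (lexx _))).
have -> : 3 * enorm (x - y) = enorm (x - y) + enorm (x - y) + enorm (x - y) by ring.
by apply: lerD; [apply: lerD|]; [exact: le_trans d1 h1|exact: le_trans d2 h2|exact: le_trans d3 h3].
Qed.

Lemma normc_bump x : nc (bump x) = tent x.
Proof.
have := normcZ (tent x) 1; rewrite mulr1 ComplexField.Normc.normc1 mulr1 => ->.
by rewrite ger0_norm// tent_ge0.
Qed.

Lemma measurable_tent : measurable_fun setT tent.
Proof.
apply: measurable_maxr => //; apply: measurable_funB => //.
apply: measurable_funD; [apply: measurable_funD|].
- by apply: measurableT_comp => //; exact: measurable_fst11.
- by apply: measurableT_comp => //; exact: measurable_fst12.
- by apply: measurableT_comp => //; exact: measurable_snd3.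
Qed.

Lemma cmeasurable_bump : cmeasurable bump.
Proof. by split; [exact: measurable_tent|exact: measurable_cst]. Qed.

Lemma LQ_bump : LQ mu3 Q bump.
Proof.
split; first exact: cmeasurable_bump.
apply: (le_rintegrable mu3 _ (fun x => M `^ Q * \1_(cube 0 M) x)).
- by apply: cmeasurable_normc_powR; exact: cmeasurable_bump.
- move=> x; rewrite ger0_norm ?powR_ge0// normc_bump indicE.
  have [t0|t0] := eqVneq (tent x) 0.
    by rewrite t0 powR0 ?gt_eqF// mulr_ge0 ?powR_ge0.
  rewrite mem_set ?mulr1; last exact: tent_supp.
  by rewrite ge0_ler_powR ?nnegrE ?tent_ge0 ?tent_le// ltW.
- by apply: rintegrableZ; exact: rintegrable_cube.
Qed.

Lemma bump_pointwise : exists2 K : R, 0 <= K & forall x y,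
  nc (L bump (x, y)) <= K * Num.min 1 (enorm (x - y)) * (\1_(cube 0 M) x + \1_(cube 0 M) y).
Proof.
have [a a0 Ha] := field_bounded A cA (M + 1).
(* The 3 is the Lipschitz constant of the tent; [12 a M] comes from the phase, at most
   [2 * (3 * 2D * a)], times the height [M]; [4 M] pays for the trivial bound [2 M] when
   [D >= 1/2]. *)
exists (3 + 12 * a * M + 4 * M); first by rewrite !addr_ge0 ?mulr_ge0.
move=> x y; set D := enorm (x - y); set K := 3 + _ + _.
have K0 : 0 <= K by rewrite !addr_ge0 ?mulr_ge0.
have aM : 0 <= a * M by rewrite mulr_ge0.
have KE : K = 3 + 12 * (a * M) + 4 * M by rewrite /K mulrA.
have M_ge0 : 0 <= M by exact: M0.
have K3 : 3 <= K by move: (a * M) aM KE => b b0 ->; lra.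
have K4 : 4 * M <= K by move: (a * M) aM KE => b b0 ->; lra.
have KM : M <= K by lra.
clearbody K.
have D0 : 0 <= D by exact: enorm_ge0.
have m0 : 0 <= Num.min 1 D by rewrite le_min ler01.
have crude : nc (L bump (x, y)) <= tent x + tent y.
  rewrite /magnetic_diff; apply: (le_trans (ler_normcD _ _)).
  by rewrite normcN ComplexField.Normc.normcM expi_normc mul1r !normc_bump.
have [tx0|tx_neq0] := eqVneq (tent x) 0; have [ty0|ty_neq0] := eqVneq (tent y) 0.
- by rewrite (le_trans crude)// tx0 ty0 addr0 !mulr_ge0// addr_ge0.
- rewrite [\1_(cube 0 M) y]indicE (mem_set (tent_supp _ ty_neq0)).
  apply: (@le_trans _ _ (K * Num.min 1 D)); last by rewrite ler_peMr ?mulr_ge0// lerDr.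
  apply: (le_trans crude); rewrite tx0 add0r.
  have [D1|D1] := leP 1 D.
    by rewrite mulr1 (le_trans (tent_le y)).
  have := tent_lipschitz x y; rewrite tx0 sub0r normrN ger0_norm ?tent_ge0// -/D => H.
  by rewrite (le_trans H)// ler_wpM2r.
all: rewrite [\1_(cube 0 M) x]indicE (mem_set (tent_supp _ tx_neq0)).
all: apply: (@le_trans _ _ (K * Num.min 1 D)); last by rewrite ler_peMr ?mulr_ge0// lerDl.
(* Below [1/2] the cube of radius [2 D] contains [y] strictly and is small enough for the phase
   estimate. *)
all: have [D12|D12] := leP 2^-1 D.
1,3: apply: (le_trans crude); apply: (@le_trans _ _ (4 * M * 2^-1));
  first (by have := tent_le x; have := tent_le y; lra).
1,2: apply: ler_pM; rewrite ?mulr_ge0// le_min D12 andbT; lra.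
all: have minD : Num.min 1 D = D by apply/min_idPr; lra.
all: rewrite minD.
all: have [Dz|D_neq0] := eqVneq D 0.
1,3: by rewrite (enorm_eq0 _ _ Dz) magnetic_diff_diag ComplexField.Normc.normc0 mulr_ge0.
all: have D_gt0 : 0 < D by rewrite lt_neqAle eq_sym D_neq0.
all: have xy : cube x (2 * D) y by apply: mem_cube_enorm; rewrite -/D; lra.
all: have r0 : 0 <= 2 * D by lra.
all: have r1 : 2 * D <= 1 by lra.
all: have th := phase_le A x y _ _ _ r0 r1 (tent_supp _ tx_neq0) xy Ha.
all: rewrite (_ : L bump (x, y) = (expi (phase A (x, y)) - 1) * bump x + (bump x - bump y));
  last by rewrite /magnetic_diff /phase /=; ring.
all: apply: (le_trans (ler_normcD _ _)); rewrite ComplexField.Normc.normcM normc_bump.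
all: have e1 := le_trans (normc_expiB1_le _) (ler_wpM2l (ler0n R 2) th).
all: have e2 := ler_pM (normc_ge0 _) (tent_ge0 x) e1 (tent_le x).
all: have e3 : nc (bump x - bump y) <= 3 * D.
1,3: rewrite /bump -rmorphB; have := normcZ (tent x - tent y) 1;
  rewrite mulr1 ComplexField.Normc.normc1 mulr1 => ->; exact: tent_lipschitz.
all: apply: (le_trans (lerD e2 e3)); rewrite KE -subr_ge0.
all: rewrite [X in 0 <= X](_ : _ = 4 * M * D); first by rewrite !mulr_ge0.
all: ring.
Qed.

Definition cube_kernel (z : R3 * R3) : R :=
  kernel s p z * (\1_(cube 0 M) z.1 + \1_(cube 0 M) z.2).

(** The indicator of the first variable is integrated last, and so is that of the second: Tonelli is
    applied in both orders, with the uniform bound of the symmetric kernel inside and the finite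
    volume of the cube outside. *)
Lemma rintegrable_cube_kernel : rintegrable mu6 cube_kernel.
Proof.
have [c c0 Hc] := kernel_integral_le s p s0 s1 p1.
have mk := measurable_kernel s p; have mind := measurable_indic_cube (0 : R3) M.
have k0 z : 0 <= kernel s p z := kernel_ge0 s p z.
have mi1 : measurable_fun setT (fun z : R3 * R3 => \1_(cube 0 M) z.1 : R).
  exact: (measurableT_comp mind measurable_fst).
have mi2 : measurable_fun setT (fun z : R3 * R3 => \1_(cube 0 M) z.2 : R).
  exact: (measurableT_comp mind measurable_snd).
have slice (g : R3 -> R3 -> R) : (forall x, measurable_fun setT (g x)) ->
    (forall x y, 0 <= g x y) -> (forall x, \int[mu3]_y (g x y)%:E <= c%:E)%E ->
    (forall x, (\int[mu3]_y (g x y * \1_(cube 0 M) x)%:E <= (c * \1_(cube 0 M) x)%:E)%E).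
  move=> mg g0 gc x; rewrite indicE; case: (x \in cube 0 M).
    by under eq_integral do rewrite mulr1; rewrite mulr1.
  by under eq_integral do rewrite mulr0; rewrite integral0 mulr0.
have Hc' y : (\int[mu3]_x (kernel s p (x, y))%:E <= c%:E)%E.
  by under eq_integral do rewrite kernel_sym; exact: Hc.
have total : (\int[mu3]_x (c * \1_(cube 0 M) x)%:E <= (c * (2 * M) ^+ 3)%:E)%E.
  rewrite rintegrableE; last by apply: rintegrableZ; exact: rintegrable_cube.
  by rewrite lee_fin rintegralZ ?rintegral_cube//; exact: rintegrable_cube.
have m1 : measurable_fun setT (fun z => (kernel s p z * \1_(cube 0 M) z.1)%:E).
  by apply/measurable_EFinP; exact: measurable_funM.
have m2 : measurable_fun setT (fun z => (kernel s p z * \1_(cube 0 M) z.2)%:E).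
  by apply/measurable_EFinP; exact: measurable_funM.
have p1' z : (0 <= (kernel s p z * \1_(cube 0 M) z.1)%:E)%E by rewrite lee_fin mulr_ge0.
have p2' z : (0 <= (kernel s p z * \1_(cube 0 M) z.2)%:E)%E by rewrite lee_fin mulr_ge0.
apply: ge0_rintegrable.
- by apply: measurable_funM => //; exact: measurable_funD.
- by move=> z; rewrite mulr_ge0// addr_ge0.
apply: le_lt_trans (ltry (c * (2 * M) ^+ 3 + c * (2 * M) ^+ 3)).
apply: (le_integral_add mu6 _ (fun z => kernel s p z * \1_(cube 0 M) z.1)
  (fun z => kernel s p z * \1_(cube 0 M) z.2)).
- by apply: measurable_funM => //; exact: measurable_funD.
- exact/measurable_EFinP.
- exact/measurable_EFinP.
- by move=> z; rewrite mulr_ge0// addr_ge0.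
- by move=> z; rewrite mulr_ge0.
- by move=> z; rewrite mulr_ge0.
- by move=> z; rewrite /cube_kernel mulrDr.
- rewrite (@fubini_tonelli1 _ _ _ _ _ (@lebesgue3 R) (@lebesgue3 R) _ m1 p1').
  apply: le_trans total; apply: ge0_le_integral; first exact: measurableT.
  + by move=> x _; exact: integral_ge0.
  + exact: (@measurable_fun_fubini_tonelli_F _ _ _ _ _ (@lebesgue3 R) _ m1 p1').
  + by apply/measurable_EFinP; exact: measurable_funM.
  + by move=> x _; exact: (slice _ (fun x => measurable_fun_pair2 x mk) (fun x y => k0 (x, y)) Hc x).
- rewrite (@fubini_tonelli2 _ _ _ _ _ (@lebesgue3 R) (@lebesgue3 R) _ m2 p2').
  apply: le_trans total; apply: ge0_le_integral; first exact: measurableT.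
  + by move=> x _; exact: integral_ge0.
  + exact: (@measurable_fun_fubini_tonelli_G _ _ _ _ _ (@lebesgue3 R) _ m2 p2').
  + by apply/measurable_EFinP; exact: measurable_funM.
  + by move=> y _; exact: (slice _ (fun y => measurable_fun_pair1 y mk) (fun y x => k0 (x, y)) Hc' y).
Qed.

Lemma energy_space_bump : E bump.
Proof.
have mL : cmeasurable (L bump) by apply: cmeasurable_magnetic_diff => //; exact: cmeasurable_bump.
split; [exact: LQ_bump|exact: mL|].
have [K K0 HK] := bump_pointwise.
apply: (le_rintegrable mu6 _ (fun z => K `^ p * 2 `^ p * cube_kernel z)).
- by apply: measurable_funM; [exact: measurable_gagliardo_weight|exact: cmeasurable_normc_powR].
- move=> [x y]; have w0 : 0 <= w (x, y) := gagliardo_weight_ge0 s p (x, y).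
  rewrite ger0_norm ?mulr_ge0 ?powR_ge0//.
  set i := \1_(cube 0 M) x + \1_(cube 0 M) y : R.
  have i0 : 0 <= i by rewrite addr_ge0.
  (* [i] takes only the values 0, 1 and 2. *)
  have ip : i `^ p <= 2 `^ p * i.
    rewrite /i !indicE; case: (x \in _); case: (y \in _) => /=.
    - by rewrite -natrD ler_peMr ?powR_ge0// ler1n.
    - by rewrite addr0 powR1 mulr1 -[leLHS](powRr0 2) ler_powR ?ler1n ?(ltW p0).
    - by rewrite add0r powR1 mulr1 -[leLHS](powRr0 2) ler_powR ?ler1n ?(ltW p0).
    - by rewrite addr0 powR0 ?mulr0// gt_eqF.
  have m0 : 0 <= Num.min 1 (enorm (x - y)) by rewrite le_min ler01 enorm_ge0.
  have H : nc (L bump (x, y)) `^ p <= K `^ p * Num.min 1 (enorm (x - y)) `^ p * (2 `^ p * i).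
    apply: (@le_trans _ _ ((K * Num.min 1 (enorm (x - y)) * i) `^ p)).
      by rewrite ge0_ler_powR ?(ltW p0) ?nnegrE ?normc_ge0 ?mulr_ge0.
    by rewrite !powRM ?mulr_ge0// ler_wpM2l// mulr_ge0 ?powR_ge0.
  apply: (le_trans (ler_wpM2l w0 H)); apply: eq_ler; rewrite /cube_kernel /kernel /= -/i; ring.
- by apply: rintegrableZ; exact: rintegrable_cube_kernel.
Qed.

End bump.

Section positive_test_function.
Context {R : realType}.
Local Notation R3 := (R3 R).
Local Notation mu3 := (@lebesgue3 R).
Local Notation nc := (@ComplexField.Normc.normc R).

(** If every bump had a vanishing term, the weight would vanish a.e. where the bumps of integer size
    are positive, and these sets cover the space. *)
Lemma exists_bump_pterm_gt0 (Q q : R) (h : R3 -> R) : 0 < q -> q <= Q ->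
  admissible mu3 Q 1 (cst 1) h -> (forall M : R, 0 <= M -> LQ mu3 Q (bump M)) ->
  ~ {ae mu3, forall x, h x `^ (Q - q) = 0} ->
  exists2 M : R, 0 <= M & 0 < pterm mu3 Q (cst 1) h q (bump M).
Proof.
move=> q0 qQ adm bQ Hn0; apply: contrapT => nex; apply: Hn0.
have ae0 (n : nat) : {ae mu3, forall x, pweight Q (cst 1) h q x * nc (bump n%:R x) `^ q = 0}.
  have I := rintegrable_pterm mu3 Q 1 (cst 1) h ler01 adm q _ q0 qQ (bQ n%:R (ler0n _ n)).
  have P0 := pterm_ge0 mu3 Q 1 (cst 1) h adm q (bump n%:R).
  have z0 : pterm mu3 Q (cst 1) h q (bump n%:R) = 0.
    apply/eqP; rewrite eq_le P0 andbT leNgt; apply/negP => H.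
    by apply: nex; exists n%:R.
  rewrite ptermE in z0.
  have z1 : (\int[mu3]_x `|(pweight Q (cst 1) h q x * nc (bump n%:R x) `^ q)%:E| = 0)%E.
    under eq_integral => x _.
      rewrite gee0_abs; last first.
        by rewrite lee_fin mulr_ge0 ?powR_ge0//; exact: (pweight_ge0 mu3 Q 1).
      over.
    by rewrite rintegrableE// z0.
  have /measurable_EFinP mI := rintegrable_measurable mu3 _ I.
  have := (ae_eq_integral_abs mu3 measurableT mI).1 z1.
  by apply: filterS => x /(_ Logic.I) /= [].
apply: filterS (ae_foralln ae0) => x Hx.
pose a := `|x.1.1| + `|x.1.2| + `|x.2|.
have a0 : 0 <= a by rewrite !addr_ge0.
have := Hx (Num.truncn a).+1; rewrite normc_bump /pweight /= mul1r => /eqP.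
rewrite mulf_eq0 => /orP[/eqP //|]; rewrite powR_eq0 => /andP[/eqP t0 _].
have : 0 < tent (Num.truncn a).+1%:R x.
  by rewrite lt_max subr_gt0 [X in _ || X](truncnS_gt a) orbT.
by rewrite t0 ltxx.
Qed.

End positive_test_function.

(** * From the function spaces of the theorem to the variational problem *)

Section Lfun_facts.
Context {d} {T : measurableType d} {R : realType}.
Variable mu : {measure set T -> \bar R}.

Lemma ge0_LfunP (f : T -> R) (r : R) : 1 <= r -> (forall x, 0 <= f x) ->
  f \in Lfun mu r%:E <-> measurable_fun setT f /\ rintegrable mu (fun x => f x `^ r).
Proof.
move=> r1 f0; split.
  move=> fL; split; first by have := sub_Lfun_mfun fL; rewrite inE.
  have := Lfun_integrable r1 fL.
  by under [X in _.-integrable _ X]eq_fun do rewrite ger0_norm//.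
move=> [mf fi]; rewrite inE; apply/andP; split; rewrite inE/=; first exact: mf.
rewrite /finite_norm unlock /= poweR_lty//.
under eq_integral => x _ do rewrite /= ger0_norm//.
by apply: (rintegrable_lty _ _ fi) => x; exact: powR_ge0.
Qed.

Lemma Lfun_oo_ae_bounded (f : T -> R) : f \in Lfun mu +oo%E ->
  exists2 C : R, 0 <= C & {ae mu, forall x, f x <= C}.
Proof.
move=> fL; have : (Lnorm mu +oo (EFin \o f) < +oo)%E.
  by move: fL; rewrite inE => /andP[_]; rewrite inE.
(* The norm at infinity is defined by cases; on a space of measure zero any bound holds almost
   everywhere. *)
rewrite unlock; case: ifPn => [_ foo|]; last first.
  rewrite -leNgt => mu0 _; exists 0 => //; exists setT; split => //.
  by apply/eqP; rewrite eq_le mu0/=.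
exists (fine (Order.max (0 : \bar R) (ess_sup_inf.ess_sup mu (abse \o (EFin \o f)))))%E.
  by rewrite fine_ge0// le_max lexx.
have := ess_sup_inf.ess_sup_ge mu (abse \o (EFin \o f)); apply: filterS => x /= fx.
rewrite -lee_fin fineK; last first.
  by rewrite ge0_fin_numE ?le_max ?lexx// gt_max ltry foo.
by rewrite le_max (le_trans _ fx) ?orbT// lee_fin ler_norm.
Qed.

Lemma ae_eq_Rintegral (f g : T -> R) : measurable_fun setT f ->
  measurable_fun setT g -> {ae mu, forall x, f x = g x} ->
  \int[mu]_x f x = \int[mu]_x g x.
Proof.
move=> mf mg fg; rewrite /Rintegral; congr fine; apply: ae_eq_integral => //.
- exact/measurable_EFinP.
- exact/measurable_EFinP.
- by apply: filterS fg => x -> .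
Qed.

End Lfun_facts.

Section gaussian.
Context {R : realType}.
Local Notation mu3 := (@lebesgue3 R).

(** Serves as an everywhere positive integrable function, the source of the weight [W]. *)
Definition gaussian3 (x : R3 R) : R :=
  normal_pdf 0 1 x.1.1 * normal_pdf 0 1 x.1.2 * normal_pdf 0 1 x.2.

Lemma gaussian3_gt0 x : 0 < gaussian3 x.
Proof.
by rewrite /gaussian3 normal_pdfE ?oner_eq0// !mulr_gt0 ?expR_gt0 ?normal_peak_gt0 ?oner_eq0.
Qed.

Lemma measurable_gaussian3 : measurable_fun setT gaussian3.
Proof.
by apply: measurable_funM; [apply: measurable_funM|];
  apply: (measurableT_comp (measurable_normal_pdf _ _));
  [exact: measurable_fst11|exact: measurable_fst12|exact: measurable_snd3].
Qed.

Let integral_scaled_normal (c : R) : 0 <= c ->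
  (\int[lebesgue_measure]_x (c * normal_pdf 0 1 x)%:E = c%:E)%E.
Proof.
move=> c0; under eq_integral do rewrite EFinM.
rewrite ge0_integralZl_EFin//.
- by rewrite integral_normal_pdf mule1.
- by move=> x _; rewrite lee_fin normal_pdf_ge0.
- by apply/measurable_EFinP; exact: measurable_normal_pdf.
Qed.

Lemma rintegrable_gaussian3 : rintegrable mu3 gaussian3.
Proof.
apply: ge0_rintegrable; first exact: measurable_gaussian3.
  by move=> x; exact: ltW (gaussian3_gt0 x).
have g0 := @normal_pdf_ge0 R 0 1; have mg := @measurable_normal_pdf R 0 1.
rewrite (fubini_tonelli1 (m1 := @lebesgue2 R) (m2 := lebesgue_measure)); last 2 first.
  by apply/measurable_EFinP; exact: measurable_gaussian3.
  by move=> x; rewrite lee_fin ltW// gaussian3_gt0.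
rewrite [ltLHS](_ : _ = \int[@lebesgue2 R]_y
    (normal_pdf 0 1 y.1 * normal_pdf 0 1 y.2)%:E)%E; last first.
  by apply: eq_integral => y _; rewrite /fubini_F -[RHS]integral_scaled_normal// mulr_ge0.
rewrite (fubini_tonelli1 (m1 := lebesgue_measure) (m2 := lebesgue_measure)); last 2 first.
  apply/measurable_EFinP/measurable_funM; first exact: (measurableT_comp mg measurable_fst).
  exact: (measurableT_comp mg measurable_snd).
  by move=> x; rewrite lee_fin mulr_ge0.
rewrite [ltLHS](_ : _ = \int[lebesgue_measure]_y (normal_pdf 0 1 y)%:E)%E; last first.
  by apply: eq_integral => y _; rewrite /fubini_F -[RHS]integral_scaled_normal.
by rewrite integral_normal_pdf ltry.
Qed.

End gaussian.

Section function_spaces.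
Context {R : realType}.
Local Notation mu3 := (@lebesgue3 R).
Local Notation mu6 := (@lebesgue3 R \x @lebesgue3 R)%E.
Local Notation nc := (@ComplexField.Normc.normc R).
Variables (A : R3 R -> R3 R) (s p : R).
Hypotheses (cA : continuous A) (s0 : 0 < s) (p1 : 1 < p) (sp3 : s * p < 3).
Local Notation Q := (pstar s p).
Local Notation w := (gagliardo_weight s p).
Local Notation L := (magnetic_diff A).

Let p0 : 0 < p. Proof. exact: lt_trans p1. Qed.
Let Q1 : 1 < Q. Proof. exact: lt_trans p1 (lt_pstar _ _ s0 p1 sp3). Qed.

Let seminormE (u : R3 R -> R[i]) : magnetic_seminorm A s p u =
  ((\int[mu6]_z (w z * nc (L u z) `^ p)%:E) `^ p^-1)%E.
Proof.
by rewrite /magnetic_seminorm; congr poweR; apply: eq_integral => z _; rewrite mulrC.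
Qed.

Lemma DspaceP (u : R3 R -> R[i]) :
  Dspace A s p u <-> energy_space mu3 mu6 p Q w L u.
Proof.
rewrite /Dspace /energy_space /= seminormE.
have wL0 z : 0 <= w z * nc (L u z) `^ p by rewrite mulr_ge0 ?powR_ge0 ?gagliardo_weight_ge0.
have p'0 : p^-1 != 0 by rewrite invr_neq0 ?gt_eqF.
split.
  move=> [[mu_ /(ge0_LfunP _ _ _ (ltW Q1) (fun x => normc_ge0 (u x)))[_ ui]] fin].
  have mL : cmeasurable (L u) by exact: cmeasurable_magnetic_diff.
  split => //; apply: ge0_rintegrable => //.
    by apply: measurable_funM; [exact: measurable_gagliardo_weight|exact: cmeasurable_normc_powR].
  by rewrite ltNge leye_eq; apply: contraTN fin => /eqP ->; rewrite poweRyr ?ltxx.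
move=> [[mu_ ui] mL Li]; split.
  split => //; apply/(ge0_LfunP _ _ _ (ltW Q1) (fun x => normc_ge0 (u x))).
  by split => //; exact: cmeasurable_normc.
by rewrite poweR_lty//; exact: rintegrable_lty.
Qed.

Lemma magnetic_seminorm_powR (u : R3 R -> R[i]) : Dspace A s p u ->
  fine (magnetic_seminorm A s p u) `^ p = dirichlet mu6 p w L u.
Proof.
move=> /DspaceP uE; have [_ _ Li] := uE; have N0 := dirichlet_ge0 mu6 p w L
  (gagliardo_weight_ge0 s p) u.
rewrite seminormE rintegrableE// -dirichletE poweR_EFin /= -powRrM mulVf ?gt_eqF//.
by rewrite powRr1.
Qed.

End function_spaces.

Section weak_form.
Context {d} {T : measurableType d} {R : realType}.
Variable mu : {measure set T -> \bar R}.
Local Notation nc := (@ComplexField.Normc.normc R).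

Lemma Re_Cintegral_cdual (f : T -> R) (e : R) (u v : T -> R[i]) :
  complex.Re (Cintegral mu (fun x =>
    (f x)%:C%C * Cpow_duality e (u x) * conjc (v x))) =
  \int[mu]_x (f x * cdual e (u x) (v x)).
Proof.
rewrite /Cintegral /=; congr Rintegral; apply/funext => x.
by rewrite -mulrA complexReZ Re_Cpow_duality.
Qed.

Variables (Q e : R) (f k h : T -> R) (u : T -> R[i]).
Hypotheses (mf : measurable_fun setT f) (mk : measurable_fun setT (pweight Q k h e)).
Hypothesis fk : {ae mu, forall x, f x = pweight Q k h e x}.
Hypothesis mu_ : cmeasurable u.

Lemma ae_eq_dpterm (v : T -> R[i]) : cmeasurable v ->
  \int[mu]_x (f x * cdual e (u x) (v x)) = dpterm mu Q k h e u v.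
Proof.
move=> mv; rewrite dptermE; apply: ae_eq_Rintegral.
- by apply: measurable_funM => //; exact: cmeasurable_cdual.
- by apply: measurable_funM => //; exact: cmeasurable_cdual.
- by apply: filterS fk => x ->.
Qed.

Lemma ae_eq_pterm : \int[mu]_x (f x * nc (u x) `^ e) = pterm mu Q k h e u.
Proof.
rewrite ptermE; apply: ae_eq_Rintegral.
- by apply: measurable_funM => //; exact: cmeasurable_normc_powR.
- by apply: measurable_funM => //; exact: cmeasurable_normc_powR.
- by apply: filterS fk => x ->.
Qed.

End weak_form.

Theorem theorem1p1 (R : realType) (s p q : R) (A : R3 R -> R3 R)
    (H K : R3 R -> R) :
  0 < s -> s < 1 -> 1 < p -> s * p < 3 -> p < q -> q < pstar s p ->
  continuous A -> locally_bounded_gradient A ->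
  {ae @lebesgue3 R, forall x, 0 <= H x} ->
  H \in Lfun (@lebesgue3 R) (pstar s p / (pstar s p - q))%:E ->
  ~ {ae @lebesgue3 R, forall x, H x = 0} ->
  (forall x, 0 <= K x) ->
  K \in Lfun (@lebesgue3 R) +oo%E -> continuous K ->
  ~ {ae @lebesgue3 R, forall x, K x = 0} ->
  (exists Omega : set (R3 R),
     [/\ measurable Omega, (0 < lebesgue3 Omega)%E &
         {ae @lebesgue3 R, forall x, Omega x -> 0 < H x}]) ->
  exists2 lambda_star : R, 0 < lambda_star &
    forall lambda : R, lambda_star < lambda ->
      exists u : R3 R -> R[i],
        [/\ weak_solution A s p q lambda H K u,
            ~ {ae @lebesgue3 R, forall x, u x = 0} &
            0 < energy A s p q lambda H K u].
Proof.
move=> s0 s1 p1 sp3 pq qQ cA _ H0 HL Hn0 K0 KL cK _ _.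
set mu3 := @lebesgue3 R; set mu6 := (@lebesgue3 R \x @lebesgue3 R)%E.
set nc := @ComplexField.Normc.normc R.
set Q := pstar s p in qQ HL *.
have pQ : p < Q by exact: lt_pstar.
have p0 : 0 < p by exact: lt_trans p1.
have q0 : 0 < q by exact: lt_trans pq.
have q1 : 1 < q by exact: lt_trans pq.
have Q0 : 0 < Q by exact: lt_trans qQ.
have Q1 : 1 < Q by exact: lt_trans qQ.
have Qq : 0 < Q - q by rewrite subr_gt0.
have mH : measurable_fun setT H by have := sub_Lfun_mfun HL; rewrite inE.
have mK : measurable_fun setT K by exact: continuous_measurable3.
have [C C0 KC] := Lfun_oo_ae_bounded mu3 K KL.
(* [H] and [K] are changed on null sets, so as to be nonnegative and bounded
   everywhere. *)
pose Hp x := Num.max (H x) 0; pose Kp x := Num.min (K x) C.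
(* The exponents are set so that [h^(Q-q)] is [Hp] and [h^Q] is [Hp^(Q/(Q-q))], integrable by the
   assumption on [H]; likewise [W^Q] is the Gaussian. *)
pose h x := Hp x `^ (Q - q)^-1; pose W x := gaussian3 x `^ Q^-1.
have Hp0 x : 0 <= Hp x by rewrite le_max lexx orbT.
have mHp : measurable_fun setT Hp by exact: measurable_maxr.
have mKp : measurable_fun setT Kp by exact: measurable_minr.
have hE x : pweight Q (cst 1) h q x = Hp x.
  by rewrite /pweight /= mul1r /h -powRrM mulVf ?gt_eqF// powRr1.
have KpE x : pweight Q Kp W Q x = Kp x.
  by rewrite /pweight subrr powRr0 mulr1.
have r1 : 1 <= Q / (Q - q) by rewrite ler_pdivlMr// mul1r gerBl ltW.
have admH : admissible mu3 Q 1 (cst 1) h.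
  split=> [|x||x|].
  - exact: measurable_cst.
  - by rewrite /= ler01 lexx.
  - exact: (measurableT_comp (measurable_powR _)).
  - exact: powR_ge0.
  - apply: (le_rintegrable _ _ _ _ _ (Lfun_integrable r1 HL)).
      by apply: (measurableT_comp (measurable_powR _)); exact: (measurableT_comp (measurable_powR _)).
    move=> x; rewrite ger0_norm ?powR_ge0// /h -powRrM mulrC.
    rewrite ge0_ler_powR ?nnegrE ?(le_trans _ r1)//.
    by rewrite ge_max ler_norm normr_ge0.
have W0 x : 0 < W x by rewrite powR_gt0// gaussian3_gt0.
have mW : measurable_fun setT W.
  exact: (measurableT_comp (measurable_powR _) measurable_gaussian3).
have admK : admissible mu3 Q C Kp W.
  split=> // [x|x|].
  - by rewrite ge_min lexx orbT andbT le_min K0.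
  - exact: ltW.
  - rewrite (_ : (fun x => _) = @gaussian3 R); first exact: rintegrable_gaussian3.
    by apply/funext => x; rewrite /W -powRrM mulVf ?gt_eqF// powRr1// ltW// gaussian3_gt0.
have HH : {ae mu3, forall x, H x = pweight Q (cst 1) h q x}.
  by apply: filterS H0 => x Hx; rewrite hE /Hp max_l.
have KK : {ae mu3, forall x, K x = pweight Q Kp W Q x}.
  by apply: filterS KC => x Kx; rewrite KpE /Kp min_l.
have [M M0 phi0] := exists_bump_pterm_gt0 Q q h q0 (ltW qQ) admH
  (LQ_bump s p s0 p1 sp3) ltac:(move=> h0; apply: Hn0; apply: filterS2 HH h0 => x -> ;
    by rewrite /pweight mul1r).
have [lam0 lam00 Hlam] := critical_solution mu3 mu6 p Q (sobolev_constant s p)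
  (gagliardo_weight s p) (magnetic_diff A) p1 pQ (powR_ge0 _ _)
  (measurable_gagliardo_weight s p) (gagliardo_weight_ge0 s p) (magnetic_diff_lin A)
  (sobolev_inequality A s p cA s0 p1 sp3) (magnetic_bounded_compact A s p cA s0 p1 sp3)
  C q h Kp W C0 admH admK W0 pq qQ (bump M) (energy_space_bump A s p cA s0 s1 p1 sp3 M M0) phi0.
exists lam0 => // lam lam0lam; have [u [uE uH uN usol]] := Hlam lam lam0lam.
have lam_gt0 : 0 < lam by exact: lt_trans lam0lam.
have [[mu_ _] _ _] := uE.
have mpH := measurable_pweight mu3 Q 1 (cst 1) h admH q.
have mpK := measurable_pweight mu3 Q C Kp W admK Q.
have uD : Dspace A s p u by apply/DspaceP.
exists u; split.
- split=> // v /(DspaceP _ _ _ cA s0 p1 sp3) vE; have [[mv _] _ _] := vE.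
  rewrite [RHS]complexReD [X in _ = X + _]complexReZ.
  rewrite [X in _ = _ * X + _](Re_Cintegral_cdual mu3 H q u v).
  rewrite [X in _ = _ + X](Re_Cintegral_cdual mu3 K Q u v).
  rewrite (ae_eq_dpterm mu3 Q q H (cst 1) h u mH mpH HH mu_ v mv).
  rewrite (ae_eq_dpterm mu3 Q Q K Kp W u mK mpK KK mu_ v mv).
  rewrite -usol// ddirichletE /Cintegral /=; congr Rintegral; apply/funext => z.
  by rewrite -fmorphV mulrC complexReZ Re_Cpow_duality.
- move=> u0; move: uH; rewrite -(ae_eq_pterm mu3 Q q H (cst 1) h u mH mpH HH mu_).
  suff -> : \int[mu3]_x (H x * nc (u x) `^ q) = 0 by rewrite ltxx.
  transitivity (\int[mu3]_x (cst (0 : R) x)); last by rewrite /Rintegral integral0.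
  apply: ae_eq_Rintegral => //.
    by apply: measurable_funM => //; exact: cmeasurable_normc_powR.
  apply: filterS u0 => x ->.
  by rewrite /nc ComplexField.Normc.normc0 powR0 ?mulr0// gt_eqF.
- have NE : dirichlet mu6 p (gagliardo_weight s p) (magnetic_diff A) u =
      lam * pterm mu3 Q (cst 1) h q u + pterm mu3 Q Kp W Q u.
    by have := usol u uE; rewrite ddirichletzz// !dptermzz.
  rewrite /energy -/mu3 -/Q (magnetic_seminorm_powR A s p cA s0 p1 sp3 u uD).
  rewrite (ae_eq_pterm mu3 Q q H (cst 1) h u mH mpH HH mu_).
  rewrite (ae_eq_pterm mu3 Q Q K Kp W u mK mpK KK mu_) NE.
  have BK := pterm_ge0 mu3 Q C Kp W admK Q u.
  set BH := pterm _ _ (cst 1) _ _ _ in uH *; set B := pterm _ _ _ _ _ _ in BK *.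
  have -> : p^-1 * (lam * BH + B) - lam / q * BH - Q^-1 * B =
      (p^-1 - q^-1) * (lam * BH) + (p^-1 - Q^-1) * B by ring.
  rewrite ltr_pwDl ?mulr_gt0 ?mulr_ge0 ?subr_ge0 ?subr_gt0//.
    by rewrite ltf_pV2.
  by rewrite ltW// ltf_pV2.
Qed.
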